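(* Let $(M^{2n+1},J,\theta)$ be a pseudohermitian manifold whose contact bundle $\xi=\ker\theta$ is endowed with a spin structure, let $\mathbb S$ be the associated spinor bundle with spin connection $\nabla$, and let $D_\xi$ be the contact Dirac operator. Then on $\Gamma(\mathbb S)$ $$D_\xi^2=\nabla^*\nabla+W-2\sum_{\beta=1}^ne_\beta e_{n+\beta}\nabla_T,$$ where $W$ is the Tanaka-Webster scalar curvature, $T$ is the Reeb vector field, $\{e_1,\dots,e_{2n}\}$ is any local orthonormal frame of $\xi$ with $e_{n+\beta}=Je_\beta$, and $e_\beta e_{n+\beta}$ acts by Clifford multiplication.
   Context: A pseudohermitian manifold $(M^{2n+1},J,\theta)$: contact form $\theta$ with contact bundle $\xi=\ker\theta$, $J:\xi\to\xi$, $J^2=-1$, $[\xi_{1,0},\xi_{1,0}]\subset\xi_{1,0}$, with Levi metric $\langle X,Y\rangle=L_\theta(X,Y)=\frac12d\theta(X,JY)$ on $\xi$ positive definite (convention $\eta\wedge\vartheta(V,W)=\eta(V)\vartheta(W)-\eta(W)\vartheta(V)$). $T$ is the Reeb field: $\theta(T)=1$, $\mathcal L_T\theta=0$. A unitary coframe $\{\theta^\alpha\}$ of $(1,0)$-forms vanishing on $T$ satisfies $d\theta=i\sum_\alpha\theta^\alpha\wedge\theta^{\bar\alpha}$; the dual frame is $Z_\alpha=\frac12(e_\alpha-ie_{n+\alpha})$ with $\{e_a\}$ orthonormal and $e_{n+\alpha}=Je_\alpha$. Connection forms $\theta_\alpha{}^\beta$ and torsion forms $\tau^\beta=A^\beta{}_{\bar\gamma}\theta^{\bar\gamma}$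 are determined by $d\theta^\beta=\theta^\alpha\wedge\theta_\alpha{}^\beta+\theta\wedge\tau^\beta$, $\theta_\alpha{}^\beta+\overline{\theta_\beta{}^\alpha}=0$, $\sum_\beta\overline{\tau^\beta}\wedge\theta^\beta=0$. The pseudohermitian connection is $\nabla^{p.h.}Z_\alpha=\theta_\alpha{}^\beta\otimes Z_\beta$, $\nabla^{p.h.}T=0$; it is real and metric on $\xi$. $R_\alpha{}^\beta{}_{\rho\bar\sigma}$ is the coefficient of $\theta^\rho\wedge\theta^{\bar\sigma}$ in $d\theta_\alpha{}^\beta-\theta_\alpha{}^\gamma\wedge\theta_\gamma{}^\beta$, and $W=\sum_{\alpha,\gamma}R_\gamma{}^\gamma{}_{\alpha\bar\alpha}$. Spinors: $\xi$ is oriented so that $(e_1,\dots,e_{2n})$ is positive; a spin structure $Spin(\xi)$ is a principal $Spin(2n)$-bundle double covering $SO(\xi)$ equivariantly. Clifford relations: $e_ae_b+e_be_a=-2\delta_{ab}$. $\mathbb S$ is the complex spinor bundle associated with the irreducible complex module $S(2n)$ of the Clifford algebra. The spin connection $\nabla$ on $\mathbb S$ is the lift of $\nabla^{p.h.}|_\xi$; in a local spin frame over $\{e_a\}$, $\nabla\varphi=d\varphi+\frac14\sum_{a,b}\langle\nabla^{p.h.}e_a,e_b\rangle e_ae_b\cdot\varphi$. $\nabla^2_{V,U}\varphi=\nabla_V\nabla_U\varphi-\nabla_{\nabla^{p.h.}_VU}\varphi$ and $\nabla^*\nabla=-\sum_{a=1}^{2n}\nabla^2_{e_a,e_a}$ (only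 horizontal directions). Contact Dirac operator: $D_\xi\varphi=\sum_{a=1}^{2n}e_a\cdot\nabla_{e_a}\varphi$. *)

(* Defs.v *)
From HB Require Import structures.
From mathcomp Require Import all_boot all_order all_algebra.
From mathcomp Require Import complex.
From mathcomp Require Import all_classical all_reals all_analysis.

Set Implicit Arguments.
Unset Strict Implicit.
Unset Printing Implicit Defensive.

Import Order.TTheory GRing.Theory Num.Theory.
Import numFieldNormedType.Exports.

Local Open Scope classical_set_scope.
Local Open Scope ring_scope.

(* gives R[i], hence the matrices over R[i], their usual topology *)
HB.instance Definition _ (R : rcfType) := NormedModule.copy R[i] R[i]^o.

Fixpoint Ck (R : realType) (m k : nat) (D : set 'rV[R]_m)
    (f : 'rV[R]_m -> R) : Prop :=
  if k is k'.+1 then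
    (forall x, D x -> differentiable f x) /\
    (forall j, Ck k' D (fun x => 'D_(delta_mx 0 j) f x))
  else forall x, D x -> {for x, continuous f}.

Definition Cinfty (R : realType) (m : nat) (D : set 'rV[R]_m)
    (f : 'rV[R]_m -> R) : Prop := forall k, Ck k D f.

(* The atlas is indexed by the points of M: chart p is a chart around p, with
   domain cdom p and inverse cinv p.  All functions are total; their values
   outside of the relevant domain are irrelevant. *)
Record manifold (R : realType) (m : nat) (M : topologicalType) := Manifold {
  chart : M -> M -> 'rV[R]_m;
  cinv : M -> 'rV[R]_m -> M;
  cdom : M -> set M;
  manifold_hausdorff : hausdorff_space M;
  manifold_second_countable : @second_countable M;
  cdom_open : forall p, open (cdom p);
  cdom_center : forall p, cdom p p;
  chart_open : forall p, open (chart p @` cdom p);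
  chartK : forall p q, cdom p q -> cinv p (chart p q) = q;
  chart_continuous : forall p, {within cdom p, continuous (chart p)};
  cinv_continuous : forall p,
    {within chart p @` cdom p, continuous (cinv p)};
  transition_smooth : forall p q k,
    Cinfty (chart p @` (cdom p `&` cdom q))
           (fun x => chart q (cinv p x) 0 k) }.

Section Calculus.
Context {R : realType} {m : nat} {M : topologicalType}.
Variable mfd : manifold R m M.

Definition smooth (U : set M) (f : M -> R) : Prop :=
  forall p, Cinfty (chart mfd p @` (cdom mfd p `&` U)) (f \o cinv mfd p).

Definition csmooth (U : set M) (f : M -> R[i]) : Prop :=
  smooth U (fun q => complex.Re (f q)) /\ smooth U (fun q => complex.Im (f q)).

(* A tangent vector at p is given by its coordinates v in chart p;
   der v f p is the derivative of f at p along v. *)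
Definition der (v : 'rV[R]_m) (f : M -> R) (p : M) : R :=
  'D_v (f \o cinv mfd p) (chart mfd p p).

Definition cder (v : 'rV[R]_m) (f : M -> R[i]) (p : M) : R[i] :=
  Complex (der v (fun q => complex.Re (f q)) p)
          (der v (fun q => complex.Im (f q)) p).

(* A vector field X maps p to the coordinates of X_p in chart p. *)
Definition smooth_vf (U : set M) (X : M -> 'rV[R]_m) : Prop :=
  forall (V : set M) f, open V -> V `<=` U -> smooth V f ->
    smooth V (fun q => der (X q) f q).

(* [X, Y] f = X (Y f) - Y (X f), applied to the coordinates of chart p *)
Definition bracket (X Y : M -> 'rV[R]_m) (p : M) : 'rV[R]_m :=
  \row_k (der (X p) (fun q => der (Y q) (fun r => chart mfd p r 0 k) q) p -
          der (Y p) (fun q => der (X q) (fun r => chart mfd p r 0 k) q) p).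

(* A 1-form is a column vector (in chart p) at each p: real forms pair with
   tangent vectors by ev, complex forms by cev. *)
Definition ev (eta : 'cV[R]_m) (v : 'rV[R]_m) : R := (v *m eta) 0 0.

Definition cev (eta : 'cV[R[i]]_m) (v : 'rV[R]_m) : R[i] :=
  (map_mx (real_complex R) v *m eta) 0 0.

Definition smooth_form (U : set M) (eta : M -> 'cV[R]_m) : Prop :=
  forall (V : set M) X, open V -> V `<=` U -> smooth_vf V X ->
    smooth V (fun q => ev (eta q) (X q)).

Definition csmooth_form (U : set M) (eta : M -> 'cV[R[i]]_m) : Prop :=
  forall (V : set M) X, open V -> V `<=` U -> smooth_vf V X ->
    csmooth V (fun q => cev (eta q) (X q)).

(* the vector field on cdom p with constant coordinates u in chart p *)
Definition cst_vf (p : M) (u : 'rV[R]_m) (q : M) : 'rV[R]_m :=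
  'D_u (chart mfd q \o cinv mfd p) (chart mfd p q).

(* d eta (X, Y) = X (eta Y) - Y (eta X) - eta [X, Y], evaluated on the
   commuting extensions cst_vf p u and cst_vf p v of u and v *)
Definition dform (eta : M -> 'cV[R]_m) (p : M) (u v : 'rV[R]_m) : R :=
  der u (fun q => ev (eta q) (cst_vf p v q)) p -
  der v (fun q => ev (eta q) (cst_vf p u q)) p.

Definition cdform (eta : M -> 'cV[R[i]]_m) (p : M) (u v : 'rV[R]_m) : R[i] :=
  cder u (fun q => cev (eta q) (cst_vf p v q)) p -
  cder v (fun q => cev (eta q) (cst_vf p u q)) p.

Definition wedge (a b : 'cV[R[i]]_m) (u v : 'rV[R]_m) : R[i] :=
  cev a u * cev b v - cev a v * cev b u.

Definition conj_form (a : 'cV[R[i]]_m) : 'cV[R[i]]_m := map_mx conjc a.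

(* the complex tangent vector x + i y *)
Definition cvec (x y : 'rV[R]_m) : 'rV[R[i]]_m :=
  map_mx (real_complex R) x + Complex 0 1 *: map_mx (real_complex R) y.

(* B (x + i y, z + i w) for the complex bilinear extension of B *)
Definition cbil (B : 'rV[R]_m -> 'rV[R]_m -> R[i]) (x y z w : 'rV[R]_m) : R[i] :=
  B x z - B y w + Complex 0 1 * (B x w + B y z).

End Calculus.

Section Pseudohermitian.
Context {R : realType} {n : nat} {M : topologicalType}.
Local Notation m := (n + n).+1.
Variable mfd : manifold R m M.

Definition levi (theta : M -> 'cV[R]_m) (J : M -> 'M[R]_m) (p : M)
    (u v : 'rV[R]_m) : R := 2^-1 * dform mfd theta p u (v *m J p).

(* x + i y lies in xi_{1,0} at p, i.e. x, y \in xi and J (x + i y) = i (x + i y) *)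
Definition type10 (theta : M -> 'cV[R]_m) (J : M -> 'M[R]_m) (p : M)
    (x y : 'rV[R]_m) : Prop :=
  [/\ ev (theta p) x = 0, ev (theta p) y = 0, x *m J p = - y & y *m J p = x].

(* J p acts on row vectors, by v *m J p; only its restriction to
   xi = ker theta is meaningful. *)
Record pseudohermitian := Pseudohermitian {
  theta : M -> 'cV[R]_m;
  J : M -> 'M[R]_m;
  reeb : M -> 'rV[R]_m;
  theta_smooth : smooth_form mfd setT theta;
  J_smooth : forall (U : set M) X, open U -> smooth_vf mfd U X ->
    (forall q, U q -> ev (theta q) (X q) = 0) ->
    smooth_vf mfd U (fun q => X q *m J q);
  J_xi : forall p v, ev (theta p) v = 0 -> ev (theta p) (v *m J p) = 0;
  J_sq : forall p v, ev (theta p) v = 0 -> v *m J p *m J p = - v;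
  J_integrable : forall (U : set M) (X Y V W : M -> 'rV[R]_m), open U ->
    smooth_vf mfd U X -> smooth_vf mfd U Y ->
    smooth_vf mfd U V -> smooth_vf mfd U W ->
    (forall q, U q -> type10 theta J q (X q) (Y q)) ->
    (forall q, U q -> type10 theta J q (V q) (W q)) ->
    forall q, U q ->
      type10 theta J q (bracket mfd X V q - bracket mfd Y W q)
                       (bracket mfd X W q + bracket mfd Y V q);
  levi_pos : forall p v, ev (theta p) v = 0 -> v != 0 ->
    0 < levi theta J p v v;
  reeb_smooth : smooth_vf mfd setT reeb;
  theta_reeb : forall p, ev (theta p) (reeb p) = 1;
  (* (L_T theta)(X) = T (theta X) - theta [T, X] *)
  lie_reeb_theta : forall (U : set M) X, open U -> smooth_vf mfd U X ->
    forall p, U p ->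
      der mfd (reeb p) (fun q => ev (theta q) (X q)) p -
      ev (theta p) (bracket mfd reeb X p) = 0 }.

Variable ph : pseudohermitian.
Local Notation metric := (levi (theta ph) (J ph)).

Definition orthonormal (p : M) (E : 'I_(n + n) -> 'rV[R]_m) : Prop :=
  (forall a, ev (theta ph p) (E a) = 0) /\
  (forall a b, metric p (E a) (E b) = (a == b)%:R).

(* e_{n + beta} = J e_beta, where e_beta is E (lshift n beta) and e_{n + beta}
   is E (rshift n beta) *)
Definition adapted (p : M) (E : 'I_(n + n) -> 'rV[R]_m) : Prop :=
  orthonormal p E /\
  (forall b : 'I_n, E (rshift n b) = E (lshift n b) *m J ph p).

Definition frame_act (E : 'I_(n + n) -> 'rV[R]_m) (A : 'M[R]_(n + n)) :
    'I_(n + n) -> 'rV[R]_m :=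
  fun a => \sum_b A b a *: E b.

(* the fibre at p of SO(xi): orthonormal bases of xi_p with the same
   orientation as the adapted ones *)
Definition SO_frame (p : M) (E : 'I_(n + n) -> 'rV[R]_m) : Prop :=
  orthonormal p E /\
  exists F A, [/\ adapted p F, 0 < \det A & E = frame_act F A].

Definition smooth_frame (U : set M) (e : 'I_(n + n) -> M -> 'rV[R]_m) : Prop :=
  forall a, smooth_vf mfd U (e a).

Definition local_adapted_frame (U : set M) (e : 'I_(n + n) -> M -> 'rV[R]_m) :=
  smooth_frame U e /\ forall q, U q -> adapted q (e ^~ q).

Definition local_SO_frame (U : set M) (e : 'I_(n + n) -> M -> 'rV[R]_m) :=
  smooth_frame U e /\ forall q, U q -> SO_frame q (e ^~ q).

(* Z_alpha = (e_alpha - i e_{n + alpha}) / 2 as the complex vector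
   zre e alpha + i zim e alpha *)
Definition zre (E : 'I_(n + n) -> 'rV[R]_m) (a : 'I_n) : 'rV[R]_m :=
  2^-1 *: E (lshift n a).
Definition zim (E : 'I_(n + n) -> 'rV[R]_m) (a : 'I_n) : 'rV[R]_m :=
  - 2^-1 *: E (rshift n a).
Definition Zvec (E : 'I_(n + n) -> 'rV[R]_m) (a : 'I_n) : 'rV[R[i]]_m :=
  cvec (zre E a) (zim E a).

(* th is a unitary coframe on U whose dual frame is Z_alpha *)
Definition unitary_coframe (U : set M) (e : 'I_(n + n) -> M -> 'rV[R]_m)
    (th : 'I_n -> M -> 'cV[R[i]]_m) : Prop :=
  (forall b, csmooth_form mfd U (th b)) /\
  forall p, U p ->
    [/\ forall b, cev (th b p) (reeb ph p) = 0,
        forall a b, (Zvec (e ^~ p) a *m th b p) 0 0 = (a == b)%:R,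
        forall a b,
          (map_mx conjc (Zvec (e ^~ p) a) *m th b p) 0 0 = 0 &
        forall u v, (dform mfd (theta ph) p u v)%:C%C =
          Complex 0 1 * \sum_a wedge (th a p) (conj_form (th a p)) u v].

(* om a b is theta_a^b and A b g is A^b_{bar g} *)
Definition structure_equations (U : set M) (th : 'I_n -> M -> 'cV[R[i]]_m)
    (om : 'I_n -> 'I_n -> M -> 'cV[R[i]]_m)
    (A : 'I_n -> 'I_n -> M -> R[i]) : Prop :=
  let tau b p := \sum_g A b g p *: conj_form (th g p) in
  [/\ forall a b, csmooth_form mfd U (om a b),
      forall b g, csmooth mfd U (A b g) &
      forall p, U p -> [/\
        forall b u v, cdform mfd (th b) p u v =
          \sum_a wedge (th a p) (om a b p) u v +
          wedge (map_mx (real_complex R) (theta ph p)) (tau b p) u v,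
        forall a b, om a b p + conj_form (om b a p) = 0 &
        forall u v,
          \sum_b wedge (conj_form (tau b p)) (th b p) u v = 0]].

(* nab p v Y is the derivative at p of the (local) vector field Y along v *)
Definition is_connection (nab : M -> 'rV[R]_m -> (M -> 'rV[R]_m) -> 'rV[R]_m) :=
  forall U : set M, open U ->
  [/\ forall Y, smooth_vf mfd U Y -> forall p, U p -> forall a u v,
        nab p (a *: u + v) Y = a *: nab p u Y + nab p v Y,
      forall X Y, smooth_vf mfd U X -> smooth_vf mfd U Y ->
        forall p, U p -> forall v,
          nab p v (fun q => X q + Y q) = nab p v X + nab p v Y,
      forall f Y, smooth mfd U f -> smooth_vf mfd U Y ->
        forall p, U p -> forall v,
          nab p v (fun q => f q *: Y q) =
          der mfd v f p *: Y p + f p *: nab p v Y,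
      forall X Y, smooth_vf mfd U X -> smooth_vf mfd U Y ->
        (forall q, U q -> X q = Y q) ->
        forall p, U p -> forall v, nab p v X = nab p v Y &
      forall X Y, smooth_vf mfd U X -> smooth_vf mfd U Y ->
        smooth_vf mfd U (fun q => nab q (X q) Y)].

Definition is_ph_connection
    (nab : M -> 'rV[R]_m -> (M -> 'rV[R]_m) -> 'rV[R]_m) : Prop :=
  [/\ is_connection nab,
      forall p v, nab p v (reeb ph) = 0 &
      forall (U : set M) e th, open U -> local_adapted_frame U e ->
        unitary_coframe U e th ->
        exists om A, structure_equations U th om A /\
          forall p, U p -> forall v a,
            Zvec (fun b => nab p v (e b)) a =
            \sum_b cev (om a b p) v *: Zvec (e ^~ p) b].

Definition curvature_form (om : 'I_n -> 'I_n -> M -> 'cV[R[i]]_m)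
    (a b : 'I_n) (p : M) (u v : 'rV[R]_m) : R[i] :=
  cdform mfd (om a b) p u v - \sum_g wedge (om a g p) (om g b p) u v.

(* R_a^b_{rho bar sigma}: the coefficient of theta^rho /\ theta^{bar sigma} in
   the curvature form is its value on (Z_rho, Z_{bar sigma}) *)
Definition webster_curvature (e : 'I_(n + n) -> M -> 'rV[R]_m)
    (om : 'I_n -> 'I_n -> M -> 'cV[R[i]]_m) (a b rho sigma : 'I_n) (p : M) :
    R[i] :=
  cbil (curvature_form om a b p)
    (zre (e ^~ p) rho) (zim (e ^~ p) rho)
    (zre (e ^~ p) sigma) (- zim (e ^~ p) sigma).

Definition is_scalar_curvature (W : M -> R) : Prop :=
  forall (U : set M) e th om A, open U -> local_adapted_frame U e ->
    unitary_coframe U e th -> structure_equations U th om A ->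
    forall p, U p ->
      (W p)%:C%C = \sum_a \sum_g webster_curvature e om g g a a p.

End Pseudohermitian.

(* h : E -> B is a two-sheeted covering; s true and s false are the local
   inverses of h over O `&` B *)
Definition double_covering (X Y : topologicalType) (E : set X) (B : set Y)
    (h : X -> Y) : Prop :=
  [/\ forall x, E x -> B (h x),
      {within E, continuous h} &
      forall b, B b -> exists O : set Y, exists s : bool -> Y -> X,
      [/\ open O, O b,
          forall i, {within O `&` B, continuous (s i)},
          forall i y, O y -> B y -> E (s i y) /\ h (s i y) = y &
          [/\ forall i, exists2 V : set X,
                open V & s i @` (O `&` B) = V `&` E,
              forall y y', O y -> B y -> O y' -> B y' ->
                s true y <> s false y' &
              forall x, E x -> O (h x) -> exists i, x = s i (h x)]]].

Section Clifford.
Context {R : realType} {k N : nat}.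

(* c a is the action of e_a on a complex module of dimension N *)
Definition clifford_relations (c : 'I_k -> 'M[R[i]]_N) : Prop :=
  forall a b, c a *m c b + c b *m c a = (- 2 * (a == b)%:R)%:M.

Definition clifford_irreducible (c : 'I_k -> 'M[R[i]]_N) : Prop :=
  (0 < N)%N /\
  forall V : 'M[R[i]]_N, (forall a, ((c a *m V)^T <= V^T)%MS) ->
    V = 0 \/ V \in unitmx.

Definition clifford_vec (c : 'I_k -> 'M[R[i]]_N) (v : 'I_k -> R) : 'M[R[i]]_N :=
  \sum_a (v a)%:C%C *: c a.

(* Spin(k): products of an even number of unit vectors.  For even k the
   complexified Clifford algebra is the algebra of endomorphisms of its
   irreducible module, so that Spin(k) may be viewed inside of the latter. *)
Definition Spin (c : 'I_k -> 'M[R[i]]_N) : set 'M[R[i]]_N :=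
  [set g | exists s : seq ('I_k -> R),
     [/\ ~~ odd (size s),
         forall i, (i < size s)%N -> \sum_a (nth (fun=> 0) s i a) ^+ 2 = 1 &
         g = foldr (fun v h => clifford_vec c v *m h) 1%:M s]].

(* A is the image of g under Spin(k) -> SO(k): g v g^{-1} = A v *)
Definition spin_cover (c : 'I_k -> 'M[R[i]]_N) (g : 'M[R[i]]_N)
    (A : 'M[R]_k) : Prop :=
  forall a, g *m c a *m invmx g = clifford_vec c (fun b => A b a).

Definition SO : set 'M[R]_k := [set A | A *m A^T = 1%:M /\ \det A = 1].

End Clifford.

Section SpinGeometry.
Context {R : realType} {n N : nat} {M : topologicalType}.
Local Notation m := (n + n).+1.
Variables (mfd : manifold R m M) (ph : pseudohermitian mfd).
Variable c : 'I_(n + n) -> 'M[R[i]]_N.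
Local Notation metric := (levi mfd (theta ph) (J ph)).

(* A principal Spin(2n)-bundle (spin_total, spin_pr) with an equivariant double
   covering spin_fr of SO(xi).  Over a local frame f, SO(xi) is identified with
   U x SO(2n) by E = frame_act (f q) A, where A b a = <E a, f b q>. *)
Record spin_structure := SpinStructure {
  spin_total : topologicalType;
  spin_pr : spin_total -> M;
  spin_act : spin_total -> 'M[R[i]]_N -> spin_total;
  spin_fr : spin_total -> 'I_(n + n) -> 'rV[R]_m;
  spin_pr_continuous : continuous spin_pr;
  spin_act_continuous :
    {within setT `*` Spin c, continuous (fun z => spin_act z.1 z.2)};
  spin_act1 : forall p, spin_act p 1%:M = p;
  spin_actM : forall p g h, Spin c g -> Spin c h ->
    spin_act (spin_act p g) h = spin_act p (g *m h);
  spin_pr_act : forall p g, Spin c g -> spin_pr (spin_act p g) = spin_pr p;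
  spin_act_free : forall p g, Spin c g -> spin_act p g = p -> g = 1%:M;
  spin_locally_trivial : forall x, exists (U : set M) (s : M -> spin_total)
      (t : spin_total -> 'M[R[i]]_N),
    [/\ open U /\ U x,
        {within U, continuous s},
        forall y, U y -> spin_pr (s y) = y,
        {within [set p | U (spin_pr p)], continuous t} &
        forall p, U (spin_pr p) ->
          Spin c (t p) /\ p = spin_act (s (spin_pr p)) (t p)];
  spin_fr_SO : forall p, SO_frame ph (spin_pr p) (spin_fr p);
  spin_fr_act : forall p g A, Spin c g -> spin_cover c g A ->
    spin_fr (spin_act p g) = frame_act (spin_fr p) A;
  spin_fr_covering : forall (U : set M) f, open U -> local_SO_frame ph U f ->
    double_covering [set p | U (spin_pr p)] (U `*` SO)
      (fun p => (spin_pr p,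
         \matrix_(b, a) metric (spin_pr p) (spin_fr p a) (f b (spin_pr p)))) }.

Variable S : spin_structure.
Local Notation P := (spin_total S).
Local Notation pr := (@spin_pr S).
Local Notation fr := (@spin_fr S).

(* a spin frame s over the oriented orthonormal frame e on U *)
Definition local_spin_frame (U : set M) (e : 'I_(n + n) -> M -> 'rV[R]_m)
    (s : M -> P) : Prop :=
  [/\ local_SO_frame ph U e, {within U, continuous s} &
      forall x, U x -> pr (s x) = x /\ fr (s x) = e ^~ x].

(* The fibre of the associated spinor bundle at x consists of the maps phi from
   the fibre of P at x to the module with phi (p g) = g^{-1} phi p, i.e.
   phi p is the component of the spinor in the spin frame p. A section is
   smooth if its components in local spin frames are. *)
Definition is_spinor (V : set M) (phi : P -> 'cV[R[i]]_N) : Prop :=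
  (forall p g, V (pr p) -> Spin c g ->
     phi (spin_act p g) = invmx g *m phi p) /\
  (forall (U : set M) e s, open U -> U `<=` V -> local_spin_frame U e s ->
     forall k, csmooth mfd U (fun x => phi (s x) k 0)).

(* Clifford multiplication by v \in xi, in the spin frame p *)
Definition cliff (p : P) (v : 'rV[R]_m) : 'M[R[i]]_N :=
  clifford_vec c (fun a => metric (pr p) v (fr p a)).

(* nabS p v phi is the component in the spin frame p of nabla_v phi; phi may be
   a local section *)
Definition is_spin_connection
    (nab : M -> 'rV[R]_m -> (M -> 'rV[R]_m) -> 'rV[R]_m)
    (nabS : P -> 'rV[R]_m -> (P -> 'cV[R[i]]_N) -> 'cV[R[i]]_N) : Prop :=
  forall (V : set M) phi, open V -> is_spinor V phi ->
  forall (U : set M) e s, open U -> U `<=` V -> local_spin_frame U e s ->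
  forall x, U x -> forall v,
    nabS (s x) v phi =
      \col_k cder mfd v (fun y => phi (s y) k 0) x +
      4^-1 *: \sum_a \sum_b
        (metric x (nab x v (e a)) (e b x))%:C%C *:
          (c a *m c b *m phi (s x)).

Variable nab : M -> 'rV[R]_m -> (M -> 'rV[R]_m) -> 'rV[R]_m.
Variable nabS : P -> 'rV[R]_m -> (P -> 'cV[R[i]]_N) -> 'cV[R[i]]_N.

Definition cov (V : M -> 'rV[R]_m) (phi : P -> 'cV[R[i]]_N) : P -> 'cV[R[i]]_N :=
  fun p => nabS p (V (pr p)) phi.

Definition cov2 (V U : M -> 'rV[R]_m) (phi : P -> 'cV[R[i]]_N) :
    P -> 'cV[R[i]]_N :=
  fun p => cov V (cov U phi) p - cov (fun x => nab x (V x) U) phi p.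

Definition rough_laplacian (e : 'I_(n + n) -> M -> 'rV[R]_m)
    (phi : P -> 'cV[R[i]]_N) : P -> 'cV[R[i]]_N :=
  fun p => - \sum_a cov2 (e a) (e a) phi p.

(* sum_a e_a . nabla_{e_a} phi at p, for the orthonormal basis fr p *)
Definition contact_dirac (phi : P -> 'cV[R[i]]_N) : P -> 'cV[R[i]]_N :=
  fun p => \sum_a cliff p (fr p a) *m nabS p (fr p a) phi.

End SpinGeometry.

(* Main.v *)
Require Import Defs.
From mathcomp Require Import all_boot all_order all_algebra.
From mathcomp Require Import complex.
From mathcomp Require Import all_classical all_reals all_analysis.
From mathcomp Require Import ring lra.
Import Order.TTheory GRing.Theory Num.Theory numFieldNormedType.Exports.
Set Implicit Arguments.
Unset Strict Implicit.
Unset Printing Implicit Defensive.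
Local Open Scope classical_set_scope.
Local Open Scope ring_scope.

(* Through every point of the spin bundle over the domain of an adapted frame e
   passes a local spin frame over e A with A a constant matrix, along which
   Clifford multiplication by e_i is a constant matrix C_i. There
     nabla_v phi = v phi + Gamma(v) phi,  [Gamma(v), C_j] = Cl(nabla_v e_j),
   so that D^2 phi = sum_ij C_i C_j H_ij phi with H_ij = nabla^2_{e_i, e_j}.
   The Clifford relations split this into nabla^* nabla and
   1/2 sum_ij C_i C_j (H_ij - H_ji), and
     H_ij - H_ji = F(e_i, e_j) - dtheta(e_i, e_j) nabla_T,
   with F the curvature of Gamma. Since dtheta(e_b, e_{n+b}) = 2, the last term
   yields -2 sum_b e_b e_{n+b} nabla_T. The curvature is
   F = sum_ab Omega_a^b G_ab, where G_ab represents gl(n) on spinors. By the first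
   Bianchi identity, which the structure equations turn the Jacobi identity
   into, the (2,0) and (0,2) parts of Omega are given by the symmetric torsion A and
   contribute 0, while the symmetries of the (1,1) part reduce
   1/2 sum_ij C_i C_j F(e_i, e_j) to the scalar W. *)

(** * Calculus in R^m *)

Section Calculus.
Context {R : realType} {m : nat}.
Implicit Types (D : set 'rV[R]_m) (f g : 'rV[R]_m -> R) (x u v : 'rV[R]_m).

(** The formula is asserted at every point p of the spin bundle, where the frame [fr p] is in
    general only a rotation e A of [e]. Working in e A itself would lose the adaptedness to J, and
    with it the coframe theta^b and the unitary structure equations. The rotation is therefore moved
    into the Clifford matrices: as A is constant, the spin connection of e A in the generators c_a
    is that of e in the generators C_i, which satisfy the same relations. From there on only an
    adapted frame and an abstract Clifford system appear.

    The scalar W comes from a half trace: G_ab is the normally ordered product of conj z_a and z_b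
    plus delta_ab / 2. In the contraction of the (1,1) curvature with the Clifford matrices only the
    product of two such halves survives; its 1/4 is compensated by the halves in Z_r and conj Z_s.

    Tangent vectors have coordinates in the chart of their own base point, so a field cannot be
    differentiated coordinatewise as it stands. It is handled through the functions it
    differentiates, and vectors are identified by their action on coordinates or by theta and
    theta^b. *)

Lemma differentiable_near_eq (V W : normedModType R) (f g : V -> W) (x : V) :
  {near x, f =1 g} -> differentiable f x -> differentiable g x.
Proof.
(* The difference [h] vanishes near x, so it is differentiable there with differential 0, and
   [g = f + h] inherits differentiability. *)
move=> fg df; pose h := g - f.
have fxgx : f x = g x by exact: nbhs_singleton fg.
suff dh : differentiable h x.
  have -> : g = f + h by apply/funext => y; rewrite /h !fctE addrC subrK.
  exact: differentiableD.
apply/diff_locallyP.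
have fg0 : \forall y \near 0, f (y + x) = g (y + x).
  by move: fg; rewrite (near_shift 0 x) /= subr0.
have ho : h \o shift x = cst (h x) + \0 +o_ 0 id.
  apply/eqaddoP => _ /posnumP[e].
  near=> y.
  rewrite /h /= !fctE /= fxgx subrr !addr0 !subr0.
  have -> : g (y + x) - f (y + x) = 0.
    by apply/eqP; rewrite subr_eq0 eq_sym; apply/eqP; near: y.
  by rewrite normr0 mulr_ge0.
have d0 : 'd h x = \0 :> (V -> W).
  by apply/diff_unique => //; exact: cst_continuous.
by rewrite d0; split => //; exact: cst_continuous.
Unshelve. all: by end_near. Qed.

Lemma Ck_subset (D D' : set 'rV[R]_m) k f : D' `<=` D -> Ck k D f -> Ck k D' f.
Proof.
move=> sub; elim: k f => [|k IH] f /=; first by move=> cf x /sub/cf.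
by move=> [df pf]; split=> [x /sub/df//|j]; exact: IH.
Qed.

Lemma CkS D k f : Ck k.+1 D f -> Ck k D f.
Proof.
elim: k f => [|k IH] f /= [df pf].
  by move=> x Dx; apply: differentiable_continuous; exact: df.
by split => // j; exact: IH.
Qed.

Lemma open_near_eq D f g x : open D -> {in D, f =1 g} -> D x ->
  {near x, f =1 g}.
Proof.
move=> oD fg Dx; near=> y.
apply: fg; rewrite inE; near: y; exact: open_nbhs_nbhs.
Unshelve. all: by end_near. Qed.

Lemma Ck_eq D k f g : open D -> {in D, f =1 g} -> Ck k D f -> Ck k D g.
Proof.
move=> oD; elim: k f g => [|k IH] f g fg /=.
  move=> cf x Dx; change (g @ x --> g x); rewrite -fg ?inE //.
  have fgn : {near x, f =1 g} by exact: (open_near_eq oD).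
  have cfx : f @ x --> f x := cf x Dx.
  apply: (cvg_trans _ cfx).
  exact: (near_eq_cvg fgn).
move=> [df pf]; split=> [x Dx|j].
  apply: differentiable_near_eq (df x Dx); exact: (open_near_eq oD fg Dx).
apply: IH (pf j) => x /[1!inE] Dx; apply: near_eq_derive.
exact: (open_near_eq oD fg Dx).
Qed.

Lemma Ck_cst D k (a : R) : Ck k D (cst a).
Proof.
elim: k a => [|k IH] a /=; first by move=> x _; exact: cst_continuous.
split=> [x _|j]; first exact: differentiable_cst.
rewrite (_ : (fun x => _) = cst 0) //.
by apply/funext => x; rewrite derive_cst.
Qed.

Lemma CkD D k f g : open D -> Ck k D f -> Ck k D g -> Ck k D (f \+ g).
Proof.
move=> oD; elim: k f g => [|k IH] f g /=.
  by move=> cf cg x Dx; apply: continuousD; [exact: cf|exact: cg].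
move=> [df pf] [dg pg]; split=> [x Dx|j].
  by apply: differentiableD; [exact: df|exact: dg].
apply: Ck_eq (IH _ _ (pf j) (pg j)) => // x /[1!inE] Dx /=.
rewrite deriveD //; apply: diff_derivable; [exact: df|exact: dg].
Qed.

(** By Leibniz a partial derivative of the product contains f and g themselves, which the induction
    hypothesis wants one order lower; hence [CkS]. *)
Lemma CkM D k f g : open D -> Ck k D f -> Ck k D g -> Ck k D (f \* g).
Proof.
move=> oD; elim: k f g => [|k IH] f g.
  by move=> cf cg x Dx; apply: continuousM; [exact: cf|exact: cg].
move=> f1 g1; have f0 := CkS f1; have g0 := CkS g1.
move: f1 g1 => /= [df pf] [dg pg]; split=> [x Dx|j].
  by apply: differentiableM; [exact: df|exact: dg].
apply: Ck_eq (CkD oD (IH _ _ f0 (pg j)) (IH _ _ g0 (pf j))) => //.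
move=> x /[1!inE] Dx /=.
rewrite deriveM //; apply: diff_derivable; [exact: df|exact: dg].
Qed.

Lemma Ck_sum D k (I : Type) (r : seq I) (F : I -> 'rV[R]_m -> R) : open D ->
  (forall i, Ck k D (F i)) -> Ck k D (fun x => \sum_(i <- r) F i x).
Proof.
move=> oD CF; elim: r => [|i r IH].
  by apply: Ck_eq (Ck_cst D k 0) => // x _; rewrite big_nil.
by apply: Ck_eq (CkD oD (CF i) IH) => // x _; rewrite big_cons.
Qed.

Lemma rV_sum_delta x : x = \sum_j x 0 j *: delta_mx 0 j.
Proof.
rewrite {1}[x]matrix_sum_delta big_ord1; apply: eq_bigr => j _.
by [].
Qed.

Lemma derive_sum_partial f x v : differentiable f x ->
  'D_v f x = \sum_j v 0 j * 'D_(delta_mx 0 j) f x.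
Proof.
move=> df; rewrite deriveE // {1}[v]rV_sum_delta linear_sum.
by apply: eq_bigr => j _; rewrite linearZ deriveE.
Qed.

Lemma differentiable_rV (p : nat) (h : 'rV[R]_m -> 'rV[R]_p) x :
  (forall k, differentiable (fun y => h y 0 k) x) -> differentiable h x.
Proof.
move=> dh.
have -> : h = \sum_(k < p) (fun y => h y 0 k *: (delta_mx 0 k : 'rV[R]_p)).
  apply/funext => y; rewrite fct_sumE {1}[h y]matrix_sum_delta big_ord1.
  by apply: eq_bigr => j _.
by apply: differentiable_sum => k; apply: differentiableZl; exact: dh.
Qed.

Lemma derive_comp (p : nat) (g : 'rV[R]_p -> R) (h : 'rV[R]_m -> 'rV[R]_p) x v :
  (forall k, differentiable (fun y => h y 0 k) x) -> differentiable g (h x) ->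
  'D_v (g \o h) x =
  'D_(\row_k 'D_v (fun y => h y 0 k) x) g (h x).
Proof.
move=> dh dg; have dh' := differentiable_rV dh.
have dhE : 'd h x v = \row_k 'D_v (fun y => h y 0 k) x.
  rewrite -deriveE // derive_mx; last exact: diff_derivable.
  by apply/rowP => k; rewrite !mxE.
rewrite deriveE; last exact: differentiable_comp.
by rewrite diff_comp //= dhE deriveE.
Qed.

End Calculus.

Lemma continuous_rV (R : realType) (T : topologicalType) (p : nat)
    (h : T -> 'rV[R]_p) x :
  (forall i, {for x, continuous (fun y => h y 0 i)}) -> {for x, continuous h}.
Proof.
move=> ch; change (h y @[y --> x] --> h x).
apply/cvgrPdist_le => e e0; near=> y.
rewrite [leLHS]/Num.Def.normr/= mx_normrE (bigmax_le _ (ltW e0))//= => i _.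
rewrite !mxE ord1 /=; move: i; near: y; apply: filter_forall => /= i.
exact: ((cvgrPdist_le _ _).1 (ch i.2)).
Unshelve. all: by end_near. Qed.

(** By the chain rule a partial derivative of [g \o h] is a sum of products of partial derivatives
    of [h] with partial derivatives of [g] composed with [h]; the induction hypothesis applies to
    the latter, with the order of [h] lowered by one. *)
Lemma Ck_comp {R : realType} {m p : nat} (D : set 'rV[R]_m) (D' : set 'rV[R]_p) k
    (g : 'rV[R]_p -> R) (h : 'rV[R]_m -> 'rV[R]_p) :
  open D -> (forall x, D x -> D' (h x)) -> 
  (forall i, Ck k D (fun x => h x 0 i)) -> Ck k D' g -> Ck k D (g \o h).
Proof.
move=> oD hD; elim: k g => [|k IH] g hC gC.
  move=> x Dx; apply: continuous_comp; last exact/gC/hD.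
  by apply: continuous_rV => i; exact: hC.
have hC0 i := CkS (hC i).
have dh x : D x -> forall i, differentiable (fun y => h y 0 i) x.
  by move=> Dx i; have [+ _] := hC i; apply.
move: gC => [dg pg]; split=> [x Dx|j].
  apply: differentiable_comp; last exact/dg/hD.
  exact/differentiable_rV/dh.
apply: (@Ck_eq _ _ _ _ (fun x => \sum_i 'D_(delta_mx 0 j) (fun y => h y 0 i) x *
         ('D_(delta_mx 0 i) g \o h) x)) => //.
  move=> x /[1!inE] Dx; rewrite derive_comp; [|exact: dh|exact/dg/hD].
  rewrite derive_sum_partial; last exact/dg/hD.
  by apply: eq_bigr => i _; rewrite mxE.
apply: Ck_sum => // i; apply: CkM => //; last by apply: IH => //; exact: pg.
by have [_ +] := hC i; apply.
Qed.

(** * Symmetry of second derivatives *)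

Section Schwarz.
Context {R : realType} {V : normedModType R}.
Implicit Types (f : V -> R) (x y u v : V).

Lemma is_derive_line f y u (s : R) : differentiable f (y + s *: u) ->
  is_derive s 1 (fun t => f (y + t *: u)) ('D_u f (y + s *: u)).
Proof.
move=> df; pose l (t : R) := y + t *: u.
have dl : is_diff s l (0 + *:%R^~ u) by rewrite /l; apply: is_diffD.
have dc : differentiable (f \o l) s.
  by apply: differentiable_comp => //; exact: ex_diff.
apply: DeriveDef; first exact: diff_derivable.
rewrite -/(f \o l) deriveE // diff_comp //.
by rewrite /= diff_val !fctE add0r scale1r deriveE.
Qed.

Lemma diff_estimate f x (e : R) : differentiable f x -> 0 < e ->
  exists2 d, 0 < d & forall w, `|w| < d ->
    `|f (x + w) - f x - 'd f x w| <= e * `|w|.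
Proof.
move=> df e0.
have /eqaddoP /(_ _ e0) /nbhs_norm0P [d /= d0 dP] := diff_locally df.
exists d => // w /dP; rewrite /= !fctE /= addrC.
by rewrite (addrC (- _)) opprD addrA (addrC w).
Qed.

(* By the mean value theorem along u, the second difference is
   h (D_u f (x + s u + h v) - D_u f (x + s u)) for some 0 < s < h. *)
Lemma second_difference f (D : set V) x u v (e : R) : open D -> D x ->
  (forall y, D y -> differentiable f y) -> differentiable ('D_u f) x -> 0 < e ->
  \forall h \near 0^'+,
    `|f (x + h *: u + h *: v) - f (x + h *: u) - f (x + h *: v) + f x
       - h ^+ 2 * 'D_v ('D_u f) x| <= e * h ^+ 2.
Proof.
move=> oD Dx df dG e0.
have [r r0 rD] : exists2 r : R, 0 < r & forall w, `|w| < r -> D (x + w).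
  have /nbhs_normP [r /= r0 rD] : nbhs x D by exact: open_nbhs_nbhs.
  by exists r => // w wr; apply: rD; rewrite /= opprD addrA subrr sub0r normrN.
(* For s, t in [0, h] the displacement s u + t v has norm at most h c; the summand 1 makes c
   positive. The derivative of f along u is linearised at two such points with relative error e / (2
   c), so the two errors add up to at most e h. *)
pose c := 1 + `|u| + `|v|.
have c0 : 0 < c by rewrite /c -addrA ltr_pwDl // addr_ge0.
have ec0 : 0 < e / (2 * c) by rewrite divr_gt0 // mulr_gt0.
have [d d0 dP] := diff_estimate dG ec0.
near=> h.
have h0 : 0 < h by near: h; exact: nbhs_right_gt.
have hr : h * c < r.
  by rewrite -ltr_pdivlMr //; near: h; apply: nbhs_right_lt; rewrite divr_gt0.
have hd : h * c < d.
  by rewrite -ltr_pdivlMr //; near: h; apply: nbhs_right_lt; rewrite divr_gt0.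
have nle (s t : R) : 0 <= s <= h -> 0 <= t <= h -> `|s *: u + t *: v| <= h * c.
  move=> /andP[s0 sh] /andP[t0 th]; apply: le_trans (ler_normD _ _) _.
  rewrite !normrZ !ger0_norm // /c !mulrDr mulr1 -addrA.
  by rewrite ler_wpDl ?(ltW h0) // lerD // ler_wpM2r.
pose phi s := f (x + h *: v + s *: u) - f (x + s *: u).
have Dphi s : 0 <= s <= h -> is_derive s 1 phi
    ('D_u f (x + h *: v + s *: u) - 'D_u f (x + s *: u)).
  move=> sh; have hh : 0 <= h <= h by rewrite lexx ltW.
  have z0 : 0 <= (0 : R) <= h by rewrite lexx ltW.
  apply: is_deriveB; apply: is_derive_line; apply: df.
    rewrite -addrA (addrC (h *: v)); apply: rD.
    exact: le_lt_trans (nle _ _ sh hh) hr.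
  apply: rD; rewrite -[s *: u]addr0 -[0](scale0r v).
  exact: le_lt_trans (nle _ _ sh z0) hr.
have [s /[!in_itv] /= /andP[s0 sh] Ephi] : exists2 s, s \in `]0, h[ &
    phi h - phi 0 = ('D_u f (x + h *: v + s *: u) - 'D_u f (x + s *: u)) * (h - 0).
  apply: MVT => // [s|].
    by rewrite in_itv /= => /andP[/ltW s0 /ltW sh]; apply: Dphi; rewrite s0.
  apply: derivable_within_continuous => s; rewrite in_itv /= => sh.
  by have [] := Dphi s sh.
have hh : 0 <= h <= h by rewrite lexx ltW.
have z0 : 0 <= (0 : R) <= h by rewrite lexx ltW.
have ss : 0 <= s <= h by rewrite !ltW.
have n1 := nle _ _ ss hh; have n2 := nle _ _ ss z0.
have := dP _ (le_lt_trans n1 hd); have := dP _ (le_lt_trans n2 hd).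
have dl w t : 'd ('D_u f) x (t *: w) = t * 'D_w ('D_u f) x.
  by rewrite linearZ deriveE.
rewrite scale0r addr0 linearD /= !dl.
rewrite subr0 in Ephi.
rewrite scale0r addr0 in n2.
set Gs := 'D_u f (x + s *: u); set Gh := 'D_u f (x + _).
have GhE : 'D_u f (x + h *: v + s *: u) = Gh.
  by rewrite /Gh -addrA (addrC (h *: v)).
rewrite GhE in Ephi.
set L1 := 'D_u ('D_u f) x; set L2 := 'D_v ('D_u f) x.
move: Ephi; rewrite /phi !scale0r !addr0 => mv e1 e2.
have -> : x + h *: u + h *: v = x + h *: v + h *: u by rewrite addrAC.
have -> : f (x + h *: v + h *: u) - f (x + h *: u) - f (x + h *: v) + f x
       - h ^+ 2 * L2 = ((Gh - 'D_u f x - (s * L1 + h * L2)) -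
                        (Gs - 'D_u f x - s * L1)) * h.
  have -> : f (x + h *: v + h *: u) - f (x + h *: u) - f (x + h *: v) + f x =
      (Gh - Gs) * h by rewrite -mv; ring.
  by ring.
rewrite normrM (gtr0_norm h0) expr2 mulrA ler_pM2r //.
apply: le_trans (ler_normB _ _) _.
apply: le_trans (lerD e2 e1) _.
rewrite -mulrDr -ler_pdivlMl //.
apply: le_trans (lerD n1 n2) _.
rewrite invfM invrK.
by rewrite le_eqVlt; apply/orP; left; apply/eqP; field; rewrite !gt_eqF.
Unshelve. all: by end_near. Qed.

(** The second difference of f along h u and h v is symmetric in u and v, and [second_difference]
    approximates it by h^2 times either mixed derivative up to (e / 2) h^2. Dividing by h^2 bounds
    the distance of the two by the arbitrary e. *)
Lemma derive_sym f (D : set V) x u v : open D -> D x ->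
  (forall y, D y -> differentiable f y) ->
  differentiable ('D_u f) x -> differentiable ('D_v f) x ->
  'D_v ('D_u f) x = 'D_u ('D_v f) x.
Proof.
move=> oD Dx df du dv; apply/eqP; rewrite -subr_eq0 -normr_le0.
apply/ler_addgt0Pr => e e0; rewrite add0r.
have e20 : 0 < e / 2 by rewrite divr_gt0.
have sd1 := second_difference v oD Dx df du e20.
have sd2 := second_difference u oD Dx df dv e20.
have [h [/= [+ +] h0]] := filter_ex
  (filterI (filterI sd1 sd2) (nbhs_right_gt (0 : R))).
rewrite (addrAC x (h *: v)).
set a := f _; set b := f _; set c := f _.
rewrite (_ : a - c - b = a - b - c); last by rewrite addrAC.
set q := a - b - c + f x; set L := 'D_v _ x; set L' := 'D_u _ x => e2 e1.
have h20 : 0 < h ^+ 2 by rewrite exprn_gt0.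
rewrite -(ler_pM2r h20) -{1}(gtr0_norm h20) -normrM.
rewrite (_ : (L - L') * _ = (q - h ^+ 2 * L') - (q - h ^+ 2 * L)); last by ring.
apply: le_trans (ler_normB _ _) _; apply: le_trans (lerD e1 e2) _.
by rewrite -mulrDl -splitr.
Qed.

End Schwarz.

Section Cinfty.
Context {R : realType} {m : nat}.
Implicit Types (D : set 'rV[R]_m) (f g : 'rV[R]_m -> R).

Lemma Cinfty_subset D D' f : D' `<=` D -> Cinfty D f -> Cinfty D' f.
Proof. by move=> sub Cf k; exact: Ck_subset (Cf k). Qed.

Lemma Cinfty_eq D f g : open D -> {in D, f =1 g} -> Cinfty D f -> Cinfty D g.
Proof. by move=> oD fg Cf k; exact: Ck_eq (Cf k). Qed.

Lemma Cinfty_partial D f j : Cinfty D f -> Cinfty D ('D_(delta_mx 0 j) f).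
Proof. by move=> Cf k; have [_ +] := Cf k.+1; apply. Qed.

Lemma Cinfty_differentiable D f x : Cinfty D f -> D x -> differentiable f x.
Proof. by move=> Cf Dx; have [+ _] := Cf 1%N; apply. Qed.

(** [Ck] speaks of coordinate directions only; a derivative in a fixed direction is a combination of
    these with constant coefficients. *)
Lemma Cinfty_derive D f u : open D -> Cinfty D f -> Cinfty D ('D_u f).
Proof.
move=> oD Cf k.
apply: (@Ck_eq _ _ _ _ (fun x => \sum_j u 0 j * 'D_(delta_mx 0 j) f x)) => //.
  move=> x /[1!inE] Dx; rewrite [RHS]derive_sum_partial //.
  exact: Cinfty_differentiable Dx.
apply: Ck_sum => // j; apply: CkM => //; first exact: Ck_cst.
exact: Cinfty_partial.
Qed.

End Cinfty.

(** * Vector fields and forms on a manifold *)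

Section ManifoldCalculus.
Context {R : realType} {m : nat} {M : topologicalType}.
Variable mfd : manifold R m M.
Implicit Types (U V : set M) (f g : M -> R) (p q : M) (u v w : 'rV[R]_m).
Implicit Types (X Y : M -> 'rV[R]_m).

Local Notation chart := (chart mfd).
Local Notation cinv := (cinv mfd).
Local Notation cdom := (cdom mfd).

Lemma chart_image_open p U : open U -> open (chart p @` (cdom p `&` U)).
Proof.
move=> oU; set I := chart p @` cdom p.
have oI : open I by exact: chart_open.
have cI : {in I, continuous (cinv p)}.
  by rewrite -continuous_open_subspace //; exact: cinv_continuous.
rewrite openE => _ [q [pq Uq] <-].
have Iq : I (chart p q) by exists q.
have cq := cI _ (mem_set Iq).
have Un : nbhs (cinv p (chart p q)) U.
  by rewrite chartK //; exact: open_nbhs_nbhs.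
rewrite /interior; near=> x.
have [r pr rx] : I x by near: x; exact: open_nbhs_nbhs.
exists r => //; split => //; rewrite -(chartK pr) rx.
by near: x; exact: cq.
Unshelve. all: by end_near. Qed.

Lemma chart_mem q U : U q -> (chart q @` (cdom q `&` U)) (chart q q).
Proof. by move=> Uq; exists q => //; split => //; exact: cdom_center. Qed.

Lemma smooth_subset U V f : V `<=` U -> smooth mfd U f -> smooth mfd V f.
Proof.
by move=> VU sf p; apply: Cinfty_subset (sf p) => _ [q [pq /VU Uq] <-]; exists q.
Qed.

Lemma smooth_eq U f g : open U -> {in U, f =1 g} -> smooth mfd U f ->
  smooth mfd U g.
Proof.
move=> oU fg sf p; apply: Cinfty_eq (sf p); first exact: chart_image_open.
move=> _ /[1!inE] -[q [pq Uq] <-] /=; rewrite chartK //.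
by apply: fg; rewrite inE.
Qed.

Lemma smooth_cst U (a : R) : smooth mfd U (fun=> a).
Proof. by move=> p k; exact: Ck_cst. Qed.

Lemma smoothD U f g : open U -> smooth mfd U f -> smooth mfd U g ->
  smooth mfd U (fun q => f q + g q).
Proof.
by move=> oU sf sg p k; apply: CkD;
  [exact: chart_image_open|exact: sf|exact: sg].
Qed.

Lemma smoothM U f g : open U -> smooth mfd U f -> smooth mfd U g ->
  smooth mfd U (fun q => f q * g q).
Proof.
by move=> oU sf sg p k; apply: CkM;
  [exact: chart_image_open|exact: sf|exact: sg].
Qed.

Lemma smoothZ U (a : R) f : open U -> smooth mfd U f ->
  smooth mfd U (fun q => a * f q).
Proof. by move=> oU; apply: smoothM => //; exact: smooth_cst. Qed.

Lemma smoothN U f : open U -> smooth mfd U f -> smooth mfd U (fun q => - f q).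
Proof.
move=> oU sf; apply: smooth_eq (smoothZ (-1) oU sf) => //.
by move=> q _; rewrite mulN1r.
Qed.

Lemma smoothB U f g : open U -> smooth mfd U f -> smooth mfd U g ->
  smooth mfd U (fun q => f q - g q).
Proof. by move=> oU sf sg; apply: smoothD => //; exact: smoothN. Qed.

Lemma smooth_sum U (I : Type) (r : seq I) (P : pred I) (F : I -> M -> R) :
  open U -> (forall i, P i -> smooth mfd U (F i)) ->
  smooth mfd U (fun q => \sum_(i <- r | P i) F i q).
Proof.
move=> oU sF; elim: r => [|i r IH].
  by apply: smooth_eq (smooth_cst U 0) => // x _; rewrite big_nil.
case: (boolP (P i)) => Pi.
  apply: smooth_eq (smoothD oU (sF i Pi) IH) => // x _.
  by rewrite big_cons Pi.
by apply: smooth_eq IH => // x _; rewrite big_cons (negbTE Pi).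
Qed.

Lemma smooth_differentiable U f q : smooth mfd U f -> U q ->
  differentiable (f \o cinv q) (chart q q).
Proof. move=> sf Uq; exact: Cinfty_differentiable (sf q) (chart_mem Uq). Qed.

Lemma cinv_near p q U : open U -> U q -> cdom p q ->
  \forall x \near chart p q, (cdom p `&` U) (cinv p x) /\ chart p (cinv p x) = x.
Proof.
move=> oU Uq pq; have oI := chart_image_open (p := p) oU.
near=> x.
have [r [pr Ur] <-] : (chart p @` (cdom p `&` U)) x.
  by near: x; apply: open_nbhs_nbhs; split => //; exists q.
by rewrite chartK.
Unshelve. all: by end_near. Qed.

Lemma der_eq U f g v q : open U -> U q -> {in U, f =1 g} ->
  der mfd v f q = der mfd v g q.
Proof.
move=> oU Uq fg; apply: near_eq_derive.
have := cinv_near oU Uq (cdom_center mfd q).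
apply: filterS => x [[_ Ux] _] /=; apply: fg; rewrite inE //.
Qed.

Lemma der_cst v (a : R) q : der mfd v (fun=> a) q = 0.
Proof. by rewrite /der (_ : _ \o _ = cst a) // derive_cst. Qed.

Section Pointwise.
Variables (U : set M) (q : M).
Hypothesis Uq : U q.

Lemma derD v f g : smooth mfd U f -> smooth mfd U g ->
  der mfd v (fun r => f r + g r) q = der mfd v f q + der mfd v g q.
Proof.
move=> sf sg; rewrite /der -deriveD //;
 by apply: diff_derivable; apply: smooth_differentiable Uq.
Qed.

Lemma derM v f g : smooth mfd U f -> smooth mfd U g ->
  der mfd v (fun r => f r * g r) q = f q * der mfd v g q + g q * der mfd v f q.
Proof.
move=> sf sg; rewrite /der.
rewrite (_ : _ \o _ = (f \o cinv q) * (g \o cinv q)) // deriveM //;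
  try by apply: diff_derivable; apply: smooth_differentiable Uq.
by rewrite /= !chartK //; exact: cdom_center.
Qed.

Lemma der_lin f (a : R) u v : smooth mfd U f ->
  der mfd (a *: u + v) f q = a * der mfd u f q + der mfd v f q.
Proof.
move=> sf; have df := smooth_differentiable sf Uq.
by rewrite /der !deriveE // linearP.
Qed.

Lemma der_sum_vec f n (a : 'I_n -> R) (w : 'I_n -> 'rV[R]_m) : smooth mfd U f ->
  der mfd (\sum_k a k *: w k) f q = \sum_k a k * der mfd (w k) f q.
Proof.
move=> sf; have df := smooth_differentiable sf Uq.
rewrite /der deriveE // linear_sum; apply: eq_bigr => k _.
by rewrite linearZ deriveE.
Qed.

End Pointwise.

Lemma derZ U q v (a : R) f : U q -> smooth mfd U f ->
  der mfd v (fun r => a * f r) q = a * der mfd v f q.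
Proof.
move=> Uq sf; rewrite (derM Uq) //; last exact: smooth_cst.
by rewrite der_cst mulr0 addr0.
Qed.

Lemma derN U q v f : U q -> smooth mfd U f ->
  der mfd v (fun r => - f r) q = - der mfd v f q.
Proof.
move=> Uq sf; rewrite -mulN1r -(derZ _ _ Uq sf).
rewrite (_ : (fun r => - f r) = fun r => -1 * f r) //.
by apply/funext => r; rewrite mulN1r.
Qed.

Lemma derB U q v f g : open U -> U q -> smooth mfd U f -> smooth mfd U g ->
  der mfd v (fun r => f r - g r) q = der mfd v f q - der mfd v g q.
Proof.
by move=> oU Uq sf sg; rewrite (derD Uq) ?(derN _ Uq sg) //; exact: smoothN.
Qed.

Lemma der_sum U q v (I : Type) (r : seq I) (F : I -> M -> R) :
  open U -> U q -> (forall i, smooth mfd U (F i)) ->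
  der mfd v (fun x => \sum_(i <- r) F i x) q = \sum_(i <- r) der mfd v (F i) q.
Proof.
move=> oU Uq sF; elim: r => [|i r IH].
  rewrite (_ : (fun _ => _) = fun=> 0) ?der_cst ?big_nil //.
  by apply/funext => x; rewrite big_nil.
rewrite big_cons -IH -(derD Uq) //; last exact: smooth_sum.
rewrite (_ : (fun _ => _) = fun x => F i x + \sum_(j <- r) F j x) //.
by apply/funext => x; rewrite big_cons.
Qed.

Lemma smooth_chart p k : smooth mfd (cdom p) (fun r => chart p r 0 k).
Proof. by move=> p'; exact: transition_smooth. Qed.

(** Read in another chart p', the function becomes g after the transition map from p' to p, which is
    smooth. *)
Lemma smooth_comp_chart p V (g : 'rV[R]_m -> R) : open V -> V `<=` cdom p ->
  Cinfty (chart p @` (cdom p `&` V)) g -> smooth mfd V (g \o chart p).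
Proof.
move=> oV Vp Cg p' k.
apply: (@Ck_comp _ _ _ _ (chart p @` (cdom p `&` V)) k g (chart p \o cinv p')).
- exact: chart_image_open.
- move=> _ [q [pq Vq] <-] /=; rewrite chartK //; exists q => //.
  by split => //; exact: Vp.
- move=> i; apply: Ck_subset (smooth_chart p i p' k).
  by move=> _ [q [pq /Vp Vq] <-]; exists q.
- exact: Cg.
Qed.

(* the components of v, a tangent vector at q, in the chart around p *)
Definition coord p v q : 'rV[R]_m := \row_k der mfd v (fun r => chart p r 0 k) q.

(** Chain rule through the transition map from the chart around q, in which [der] is computed, to
    the chart around p. Coordinates in one fixed chart make the values of a field at different
    points comparable. *)
Lemma der_coord V f p q v : open V -> smooth mfd V f -> V q -> cdom p q ->
  der mfd v f q = 'D_(coord p v q) (f \o cinv p) (chart p q).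
Proof.
move=> oV sf Vq pq.
have cq : cinv q (chart q q) = q by rewrite chartK //; exact: cdom_center.
rewrite /der (@near_eq_derive _ _ _ _ ((f \o cinv p) \o (chart p \o cinv q))).
  rewrite derive_comp /= ?cq //.
    by move=> k; apply: smooth_differentiable (smooth_chart p k) pq.
  apply: Cinfty_differentiable (sf p) _.
  by exists q.
have := cinv_near (cdom_open mfd p) pq (cdom_center mfd q).
by apply: filterS => x [[_ px] _] /=; rewrite chartK.
Qed.

Lemma coord_id q v : coord q v q = v.
Proof.
apply/rowP => k; rewrite mxE /der.
rewrite (@near_eq_derive _ _ _ _ (fun x : 'rV[R]_m => x 0 k : R)).
  rewrite deriveE; last exact: differentiable_coord.
  have @l : {linear 'rV[R]_m -> R}.
    by exists (fun N : 'rV[R]_m => N 0 k); do 2![eexists]; do ?[constructor];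
     rewrite ?mxE// => ? *; rewrite ?mxE//; move=> ?; rewrite !mxE.
  rewrite (_ : (fun _ => _) = l) // diff_lin //; exact: coord_continuous.
have := cinv_near openT I (cdom_center mfd q).
by apply: filterS => x [_ /= ->].
Qed.

Lemma vec_eq q u v :
  (forall k, der mfd u (fun r => chart q r 0 k) q =
             der mfd v (fun r => chart q r 0 k) q) -> u = v.
Proof.
by move=> uv; rewrite -(coord_id q u) -(coord_id q v); apply/rowP => k; rewrite !mxE.
Qed.

(** At each q the field is given in the chart around q; the chain rule brings it back to the chart
    around p, where its coordinates are the constant u. *)
Lemma cst_vf_der V f p u q : open V -> smooth mfd V f -> V q -> cdom p q ->
  der mfd (cst_vf mfd p u q) f q = 'D_u (f \o cinv p) (chart p q).
Proof.
move=> oV sf Vq pq; rewrite /der.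
have dc k : differentiable (fun y => (chart q \o cinv p) y 0 k) (chart p q).
  apply: (Cinfty_differentiable (smooth_chart q k p)); exists q => //.
  by split => //; exact: cdom_center.
rewrite [RHS](@near_eq_derive _ _ _ _ ((f \o cinv q) \o (chart q \o cinv p))).
  rewrite derive_comp /= ?chartK //.
    congr ('D_ _ _ _); rewrite /cst_vf derive_mx; last first.
      by apply: diff_derivable; exact: differentiable_rV.
    by apply/rowP => k; rewrite !mxE.
  exact: smooth_differentiable sf Vq.
have := cinv_near (cdom_open mfd q) (cdom_center mfd q) pq.
by apply: filterS => x [[_ px] _] /=; rewrite chartK.
Qed.

Lemma cst_vf_lin p q (a : R) u v : cdom p q ->
  cst_vf mfd p (a *: u + v) q = a *: cst_vf mfd p u q + cst_vf mfd p v q.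
Proof.
move=> pq; rewrite /cst_vf.
have dc : differentiable (chart q \o cinv p) (chart p q).
  apply: differentiable_rV => k.
  apply: (Cinfty_differentiable (smooth_chart q k p)); exists q => //.
  by split => //; exact: cdom_center.
by rewrite !deriveE // linearP.
Qed.

Lemma cst_vf_coord p q v : cdom p q -> cst_vf mfd p (coord p v q) q = v.
Proof.
move=> pq; apply: (@vec_eq q) => k.
rewrite (cst_vf_der _ (cdom_open mfd q) (smooth_chart q k)) //; last first.
  exact: cdom_center.
rewrite -(der_coord _ (cdom_open mfd q)) //; last exact: cdom_center.
exact: smooth_chart.
Qed.

Lemma cst_vf_center p u : cst_vf mfd p u p = u.
Proof.
rewrite -{1}(coord_id p u) cst_vf_coord //; exact: cdom_center.
Qed.

Lemma cst_vf_expand p q v : cdom p q ->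
  v = \sum_k coord p v q 0 k *: cst_vf mfd p (delta_mx 0 k) q.
Proof.
move=> pq; rewrite -{1}(cst_vf_coord v pq).
have dc : differentiable (chart q \o cinv p) (chart p q).
  apply: differentiable_rV => k.
  apply: (Cinfty_differentiable (smooth_chart q k p)); exists q => //.
  by split => //; exact: cdom_center.
rewrite /cst_vf deriveE // {1}[coord _ _ _]rV_sum_delta linear_sum.
by apply: eq_bigr => k _; rewrite linearZ deriveE.
Qed.

Lemma cst_vf_smooth p u : smooth_vf mfd (cdom p) (cst_vf mfd p u).
Proof.
move=> V f oV Vp sf.
apply: (@smooth_eq _ ('D_u (f \o cinv p) \o chart p)) => //.
  by move=> q /[1!inE] Vq /=; rewrite (cst_vf_der _ oV) //; exact: Vp.
apply: smooth_comp_chart => //; apply: Cinfty_derive; first exact: chart_image_open.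
exact: sf.
Qed.

Lemma smooth_vf_subset U V X : V `<=` U -> smooth_vf mfd U X -> smooth_vf mfd V X.
Proof.
by move=> VU sX V' f oV' V'V; apply: sX => //; exact: subset_trans V'V VU.
Qed.

Lemma smooth_vf_lin U (a : R) X Y : open U ->
  smooth_vf mfd U X -> smooth_vf mfd U Y ->
  smooth_vf mfd U (fun q => a *: X q + Y q).
Proof.
move=> oU sX sY V f oV VU sf.
apply: (@smooth_eq _ (fun q => a * der mfd (X q) f q + der mfd (Y q) f q)) => //.
  by move=> q /[1!inE] Vq; rewrite (der_lin Vq).
by apply: smoothD => //; [apply: smoothZ => //; exact: sX|exact: sY].
Qed.

Lemma smooth_vf_sum U n (a : 'I_n -> R) (X : 'I_n -> M -> 'rV[R]_m) : open U ->
  (forall k, smooth_vf mfd U (X k)) ->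
  smooth_vf mfd U (fun q => \sum_k a k *: X k q).
Proof.
move=> oU sX V f oV VU sf.
apply: (@smooth_eq _ (fun q => \sum_k a k * der mfd (X k q) f q)) => //.
  by move=> q /[1!inE] Vq; rewrite (der_sum_vec Vq).
by apply: smooth_sum => // k _; apply: smoothZ => //; exact: sX.
Qed.

Lemma coordE p X k :
  (fun q => coord p (X q) q 0 k) = fun q => der mfd (X q) (fun r => chart p r 0 k) q.
Proof. by apply/funext => q; rewrite mxE. Qed.

Lemma coord_smooth U X p k : open U -> smooth_vf mfd U X ->
  smooth mfd (U `&` cdom p) (fun q => coord p (X q) q 0 k).
Proof.
move=> oU sX; have oV : open (U `&` cdom p) by apply: openI => //; exact: cdom_open.
rewrite coordE; apply: sX => //.
apply: smooth_subset (smooth_chart p k); exact: subIsetr.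
Qed.

Lemma der_comp_chart p v (g : 'rV[R]_m -> R) :
  der mfd v (g \o chart p) p = 'D_v g (chart p p).
Proof.
apply: near_eq_derive.
have := cinv_near openT I (cdom_center mfd p).
by apply: filterS => x [_ /= ->].
Qed.

(* Symmetry of second derivatives in the chart around p. *)
Lemma der_bracket U X Y f p : open U -> U p -> smooth_vf mfd U X ->
  smooth_vf mfd U Y -> smooth mfd U f ->
  der mfd (bracket mfd X Y p) f p =
  der mfd (X p) (fun q => der mfd (Y q) f q) p -
  der mfd (Y p) (fun q => der mfd (X q) f q) p.
Proof.
move=> oU Up sX sY sf.
pose F := f \o cinv p; pose D k := 'D_(delta_mx 0 k) F.
pose W := U `&` cdom p.
have oW : open W by apply: openI => //; exact: cdom_open.
have Wp : W p by split => //; exact: cdom_center.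
have oI := chart_image_open (p := p) oW.
have CF : Cinfty (chart p @` (cdom p `&` W)) F.
  by apply: Cinfty_subset (sf p) => _ [q [pq [Uq _]] <-]; exists q.
have Ip := chart_mem Wp.
have CD k := Cinfty_partial k CF.
have expand Z q : W q -> der mfd (Z q) f q =
    \sum_k coord p (Z q) q 0 k * (D k \o chart p) q.
  move=> [Uq pq]; rewrite (der_coord _ oU sf Uq pq) derive_sum_partial //.
  by apply: Cinfty_differentiable (CF) _; exists q.
have sD k : smooth mfd W (D k \o chart p).
  by apply: (smooth_comp_chart oW _ (CD k)) => q [].

(* The first sum is the part that the bracket keeps. The second is the Hessian of f in the chart,
   contracted with Z and Z'; by [derive_sym] it drops out when X and Y are exchanged and the results
   subtracted. *)
have second Z Z' : smooth_vf mfd U Z -> smooth_vf mfd U Z' ->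
    der mfd (Z p) (fun q => der mfd (Z' q) f q) p =
    \sum_k der mfd (Z p) (fun q => coord p (Z' q) q 0 k) p * D k (chart p p) +
    \sum_k \sum_j Z' p 0 k * Z p 0 j * 'D_(delta_mx 0 j) (D k) (chart p p).
  move=> sZ sZ'; rewrite (@der_eq W _ (fun q => \sum_k coord p (Z' q) q 0 k * (D k \o chart p) q)) //; last first.
    by move=> q /[1!inE] Wq; exact: expand.
  have sc k : smooth mfd W (fun q => coord p (Z' q) q 0 k) by exact: coord_smooth.
  rewrite (der_sum _ _ oW Wp) //; last by move=> k; exact: smoothM.
  rewrite -big_split /=; apply: eq_bigr => k _.
  rewrite (derM Wp _ (sc k) (sD k)) coord_id addrC mulrC; congr (_ + _); last first.
    by rewrite mulrC.
  rewrite der_comp_chart derive_sum_partial; last exact: Cinfty_differentiable (CD k) Ip.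
  by rewrite mulrC mulr_sumr; apply: eq_bigr => j _; rewrite mulrA.
rewrite !second // (expand (bracket mfd X Y)) // coord_id.
rewrite opprD addrACA -!sumrB [X in _ = _ + X](_ : _ = 0) ?addr0.
  by apply: eq_bigr => k _; rewrite mxE /= -mulrBl !coordE.
rewrite sumrB exchange_big /= -sumrB big1 // => j _; rewrite -sumrB big1 // => k _.
rewrite (derive_sym (D := chart p @` (cdom p `&` W))) //.
- by rewrite (mulrC (X p 0 j)) subrr.
- by move=> y; exact: Cinfty_differentiable.
- exact: Cinfty_differentiable Ip.
- exact: Cinfty_differentiable Ip.
Qed.

Lemma bracket_smooth U X Y : open U -> smooth_vf mfd U X -> smooth_vf mfd U Y ->
  smooth_vf mfd U (bracket mfd X Y).
Proof.
move=> oU sX sY V f oV VU sf.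
have sXV := smooth_vf_subset VU sX; have sYV := smooth_vf_subset VU sY.
apply: (@smooth_eq _ (fun q => der mfd (X q) (fun q => der mfd (Y q) f q) q -
  der mfd (Y q) (fun q => der mfd (X q) f q) q)) => //.
  by move=> q /[1!inE] Vq; rewrite (der_bracket oV).
by apply: smoothB => //; [apply: sX => //; exact: sY|apply: sY => //; exact: sX].
Qed.

Lemma ev_sum (eta : 'cV[R]_m) n (a : 'I_n -> R) (w : 'I_n -> 'rV[R]_m) :
  ev eta (\sum_k a k *: w k) = \sum_k a k * ev eta (w k).
Proof.
rewrite /ev mulmx_suml summxE; apply: eq_bigr => k _.
by rewrite -scalemxAl mxE.
Qed.

(** [dform] is defined by the extensions of X p and Y p with constant coordinates. When X and Y are
    expanded in the coordinate fields around p, the derivatives of their coefficients add up to eta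
    [X, Y], which the last term removes. *)
Lemma dformE U eta X Y p : open U -> U p -> smooth_form mfd U eta ->
  smooth_vf mfd U X -> smooth_vf mfd U Y ->
  dform mfd eta p (X p) (Y p) =
  der mfd (X p) (fun q => ev (eta q) (Y q)) p -
  der mfd (Y p) (fun q => ev (eta q) (X q)) p - ev (eta p) (bracket mfd X Y p).
Proof.
move=> oU Up se sX sY.
pose W := U `&` cdom p.
have oW : open W by apply: openI => //; exact: cdom_open.
have Wp : W p by split => //; exact: cdom_center.
pose E k q := ev (eta q) (cst_vf mfd p (delta_mx 0 k) q).
have sE k : smooth mfd W (E k).
  apply: se => //; first exact: subIsetl.
  apply: smooth_vf_subset (cst_vf_smooth (p := p) _); exact: subIsetr.
have ev_cst u q : W q -> ev (eta q) (cst_vf mfd p u q) = \sum_k u 0 k * E k q.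
  move=> [Uq pq]; rewrite -ev_sum; congr (ev _ _).
  have dc : differentiable (chart q \o cinv p) (chart p q).
    apply: differentiable_rV => k.
    apply: (Cinfty_differentiable (smooth_chart q k p)); exists q => //.
    by split => //; exact: cdom_center.
  rewrite /cst_vf deriveE // {1}[u]rV_sum_delta linear_sum.
  by apply: eq_bigr => k _; rewrite linearZ deriveE.
have evZ Z q : W q -> ev (eta q) (Z q) = \sum_k coord p (Z q) q 0 k * E k q.
  by move=> [Uq pq]; rewrite {1}(cst_vf_expand (Z q) pq) ev_sum.
have der1 v Z : smooth_vf mfd U Z -> der mfd v (fun q => ev (eta q) (Z q)) p =
   der mfd v (fun q => ev (eta q) (cst_vf mfd p (Z p) q)) p +
   \sum_k E k p * der mfd v (fun q => coord p (Z q) q 0 k) p.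
  move=> sZ; have sc k : smooth mfd W (fun q => coord p (Z q) q 0 k).
    exact: coord_smooth.
  rewrite (@der_eq W _ (fun q => \sum_k coord p (Z q) q 0 k * E k q)) //; last first.
    by move=> q /[1!inE] Wq; exact: evZ.
  rewrite (der_sum _ _ oW Wp) //; last by move=> k; exact: smoothM.
  rewrite (@der_eq W _ (fun q => \sum_k Z p 0 k * E k q)) //; last first.
    by move=> q /[1!inE] Wq; exact: ev_cst.
  rewrite (der_sum _ _ oW Wp) //; last by move=> k; exact: smoothZ.
  rewrite -big_split /=; apply: eq_bigr => k _.
  by rewrite (derM Wp) // (derZ _ _ Wp) // coord_id.
rewrite (der1 (X p) Y) // (der1 (Y p) X) // -[bracket _ _ _ p](cst_vf_center p) ev_cst //.
rewrite (_ : \sum_k bracket mfd X Y p 0 k * E k p =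
  \sum_k E k p * der mfd (X p) (fun q => coord p (Y q) q 0 k) p -
  \sum_k E k p * der mfd (Y p) (fun q => coord p (X q) q 0 k) p).
  have aux (a b s t : R) : a - b = a + s - (b + t) - (s - t) by ring.
  exact: aux.
by rewrite -sumrB; apply: eq_bigr => k _; rewrite mxE /= !coordE mulrC mulrBr.
Qed.

(** Applied to a coordinate function, each double bracket expands by [der_bracket] into four
    third-order terms, and the twelve terms cancel in pairs. The coordinate functions are smooth on
    [cdom mfd p], whence the intersection with it. *)
Lemma jacobi U X Y Z p : open U -> U p -> smooth_vf mfd U X ->
  smooth_vf mfd U Y -> smooth_vf mfd U Z ->
  bracket mfd (bracket mfd X Y) Z p + bracket mfd (bracket mfd Y Z) X p +
  bracket mfd (bracket mfd Z X) Y p = 0.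
Proof.
move=> oU Up sX sY sZ; pose W := U `&` cdom p.
have oW : open W by apply: openI => //; exact: cdom_open.
have Wp : W p by split => //; exact: cdom_center.
have sub (V : M -> 'rV[R]_m) : smooth_vf mfd U V -> smooth_vf mfd W V.
  by apply: smooth_vf_subset; exact: subIsetl.
move: sX sY sZ => /sub sX /sub sY /sub sZ.
apply: (@vec_eq p) => k; set f := fun r => chart p r 0 k.
have sf : smooth mfd W f.
  by apply: smooth_subset (smooth_chart p k); exact: subIsetr.
have br (V V' V'' : M -> 'rV[R]_m) : smooth_vf mfd W V -> smooth_vf mfd W V' -> smooth_vf mfd W V'' ->
    der mfd (bracket mfd (bracket mfd V V') V'' p) f p =
    der mfd (V p) (fun r => der mfd (V' r) (fun r => der mfd (V'' r) f r) r) p -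
    der mfd (V' p) (fun r => der mfd (V r) (fun r => der mfd (V'' r) f r) r) p -
    (der mfd (V'' p) (fun r => der mfd (V r) (fun r => der mfd (V' r) f r) r) p -
     der mfd (V'' p) (fun r => der mfd (V' r) (fun r => der mfd (V r) f r) r) p).
  move=> s1 s2 s3.
  have sub1 (V0 : M -> 'rV[R]_m) g : smooth_vf mfd W V0 -> smooth mfd W g ->
      smooth mfd W (fun q => der mfd (V0 q) g q).
    by move=> sV0 sg; apply: sV0.
  have s4 := sub1 _ _ s3 sf; have s12 := bracket_smooth oW s1 s2.
  have s5 := sub1 _ _ s1 (sub1 _ _ s2 sf); have s6 := sub1 _ _ s2 (sub1 _ _ s1 sf).
  have E1 := der_bracket oW Wp s12 s3 sf.
  have E2 := der_bracket oW Wp s1 s2 s4.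
  have E3 : der mfd (V'' p) (fun q => der mfd (bracket mfd V V' q) f q) p =
      der mfd (V'' p) (fun r => der mfd (V r) (fun r => der mfd (V' r) f r) r -
              der mfd (V' r) (fun r => der mfd (V r) f r) r) p.
    apply: (der_eq _ oW Wp) => r /[1!inE] Wr; exact: (der_bracket oW Wr s1 s2 sf).
  have E4 := derB (V'' p) oW Wp s5 s6.
  exact: (etrans E1 (f_equal2 (fun x y => x - y) E2 (etrans E3 E4))).
have dD u v : der mfd (u + v) f p = der mfd u f p + der mfd v f p.
  by have := der_lin Wp 1 u v sf; rewrite scale1r mul1r.
rewrite dD dD.
have E := f_equal2 +%R (f_equal2 +%R (br X Y Z sX sY sZ) (br Y Z X sY sZ sX)) (br Z X Y sZ sX sY).
have d0 : der mfd 0 f p = 0.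
  have := dD 0 0; rewrite addr0 => d00; apply/eqP.
  by rewrite -subr_eq0 subr0 -(inj_eq (addrI (der mfd 0 f p))) addr0 -d00.
have aux (a b c d e' g : R) :
  a + - b + - (c + - d) + (e' + - d + - (a + - g)) + (c + - g + - (e' + - b)) = 0 by ring.
exact: (etrans E (etrans (aux _ _ _ _ _ _) (esym d0))).
Qed.

End ManifoldCalculus.

(** * Complex-valued functions, forms and matrices *)

Section ComplexParts.
Context {R : realType}.
Implicit Types (a : R) (x y : R[i]).

Lemma complex_ext x y : complex.Re x = complex.Re y ->
  complex.Im x = complex.Im y -> x = y.
Proof. by case: x => a b; case: y => c d /= -> ->. Qed.

Lemma cReD x y : complex.Re (x + y) = complex.Re x + complex.Re y.
Proof. by case: x; case: y. Qed.
Lemma cImD x y : complex.Im (x + y) = complex.Im x + complex.Im y.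
Proof. by case: x; case: y. Qed.
Lemma cReM x y : complex.Re (x * y) =
  complex.Re x * complex.Re y - complex.Im x * complex.Im y.
Proof. by case: x; case: y. Qed.
Lemma cImM x y : complex.Im (x * y) =
  complex.Re x * complex.Im y + complex.Im x * complex.Re y.
Proof. by case: x; case: y. Qed.
Lemma cReN x : complex.Re (- x) = - complex.Re x. Proof. by case: x. Qed.
Lemma cImN x : complex.Im (- x) = - complex.Im x. Proof. by case: x. Qed.
Lemma cReJ x : complex.Re (conjc x) = complex.Re x. Proof. by case: x. Qed.
Lemma cImJ x : complex.Im (conjc x) = - complex.Im x. Proof. by case: x. Qed.

End ComplexParts.

Section ComplexCalculus.
Context {R : realType} {m : nat} {M : topologicalType}.
Variable mfd : manifold R m M.
Implicit Types (U V : set M) (f g : M -> R[i]) (p q : M) (u v w : 'rV[R]_m).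
Implicit Types (X Y : M -> 'rV[R]_m).

Lemma csmooth_subset U V f : V `<=` U -> csmooth mfd U f -> csmooth mfd V f.
Proof. by move=> VU [s1 s2]; split; exact: smooth_subset VU _. Qed.

Lemma csmooth_eq U f g : open U -> {in U, f =1 g} -> csmooth mfd U f ->
  csmooth mfd U g.
Proof.
move=> oU fg [s1 s2]; split.
  by apply: smooth_eq s1 => // q Uq /=; rewrite fg.
by apply: smooth_eq s2 => // q Uq /=; rewrite fg.
Qed.

Lemma csmooth_cst U (a : R[i]) : csmooth mfd U (fun=> a).
Proof. by split; exact: smooth_cst. Qed.

Lemma csmooth_real U (f : M -> R) : smooth mfd U f ->
  csmooth mfd U (fun q => (f q)%:C%C).
Proof. by move=> sf; split => //; exact: smooth_cst. Qed.

Lemma csmoothD U f g : open U -> csmooth mfd U f -> csmooth mfd U g ->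
  csmooth mfd U (fun q => f q + g q).
Proof.
move=> oU [f1 f2] [g1 g2]; split.
  by apply: smooth_eq (smoothD oU f1 g1) => // q _; rewrite cReD.
by apply: smooth_eq (smoothD oU f2 g2) => // q _; rewrite cImD.
Qed.

Lemma csmoothM U f g : open U -> csmooth mfd U f -> csmooth mfd U g ->
  csmooth mfd U (fun q => f q * g q).
Proof.
move=> oU [f1 f2] [g1 g2]; split.
  apply: smooth_eq (smoothB oU (smoothM oU f1 g1) (smoothM oU f2 g2)) => // q _.
  by rewrite cReM.
apply: smooth_eq (smoothD oU (smoothM oU f1 g2) (smoothM oU f2 g1)) => // q _.
by rewrite cImM.
Qed.

Lemma csmooth_sum U (I : Type) (r : seq I) (F : I -> M -> R[i]) :
  open U -> (forall i, csmooth mfd U (F i)) ->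
  csmooth mfd U (fun q => \sum_(i <- r) F i q).
Proof.
move=> oU sF; elim: r => [|i r IH].
  by apply: csmooth_eq (csmooth_cst U 0) => // x _; rewrite big_nil.
by apply: csmooth_eq (csmoothD oU (sF i) IH) => // x _; rewrite big_cons.
Qed.

Lemma cder_eq U f g v q : open U -> U q -> {in U, f =1 g} ->
  cder mfd v f q = cder mfd v g q.
Proof.
move=> oU Uq fg; rewrite /cder.
by congr Complex; apply: (der_eq _ _ oU Uq) => x Ux /=; rewrite fg.
Qed.

Lemma cder_cst v (a : R[i]) q : cder mfd v (fun=> a) q = 0.
Proof. by rewrite /cder !der_cst. Qed.

Lemma cder_smooth U X f : open U -> smooth_vf mfd U X -> csmooth mfd U f ->
  csmooth mfd U (fun q => cder mfd (X q) f q).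
Proof. by move=> oU sX [f1 f2]; split => /=; exact: sX. Qed.

Section Pointwise.
Variables (U : set M) (q : M).
Hypotheses (oU : open U) (Uq : U q).

Lemma cderD v f g : csmooth mfd U f -> csmooth mfd U g ->
  cder mfd v (fun r => f r + g r) q = cder mfd v f q + cder mfd v g q.
Proof.
move=> [f1 f2] [g1 g2]; rewrite /cder /=; apply: complex_ext => /=.
  rewrite -(derD Uq) //; apply: (der_eq _ _ oU Uq) => r _; exact: cReD.
rewrite -(derD Uq) //; apply: (der_eq _ _ oU Uq) => r _; exact: cImD.
Qed.

Lemma cderM v f g : csmooth mfd U f -> csmooth mfd U g ->
  cder mfd v (fun r => f r * g r) q = cder mfd v f q * g q + f q * cder mfd v g q.
Proof.
move=> [f1 f2] [g1 g2]; apply: complex_ext.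
  rewrite cReD !cReM /=.
  rewrite (@der_eq _ _ _ _ U _ (fun r => complex.Re (f r) * complex.Re (g r) -
    complex.Im (f r) * complex.Im (g r))) //; last by move=> r _; exact: cReM.
  rewrite (derB _ oU Uq) ?(derM Uq) //; try exact: smoothM.
  by rewrite (mulrC (complex.Re (g q))) (mulrC (complex.Im (g q))) opprD addrACA addrC.
rewrite cImD !cImM /=.
rewrite (@der_eq _ _ _ _ U _ (fun r => complex.Re (f r) * complex.Im (g r) +
    complex.Im (f r) * complex.Re (g r))) //; last by move=> r _; exact: cImM.
rewrite (derD Uq) ?(derM Uq) //; try exact: smoothM.
by rewrite (mulrC (complex.Re (g q))) (mulrC (complex.Im (g q))) addrACA addrC.
Qed.

Lemma cder_lin f (a : R) u v : csmooth mfd U f ->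
  cder mfd (a *: u + v) f q = a%:C%C * cder mfd u f q + cder mfd v f q.
Proof.
move=> [f1 f2]; apply: complex_ext; rewrite ?cReD ?cImD ?cReM ?cImM /=.
  by rewrite (der_lin Uq) // mul0r subr0.
by rewrite (der_lin Uq) // mul0r addr0.
Qed.

Lemma cder_conj v f : csmooth mfd U f ->
  cder mfd v (fun r => conjc (f r)) q = conjc (cder mfd v f q).
Proof.
move=> [f1 f2]; apply: complex_ext; rewrite ?cReJ ?cImJ /=.
  by apply: (der_eq _ _ oU Uq) => r _; rewrite cReJ.
rewrite -(derN _ Uq) //; by apply: (der_eq _ _ oU Uq) => r _; rewrite cImJ.
Qed.

Lemma cder_bracket X Y f : smooth_vf mfd U X -> smooth_vf mfd U Y ->
  csmooth mfd U f ->
  cder mfd (bracket mfd X Y q) f q =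
  cder mfd (X q) (fun r => cder mfd (Y r) f r) q -
  cder mfd (Y q) (fun r => cder mfd (X r) f r) q.
Proof.
move=> sX sY [f1 f2]; apply: complex_ext; rewrite ?cReD ?cImD ?cReN ?cImN /=;
by rewrite (der_bracket oU).
Qed.

Lemma cder_sum v (I : Type) (r : seq I) (F : I -> M -> R[i]) :
  (forall i, csmooth mfd U (F i)) ->
  cder mfd v (fun x => \sum_(i <- r) F i x) q = \sum_(i <- r) cder mfd v (F i) q.
Proof.
move=> sF; elim: r => [|i r IH].
  rewrite (@cder_eq U _ (fun=> 0)) ?cder_cst ?big_nil //.
  by move=> x _; rewrite big_nil.
rewrite big_cons -IH -cderD //; last exact: csmooth_sum.
by apply: (@cder_eq U) => // x _; rewrite big_cons.
Qed.

End Pointwise.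

Lemma cevE (eta : 'cV[R[i]]_m) v : cev eta v =
  Complex (ev (map_mx (@complex.Re R) eta) v) (ev (map_mx (@complex.Im R) eta) v).
Proof.
rewrite /cev /ev !mxE; apply: complex_ext => /=.
  rewrite (big_morph _ cReD (erefl : complex.Re (0 : R[i]) = 0)).
  by apply: eq_bigr => k _; rewrite !mxE cReM /= mul0r subr0.
rewrite (big_morph _ cImD (erefl : complex.Im (0 : R[i]) = 0)).
by apply: eq_bigr => k _; rewrite !mxE cImM /= mul0r addr0.
Qed.

Lemma ev_lin (eta : 'cV[R]_m) (a : R) u v :
  ev eta (a *: u + v) = a * ev eta u + ev eta v.
Proof. by rewrite /ev mulmxDl -scalemxAl !mxE. Qed.

Lemma cev_lin (eta : 'cV[R[i]]_m) (a : R) u v :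
  cev eta (a *: u + v) = a%:C%C * cev eta u + cev eta v.
Proof.
rewrite /cev !mxE mulr_sumr -big_split /=; apply: eq_bigr => k _.
by rewrite !mxE (rmorphD (real_complex R)) (rmorphM (real_complex R)) mulrDl mulrA.
Qed.

Lemma csmooth_formP U (eta : M -> 'cV[R[i]]_m) :
  csmooth_form mfd U eta <->
  smooth_form mfd U (fun q => map_mx (@complex.Re R) (eta q)) /\
  smooth_form mfd U (fun q => map_mx (@complex.Im R) (eta q)).
Proof.
split=> [se|[s1 s2] V X oV VU sX].
  split=> V X oV VU sX; have [s1 s2] := se V X oV VU sX.
    by apply: smooth_eq s1 => // q _; rewrite cevE.
  by apply: smooth_eq s2 => // q _; rewrite cevE.
split.
  by apply: smooth_eq (s1 V X oV VU sX) => // q _; rewrite cevE.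
by apply: smooth_eq (s2 V X oV VU sX) => // q _; rewrite cevE.
Qed.

Lemma cdform_parts (eta : M -> 'cV[R[i]]_m) p u v : cdform mfd eta p u v =
  Complex (dform mfd (fun q => map_mx (@complex.Re R) (eta q)) p u v)
          (dform mfd (fun q => map_mx (@complex.Im R) (eta q)) p u v).
Proof.
apply: complex_ext; rewrite /cdform /dform ?cReD ?cImD ?cReN ?cImN /=.
  by congr (_ - _); apply: (der_eq _ _ openT) => // q _; rewrite cevE.
by congr (_ - _); apply: (der_eq _ _ openT) => // q _; rewrite cevE.
Qed.

Lemma cdformE U (eta : M -> 'cV[R[i]]_m) X Y p : open U -> U p ->
  csmooth_form mfd U eta -> smooth_vf mfd U X -> smooth_vf mfd U Y ->
  cdform mfd eta p (X p) (Y p) =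
  cder mfd (X p) (fun q => cev (eta q) (Y q)) p -
  cder mfd (Y p) (fun q => cev (eta q) (X q)) p - cev (eta p) (bracket mfd X Y p).
Proof.
move=> oU Up /csmooth_formP [s1 s2] sX sY.
rewrite cdform_parts (dformE oU Up s1) // (dformE oU Up s2) //.
rewrite cevE; apply: complex_ext; rewrite ?cReD ?cImD ?cReN ?cImN /=.
  by congr (_ - _ - _); apply: (der_eq _ _ openT) => // q _; rewrite cevE.
by congr (_ - _ - _); apply: (der_eq _ _ openT) => // q _; rewrite cevE.
Qed.

Definition msmooth U a b (F : M -> 'M[R[i]]_(a, b)) :=
  forall i j, csmooth mfd U (fun q => F q i j).

Definition mder v a b (F : M -> 'M[R[i]]_(a, b)) q : 'M[R[i]]_(a, b) :=
  \matrix_(i, j) cder mfd v (fun r => F r i j) q.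

Lemma msmooth_cst U a b (A : 'M[R[i]]_(a, b)) : msmooth U (fun=> A).
Proof. by move=> i j; exact: csmooth_cst. Qed.

Lemma msmooth_eq U a b (F G : M -> 'M[R[i]]_(a, b)) : open U -> {in U, F =1 G} ->
  msmooth U F -> msmooth U G.
Proof. by move=> oU FG sF i j; apply: csmooth_eq (sF i j) => // q Uq; rewrite FG. Qed.

Lemma mder_eq U a b (F G : M -> 'M[R[i]]_(a, b)) v q : open U -> U q ->
  {in U, F =1 G} -> mder v F q = mder v G q.
Proof.
move=> oU Uq FG; apply/matrixP => i j; rewrite !mxE.
by apply: (cder_eq _ oU Uq) => r Ur; rewrite FG.
Qed.

Lemma mder_cst v a b (A : 'M[R[i]]_(a, b)) q : mder v (fun=> A) q = 0.
Proof. by apply/matrixP => i j; rewrite !mxE cder_cst. Qed.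

Lemma msmoothD U a b (F G : M -> 'M[R[i]]_(a, b)) : open U ->
  msmooth U F -> msmooth U G -> msmooth U (fun q => F q + G q).
Proof.
move=> oU sF sG i j; apply: csmooth_eq (csmoothD oU (sF i j) (sG i j)) => // q _.
by rewrite mxE.
Qed.

Lemma msmooth_sum U a b (I : Type) (r : seq I) (F : I -> M -> 'M[R[i]]_(a, b)) :
  open U -> (forall i, msmooth U (F i)) ->
  msmooth U (fun q => \sum_(i <- r) F i q).
Proof.
move=> oU sF; elim: r => [|i r IH].
  by apply: msmooth_eq (msmooth_cst U 0) => // x _; rewrite big_nil.
by apply: msmooth_eq (msmoothD oU (sF i) IH) => // x _; rewrite big_cons.
Qed.

Lemma msmoothM U a b c (F : M -> 'M[R[i]]_(a, b)) (G : M -> 'M[R[i]]_(b, c)) :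
  open U -> msmooth U F -> msmooth U G -> msmooth U (fun q => F q *m G q).
Proof.
move=> oU sF sG i j.
apply: (@csmooth_eq _ (fun q => \sum_k F q i k * G q k j)) => //.
  by move=> q _; rewrite mxE.
by apply: csmooth_sum => // k; exact: csmoothM.
Qed.

Lemma msmoothZ U a b f (F : M -> 'M[R[i]]_(a, b)) : open U ->
  csmooth mfd U f -> msmooth U F -> msmooth U (fun q => f q *: F q).
Proof.
move=> oU sf sF i j; apply: csmooth_eq (csmoothM oU sf (sF i j)) => // q _.
by rewrite mxE.
Qed.

Section MatrixPointwise.
Variables (U : set M) (q : M).
Hypotheses (oU : open U) (Uq : U q).

Lemma mderD v a b (F G : M -> 'M[R[i]]_(a, b)) : msmooth U F -> msmooth U G ->
  mder v (fun r => F r + G r) q = mder v F q + mder v G q.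
Proof.
move=> sF sG; apply/matrixP => i j; rewrite !mxE -(cderD oU Uq) //.
by apply: (cder_eq _ oU Uq) => r _; rewrite mxE.
Qed.

Lemma mder_sum v a b (I : Type) (s : seq I) (F : I -> M -> 'M[R[i]]_(a, b)) :
  (forall i, msmooth U (F i)) ->
  mder v (fun r => \sum_(i <- s) F i r) q = \sum_(i <- s) mder v (F i) q.
Proof.
move=> sF; apply/matrixP => i j; rewrite summxE.
rewrite (eq_bigr (fun k => cder mfd v (fun r => F k r i j) q)); last first.
  by move=> k _; rewrite mxE.
rewrite -(cder_sum oU Uq) //; last by move=> k; exact: sF.
by rewrite mxE; apply: (cder_eq _ oU Uq) => r _; rewrite summxE.
Qed.

Lemma mderM v a b c (F : M -> 'M[R[i]]_(a, b)) (G : M -> 'M[R[i]]_(b, c)) :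
  msmooth U F -> msmooth U G ->
  mder v (fun r => F r *m G r) q = mder v F q *m G q + F q *m mder v G q.
Proof.
move=> sF sG; apply/matrixP => i j; rewrite !mxE -big_split /=.
rewrite (@cder_eq U _ (fun r => \sum_k F r i k * G r k j)) //; last first.
  by move=> r _; rewrite mxE.
rewrite (cder_sum oU Uq); last by move=> k; exact: csmoothM.
by apply: eq_bigr => k _; rewrite (cderM oU Uq) // !mxE.
Qed.

Lemma mderMl v a b c (A : 'M[R[i]]_(a, b)) (G : M -> 'M[R[i]]_(b, c)) :
  msmooth U G -> mder v (fun r => A *m G r) q = A *m mder v G q.
Proof.
by move=> sG; rewrite mderM //; [rewrite mder_cst mul0mx add0r|exact: msmooth_cst].
Qed.

Lemma mderZ v a b f (A : 'M[R[i]]_(a, b)) : csmooth mfd U f ->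
  mder v (fun r => f r *: A) q = cder mfd v f q *: A.
Proof.
move=> sf; apply/matrixP => i j; rewrite !mxE.
rewrite (@cder_eq U _ (fun r => f r * A i j)) //; last by move=> r _; rewrite mxE.
by rewrite (cderM oU Uq) // ?cder_cst ?mulr0 ?addr0 //; exact: csmooth_cst.
Qed.

Lemma mder_lin a b (F : M -> 'M[R[i]]_(a, b)) (c : R) u v : msmooth U F ->
  mder (c *: u + v) F q = c%:C%C *: mder u F q + mder v F q.
Proof. by move=> sF; apply/matrixP => i j; rewrite !mxE (cder_lin Uq). Qed.

Lemma mder_bracket X Y a b (F : M -> 'M[R[i]]_(a, b)) :
  smooth_vf mfd U X -> smooth_vf mfd U Y -> msmooth U F ->
  mder (bracket mfd X Y q) F q =
  mder (X q) (fun r => mder (Y r) F r) q - mder (Y q) (fun r => mder (X r) F r) q.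
Proof.
move=> sX sY sF; apply/matrixP => i j; rewrite !mxE (cder_bracket oU Uq) //.
by congr (_ - _); apply: (cder_eq _ oU Uq) => r _; rewrite mxE.
Qed.

End MatrixPointwise.

Lemma mder_smooth U X a b (F : M -> 'M[R[i]]_(a, b)) : open U ->
  smooth_vf mfd U X -> msmooth U F -> msmooth U (fun q => mder (X q) F q).
Proof.
move=> oU sX sF i j; apply: csmooth_eq (cder_smooth oU sX (sF i j)) => // q _.
by rewrite mxE.
Qed.

End ComplexCalculus.

Section Forms.
Context {R : realType} {m : nat} {M : topologicalType}.
Variable mfd : manifold R m M.
Implicit Types (U V : set M) (p q : M) (u v w : 'rV[R]_m) (eta : M -> 'cV[R]_m).

Lemma smooth_form_subset U V eta : V `<=` U -> smooth_form mfd U eta ->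
  smooth_form mfd V eta.
Proof.
by move=> VU se V' X oV' V'V sX; apply: se => //; exact: subset_trans V'V VU.
Qed.

Lemma dformC eta p u v : dform mfd eta p u v = - dform mfd eta p v u.
Proof. by rewrite /dform opprB. Qed.

(** Both ingredients depend linearly on the vector: the derivation along it and its extension
    [cst_vf]. *)
Lemma dform_linl U eta p (a : R) u v w : open U -> U p -> smooth_form mfd U eta ->
  dform mfd eta p (a *: u + v) w = a * dform mfd eta p u w + dform mfd eta p v w.
Proof.
move=> oU Up se; pose W := U `&` cdom mfd p.
have oW : open W by apply: openI => //; exact: cdom_open.
have Wp : W p by split => //; exact: cdom_center.
have sE z : smooth mfd W (fun q => ev (eta q) (cst_vf mfd p z q)).
  apply: se => //; first exact: subIsetl.
  apply: smooth_vf_subset (cst_vf_smooth (p := p) _); exact: subIsetr.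
have E1 := der_lin Wp a u v (sE w).
have E2 : der mfd w (fun q => ev (eta q) (cst_vf mfd p (a *: u + v) q)) p =
   a * der mfd w (fun q => ev (eta q) (cst_vf mfd p u q)) p +
   der mfd w (fun q => ev (eta q) (cst_vf mfd p v q)) p.
  have E3 := derD Wp w (smoothZ a oW (sE u)) (sE v).
  have E4 := derZ w a Wp (sE u).
  have E5 := etrans E3 (f_equal2 +%R E4 erefl).
  apply: etrans E5.
  apply: (der_eq _ _ oW Wp) => q /[1!inE] -[_ pq].
  by rewrite cst_vf_lin // ev_lin.
have aux (b c d e f : R) : b * c + d - (b * e + f) = b * (c - e) + (d - f) by ring.
exact: (etrans (f_equal2 (fun x y => x - y) E1 E2) (aux _ _ _ _ _)).
Qed.

Lemma dform_linr U eta p (a : R) u v w : open U -> U p -> smooth_form mfd U eta ->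
  dform mfd eta p w (a *: u + v) = a * dform mfd eta p w u + dform mfd eta p w v.
Proof.
move=> oU Up se; rewrite dformC (dform_linl _ _ _ _ oU Up se) opprD -mulrN.
by rewrite (dformC _ _ w u) (dformC _ _ w v).
Qed.

Lemma cdformC (eta : M -> 'cV[R[i]]_m) p u v :
  cdform mfd eta p u v = - cdform mfd eta p v u.
Proof. by rewrite /cdform opprB. Qed.

Lemma cdform_linl U (eta : M -> 'cV[R[i]]_m) p (a : R) u v w : open U -> U p ->
  csmooth_form mfd U eta ->
  cdform mfd eta p (a *: u + v) w =
  a%:C%C * cdform mfd eta p u w + cdform mfd eta p v w.
Proof.
move=> oU Up /csmooth_formP [s1 s2]; rewrite !cdform_parts.
rewrite (dform_linl _ _ _ _ oU Up s1) (dform_linl _ _ _ _ oU Up s2).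
by apply: complex_ext; rewrite ?cReD ?cImD ?cReM ?cImM /= mul0r ?subr0 ?addr0.
Qed.

Lemma smooth_dform U eta X Y : open U -> smooth_form mfd U eta ->
  smooth_vf mfd U X -> smooth_vf mfd U Y ->
  smooth mfd U (fun q => dform mfd eta q (X q) (Y q)).
Proof.
move=> oU se sX sY.
apply: (@smooth_eq _ _ _ _ _ (fun q => der mfd (X q) (fun q => ev (eta q) (Y q)) q -
  der mfd (Y q) (fun q => ev (eta q) (X q)) q - ev (eta q) (bracket mfd X Y q))) => //.
  by move=> q /[1!inE] Uq; rewrite (dformE oU Uq se sX sY).
have sub : U `<=` U by [].
apply: smoothB => //; last exact: (se U _ oU sub (bracket_smooth oU sX sY)).
apply: smoothB => //.
  exact: (sX U _ oU sub (se U _ oU sub sY)).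
exact: (sY U _ oU sub (se U _ oU sub sX)).
Qed.

End Forms.

(** * Adapted frames and the structure equations *)

Section Frame.
Context {R : realType} {n : nat} {M : topologicalType}.
Local Notation m := (n + n).+1.
Variables (mfd : manifold R m M) (ph : pseudohermitian mfd).
Implicit Types (p q : M) (u v w : 'rV[R]_m).

Local Notation th := (theta ph).
Local Notation dth := (dform mfd (theta ph)).
Local Notation metric := (levi mfd (theta ph) (J ph)).
Local Notation T := (reeb ph).

Lemma dth_lin p (a : R) u v w : dth p (a *: u + v) w = a * dth p u w + dth p v w.
Proof. exact: (dform_linl _ _ _ _ openT _ (theta_smooth ph)). Qed.

Lemma dth_linr p (a : R) u v w : dth p w (a *: u + v) = a * dth p w u + dth p w v.
Proof. exact: (dform_linr _ _ _ _ openT _ (theta_smooth ph)). Qed.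

Lemma leviE p u v : metric p u v = 2^-1 * dth p u (v *m J ph p).
Proof. by []. Qed.

#[local] Opaque levi dform der.

Lemma metric_lin p (a : R) u v w :
  metric p (a *: u + v) w = a * metric p u w + metric p v w.
Proof. by rewrite !leviE dth_lin mulrDr mulrCA. Qed.

Lemma metric_linr p (a : R) u v w :
  metric p w (a *: u + v) = a * metric p w u + metric p w v.
Proof. by rewrite !leviE mulmxDl -scalemxAl dth_linr mulrDr mulrCA. Qed.

Lemma lin0 (f : 'rV[R]_m -> R) :
  (forall (a : R) u v, f (a *: u + v) = a * f u + f v) -> f 0 = 0.
Proof. by move=> fl; have := fl (-1) 0 0; rewrite scaler0 addr0 mulN1r addNr. Qed.

Lemma lin_sum (f : 'rV[R]_m -> R) k (a : 'I_k -> R) (w : 'I_k -> 'rV[R]_m) :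
  (forall (a : R) u v, f (a *: u + v) = a * f u + f v) ->
  f (\sum_i a i *: w i) = \sum_i a i * f (w i).
Proof.
move=> fl; elim: k a w => [|k IH] a w; first by rewrite !big_ord0 lin0.
by rewrite !big_ord_recl fl IH.
Qed.

(** As theta(T) = 1 is constant, Cartan's formula gives dtheta(T, Y) = T (theta Y) - theta [T, Y],
    which is (L_T theta)(Y) = 0. *)
Lemma dth_reeb p v : dth p (T p) v = 0.
Proof.
have oV := cdom_open mfd p; have Vp := cdom_center mfd p.
have sT : smooth_vf mfd (cdom mfd p) T.
  by apply: smooth_vf_subset (reeb_smooth ph).
have sY := cst_vf_smooth (mfd := mfd) (p := p) v.
have sth : smooth_form mfd (cdom mfd p) th.
  by apply: smooth_form_subset (theta_smooth ph).
have := dformE oV Vp sth sT sY.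
rewrite cst_vf_center => ->.
rewrite (der_eq _ v oV Vp (g := fun=> 1)) ?der_cst; last first.
  by move=> q _; rewrite theta_reeb.
rewrite subr0; exact: (lie_reeb_theta ph oV sY Vp).
Qed.

(** [levi] is evaluated on all tangent vectors, not only on xi. It ignores the T-component of its
    first argument, so the coefficients of any v against a frame of xi are those of its horizontal
    part. *)
Lemma metric_reeb p v : metric p (T p) v = 0.
Proof. by rewrite !leviE dth_reeb mulr0. Qed.

Section OrthonormalBasis.
Variables (p : M) (E : 'I_(n + n) -> 'rV[R]_m).
Hypothesis oE : Defs.orthonormal ph p E.

(** Pairing with theta and with the metric recovers every coefficient of a combination of T and the
    [E a]. These 2n + 1 vectors are therefore independent and, by dimension, a basis. *)
Lemma orthonormal_expand v :
  v = ev (th p) v *: T p + \sum_a metric p v (E a) *: E a.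
Proof.
have [E0 E1] := oE.
pose F i := if unlift ord0 i is Some a then E a else T p.
pose B := \matrix_i F i.
have F0 : F ord0 = T p by rewrite /F unlift_none.
have FS a : F (lift ord0 a) = E a by rewrite /F liftK.
have rowsE (x : 'rV[R]_m) : x *m B =
    x 0 ord0 *: T p + \sum_a x 0 (lift ord0 a) *: E a.
  rewrite mulmx_sum_row big_ord_recl rowK F0; congr (_ + _).
  by apply: eq_bigr => a _; rewrite rowK FS.
have evB (x : 'rV[R]_m) : ev (th p) (x *m B) = x 0 ord0.
  rewrite rowsE ev_lin theta_reeb mulr1 ev_sum big1 ?addr0 // => a _.
  by rewrite E0 mulr0.
have meB (x : 'rV[R]_m) b : metric p (x *m B) (E b) = x 0 (lift ord0 b).
  rewrite rowsE metric_lin metric_reeb mulr0 add0r.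
  rewrite (lin_sum _ _ (fun a u v => metric_lin p a u v (E b))).
  rewrite (bigD1 b) //= E1 eqxx mulr1 big1 ?addr0 // => a ab.
  by rewrite E1 (negbTE ab) mulr0.
have uB : B \in unitmx.
  rewrite -row_free_unit -kermx_eq0; apply/rowV0P => x /sub_kermxP xB.
  apply/rowP => i; rewrite mxE; case: (unliftP ord0 i) => [a|] ->.
    by rewrite -meB xB (lin0 (fun c u v => metric_lin p c u v (E a))).
  by rewrite -evB xB (lin0 (fun a u v => ev_lin (th p) a u v)).
rewrite -[v](mulmxKV uB) evB {1}rowsE; congr (_ + _).
by apply: eq_bigr => a _; rewrite meB.
Qed.

Lemma frame_ext u v : ev (th p) u = ev (th p) v ->
  (forall a, metric p u (E a) = metric p v (E a)) -> u = v.
Proof.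
move=> e1 e2; rewrite (orthonormal_expand u) (orthonormal_expand v) e1.
by under [in LHS]eq_bigr => a _ do rewrite e2.
Qed.

End OrthonormalBasis.

Lemma smooth_metric U X Y : open U -> smooth_vf mfd U X -> smooth_vf mfd U Y ->
  (forall q, U q -> ev (th q) (Y q) = 0) ->
  smooth mfd U (fun q => metric q (X q) (Y q)).
Proof.
move=> oU sX sY Y0; have sJ := J_smooth oU sY Y0.
have sth : smooth_form mfd U th by exact: smooth_form_subset (theta_smooth ph).
exact: (smoothZ 2^-1 oU (smooth_dform oU sth sX sJ)).
Qed.

Section AdaptedBasis.
Variables (p : M) (E : 'I_(n + n) -> 'rV[R]_m).
Hypothesis aE : adapted ph p E.

Let oE : Defs.orthonormal ph p E. Proof. by case: aE. Qed.

Lemma dth_rshift u b : dth p u (E (rshift n b)) = 2 * metric p u (E (lshift n b)).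
Proof.
by have [_ ->] := aE; rewrite !leviE mulrA divff ?mul1r // pnatr_eq0.
Qed.

Lemma dth_lshift u b : dth p u (E (lshift n b)) = - 2 * metric p u (E (rshift n b)).
Proof.
have [[E0 _] EJ] := aE.
have -> : E (lshift n b) = (-1) *: (E (rshift n b) *m J ph p) + 0.
  by rewrite EJ J_sq // scaleN1r opprK addr0.
rewrite dth_linr (lin0 (fun a x y => dth_linr p a x y u)) addr0 !leviE.
by rewrite mulN1r mulNr mulrA divff ?mul1r // pnatr_eq0.
Qed.

(** The real form of dtheta = i sum_b theta^b /\ conj theta^b for theta^b = e^b + i e^{n+b}; the
    factor 2 undoes the 1/2 in the Levi metric. *)
Lemma dth_metric u v : dth p u v = 2 * \sum_b
  (metric p u (E (lshift n b)) * metric p v (E (rshift n b)) -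
   metric p u (E (rshift n b)) * metric p v (E (lshift n b))).
Proof.
rewrite {1}(orthonormal_expand oE v) dth_linr dformC dth_reeb oppr0 mulr0 add0r.
rewrite (lin_sum _ _ (fun a x y => dth_linr p a x y u)) big_split_ord /=.
rewrite -big_split mulr_sumr; apply: eq_bigr => b _ /=.
rewrite dth_rshift dth_lshift.
have aux (x y z w : R) : x * (- 2 * y) + z * (2 * w) = 2 * (w * z - y * x) by ring.
exact: aux.
Qed.

End AdaptedBasis.

(* theta^b, the coframe dual to Z_b *)
Definition thf (e : 'I_(n + n) -> M -> 'rV[R]_m) (b : 'I_n) (q : M) : 'cV[R[i]]_m :=
  \col_k Complex (metric q (delta_mx 0 k) (e (lshift n b) q))
                 (metric q (delta_mx 0 k) (e (rshift n b) q)).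

Lemma cev_thf e b q v : cev (thf e b q) v =
  Complex (metric q v (e (lshift n b) q)) (metric q v (e (rshift n b) q)).
Proof.
rewrite cevE; congr Complex; rewrite /ev mxE {2}[v]rV_sum_delta.
  rewrite (lin_sum _ _ (fun a x y => metric_lin q a x y _)).
  by apply: eq_bigr => k _; rewrite !mxE.
rewrite (lin_sum _ _ (fun a x y => metric_lin q a x y _)).
by apply: eq_bigr => k _; rewrite !mxE.
Qed.

(* theta^b (e_i) *)
Definition tcoef (b : 'I_n) (i : 'I_(n + n)) : R[i] :=
  Complex (i == lshift n b)%:R (i == rshift n b)%:R.

Lemma tcoef_lshift b a : tcoef b (lshift n a) = (a == b)%:R.
Proof.
by rewrite /tcoef eq_lshift eq_lrshift; case: (a == b); apply: complex_ext.
Qed.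

Lemma tcoef_rshift b a : tcoef b (rshift n a) = Complex 0 1 * (a == b)%:R.
Proof.
rewrite /tcoef eq_rshift eq_rlshift; case: (a == b).
  by rewrite mulr1.
by rewrite mulr0.
Qed.

Lemma thf_frame e b q i : Defs.orthonormal ph q (e ^~ q) ->
  cev (thf e b q) (e i q) = tcoef b i.
Proof. by move=> [_ e1]; rewrite cev_thf !e1. Qed.

Lemma cvec_mul (x y : 'rV[R]_m) (eta : 'cV[R[i]]_m) :
  (cvec x y *m eta) 0 0 = cev eta x + Complex 0 1 * cev eta y.
Proof. by rewrite /cvec mulmxDl -scalemxAl mxE [X in _ + X]mxE. Qed.

Lemma cvec_conj (x y : 'rV[R]_m) : map_mx conjc (cvec x y) = cvec x (- y).
Proof.
apply/matrixP => i j; rewrite !mxE; apply: complex_ext;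
  rewrite ?cReJ ?cImJ ?cReD ?cImD ?cReM ?cImM /=; ring.
Qed.

Lemma cev0 (eta : 'cV[R[i]]_m) : cev eta 0 = 0.
Proof. by rewrite /cev map_mx0 mul0mx mxE. Qed.

Lemma cevZ (eta : 'cV[R[i]]_m) (a : R) u : cev eta (a *: u) = a%:C%C * cev eta u.
Proof. by rewrite -[a *: u]addr0 cev_lin cev0 addr0. Qed.

Lemma cevD (eta : 'cV[R[i]]_m) u v : cev eta (u + v) = cev eta u + cev eta v.
Proof. by rewrite -[u]scale1r cev_lin mul1r scale1r. Qed.

Lemma cev_conj (eta : 'cV[R[i]]_m) u : cev (conj_form eta) u = conjc (cev eta u).
Proof.
rewrite /cev !mxE rmorph_sum; apply: eq_bigr => k _; rewrite !mxE.
by apply: complex_ext; rewrite ?cReJ ?cImJ ?cReM ?cImM ?cReJ ?cImJ /=; ring.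
Qed.

Lemma cev_lincomb k (c : 'I_k -> R[i]) (eta : 'I_k -> 'cV[R[i]]_m) u :
  cev (\sum_i c i *: eta i) u = \sum_i c i * cev (eta i) u.
Proof.
rewrite /cev mulmx_sumr summxE; apply: eq_bigr => i _.
by rewrite -scalemxAr mxE.
Qed.

Lemma cev_real (eta : 'cV[R]_m) u :
  cev (map_mx (real_complex R) eta) u = (ev eta u)%:C%C.
Proof.
rewrite cevE; apply: complex_ext => /=; rewrite /ev !mxE.
  by apply: eq_bigr => k _; rewrite !mxE.
by rewrite big1 // => k _; rewrite !mxE mulr0.
Qed.

Section LocalFrame.
Variables (U : set M) (e : 'I_(n + n) -> M -> 'rV[R]_m).
Hypotheses (oU : open U) (he : local_adapted_frame ph U e).

Let aE q : U q -> adapted ph q (e ^~ q). Proof. by case: he => _; apply. Qed.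
Let oE q : U q -> Defs.orthonormal ph q (e ^~ q). Proof. by move/aE => []. Qed.
Let sE i : smooth_vf mfd U (e i). Proof. by case: he. Qed.
Let E0 i q : U q -> ev (th q) (e i q) = 0. Proof. by move/oE => [+ _]; apply. Qed.

Lemma thf_smooth b : csmooth_form mfd U (thf e b).
Proof.
move=> V X oV VU sX.
have sV i : smooth mfd V (fun q => metric q (X q) (e i q)).
  apply: smooth_metric => //; first exact: smooth_vf_subset VU _.
  by move=> q /VU Uq; exact: E0.
split.
  by apply: smooth_eq (sV (lshift n b)) => // q _; rewrite cev_thf.
by apply: smooth_eq (sV (rshift n b)) => // q _; rewrite cev_thf.
Qed.

(** The connection and the scalar curvature are specified relative to unitary coframes, so one has
    to be exhibited over the given frame; the coframe read off from the metric serves. *)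
Lemma thf_unitary : unitary_coframe ph U e (thf e).
Proof.
split; first exact: thf_smooth.
move=> p Up; split.
- by move=> b; rewrite cev_thf !metric_reeb.
- move=> a b; rewrite cvec_mul !cevZ !(thf_frame _ _ (oE Up)).
  rewrite tcoef_lshift tcoef_rshift; case: (a == b);
   by apply: complex_ext; rewrite ?cReD ?cImD ?cReM ?cImM /=; field.
- move=> a b; rewrite cvec_conj cvec_mul -scaleNr opprK !cevZ.
  rewrite !(thf_frame _ _ (oE Up)).
  rewrite tcoef_lshift tcoef_rshift; case: (a == b);
   by apply: complex_ext; rewrite ?cReD ?cImD ?cReM ?cImM /=; field.
- move=> u v; rewrite (dth_metric (aE Up)).
  rewrite /wedge (eq_bigr (fun b => - (2 * Complex 0 1) *
    ((metric p u (e (lshift n b) p) * metric p v (e (rshift n b) p) -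
   metric p u (e (rshift n b) p) * metric p v (e (lshift n b) p))%:C%C))).
    rewrite -mulr_sumr -rmorph_sum; set s := \sum_(_ < _) _; move: s => s.
    by apply: complex_ext; rewrite ?cReM ?cImM ?cReN ?cImN ?cReM ?cImM /=; ring.
  move=> b _; rewrite !cev_conj !cev_thf /=.
  set x := metric _ _ _; set y := metric _ _ _.
  set z := metric _ _ _; set w := metric _ _ _.
  move: x y z w => x y z w.
  by apply: complex_ext; rewrite ?cReD ?cImD ?cReN ?cImN ?cReM ?cImM /=; ring.
Qed.

Lemma thf_ext q u v : U q -> ev (th q) u = ev (th q) v ->
  (forall b, cev (thf e b q) u = cev (thf e b q) v) -> u = v.
Proof.
move=> Uq e1 e2; apply: (frame_ext (oE Uq) e1) => i.
rewrite -(splitK i); case: (fintype.split i) => b /=.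
  by have := f_equal (@complex.Re R) (e2 b); rewrite 2!cev_thf.
by have := f_equal (@complex.Im R) (e2 b); rewrite 2!cev_thf.
Qed.

End LocalFrame.

End Frame.

(** The linear algebra behind [bianchi], over atoms: p stands for products of connection
    coefficients, e for their derivatives, n for connection forms on brackets, f for torsion terms,
    b for double brackets, with the frame indices as subscripts. The first three hypotheses are the
    structure equation on ([e_i, e_j], e_k) and its cyclic permutations, the last one is the Jacobi
    identity. *)
Lemma bianchi_linear (K : comRingType) (pijk pjik pjki pkji pkij pikj eijk ejik
    ejki ekji ekij eikj nk ni nj f1 f2 f3 b1 b2 b3 : K) :
  pjik - pijk - nk - f1 = - (ejki - eikj) - b1 ->
  pkji - pjki - ni - f2 = - (ekij - ejik) - b2 ->
  pikj - pkij - nj - f3 = - (eijk - ekji) - b3 -> b1 + b2 + b3 = 0 ->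
  ekij - ekji - nk - (pkij - pkji) + (eijk - eikj - ni - (pijk - pikj)) +
  (ejki - ejik - nj - (pjki - pjik)) = f1 + f2 + f3.
Proof.
have E (x y z : K) : x - y = z -> y = x - z by move=> <-; ring.
move=> /E -> /E -> /E -> /(canRL (addKr _)) ->; ring.
Qed.

(** * Bianchi identity, torsion and connection in an adapted frame *)

Section Structure.
Context {R : realType} {n : nat} {M : topologicalType}.
Local Notation m := (n + n).+1.
Variables (mfd : manifold R m M) (ph : pseudohermitian mfd).
Variables (U : set M) (e : 'I_(n + n) -> M -> 'rV[R]_m).
Variables (om : 'I_n -> 'I_n -> M -> 'cV[R[i]]_m) (A : 'I_n -> 'I_n -> M -> R[i]).
Hypotheses (oU : open U) (he : local_adapted_frame ph U e).
Hypothesis hS : structure_equations ph U (thf ph e) om A.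

Local Notation th := (theta ph).
Local Notation dth := (dform mfd (theta ph)).
Local Notation metric := (levi mfd (theta ph) (J ph)).
Local Notation T := (reeb ph).
Local Notation t := (@tcoef R n).
Local Notation br i j := (bracket mfd (e i) (e j)).

#[local] Opaque levi dform der cder cdform bracket.

Lemma adapted_frame q : U q -> adapted ph q (e ^~ q).
Proof. by case: he => _; apply. Qed.
Lemma orthonormal_frame q : U q -> Defs.orthonormal ph q (e ^~ q).
Proof. by move/adapted_frame => []. Qed.
Lemma smooth_frame_vf i : smooth_vf mfd U (e i). Proof. by case: he. Qed.
Lemma theta_frame i q : U q -> ev (th q) (e i q) = 0.
Proof. by move/orthonormal_frame => [+ _]; apply. Qed.

Local Notation sE := smooth_frame_vf.

Definition ofr a b i q := cev (om a b q) (e i q).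
Definition taufr b i q := \sum_g A b g q * conjc (t g i).
Definition Omfr a b i j q := curvature_form mfd om a b q (e i q) (e j q).
Definition dthfr i j q : R := dth q (e i q) (e j q).

Lemma om_smooth a b : csmooth_form mfd U (om a b). Proof. by have [+ _ _] := hS. Qed.

Lemma ofr_smooth a b i : csmooth mfd U (ofr a b i).
Proof. by apply: (om_smooth a b) => //; exact: sE. Qed.

(** As theta(e_i) vanishes on U, only the bracket survives in Cartan's formula. That brackets of
    horizontal fields have a T-component is the origin of the nabla_T term. *)
Lemma theta_bracket i j q : U q -> ev (th q) (br i j q) = - dthfr i j q.
Proof.
move=> Uq.
have sth : smooth_form mfd U th by exact: smooth_form_subset (theta_smooth ph).
have H := dformE oU Uq sth (sE i) (sE j).
have z k v : der mfd v (fun r => ev (th r) (e k r)) q = 0.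
  rewrite -(der_cst mfd v 0 q); apply: (der_eq _ _ oU Uq) => r /[1!inE] Ur.
  exact: theta_frame.
by rewrite /dthfr H z z subr0 sub0r opprK.
Qed.

Lemma taufrE b i q : U q ->
  cev (\sum_g A b g q *: conj_form (thf ph e g q)) (e i q) = taufr b i q.
Proof.
move=> Uq; rewrite cev_lincomb; apply: eq_bigr => g _.
by rewrite cev_conj (thf_frame _ _ (orthonormal_frame Uq)).
Qed.

Lemma cdform_thf b u v q : U q -> cdform mfd (thf ph e b) q u v =
  \sum_a (cev (thf ph e a q) u * cev (om a b q) v -
          cev (thf ph e a q) v * cev (om a b q) u) +
  ((ev (th q) u)%:C%C * cev (\sum_g A b g q *: conj_form (thf ph e g q)) v -
   (ev (th q) v)%:C%C * cev (\sum_g A b g q *: conj_form (thf ph e g q)) u).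
Proof.
by move=> Uq; have [_ _ /(_ q Uq) [-> _ _]] := hS; rewrite /wedge !cev_real.
Qed.

(** The functions theta^b(e_i) are constant, so Cartan's formula leaves only the bracket; on
    horizontal arguments the torsion term theta /\ tau^b of the structure equation vanishes. *)
Lemma thf_bracket b i j q : U q -> cev (thf ph e b q) (br i j q) =
  \sum_a (t a j * ofr a b i q - t a i * ofr a b j q).
Proof.
move=> Uq; have H := cdformE oU Uq (thf_smooth he b) (sE i) (sE j).
have z k v : cder mfd v (fun r => cev (thf ph e b r) (e k r)) q = 0.
  rewrite -(cder_cst mfd v (t b k) q); apply: (cder_eq _ _ oU Uq) => r /[1!inE] Ur.
  exact: (thf_frame _ _ (orthonormal_frame Ur)).
move: H; rewrite z z subr0 sub0r cdform_thf // !theta_frame // !mul0r subr0 addr0.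
move=> H; rewrite -[LHS]opprK -H.
rewrite -sumrN; apply: eq_bigr => a _; rewrite opprB.
by rewrite !(thf_frame _ _ (orthonormal_frame Uq)).
Qed.

Lemma cderZ V q v (c : R[i]) f : open V -> V q -> csmooth mfd V f ->
  cder mfd v (fun r => c * f r) q = c * cder mfd v f q.
Proof.
move=> oV Vq sf; rewrite (cderM oV Vq) //; last exact: csmooth_cst.
by rewrite cder_cst mul0r add0r.
Qed.

Lemma csmoothZ V (c : R[i]) f : open V -> csmooth mfd V f ->
  csmooth mfd V (fun r => c * f r).
Proof. by move=> oV; apply: csmoothM => //; exact: csmooth_cst. Qed.

Lemma curvature_frame a b i j q : U q -> Omfr a b i j q =
  cder mfd (e i q) (ofr a b j) q - cder mfd (e j q) (ofr a b i) q -
  cev (om a b q) (br i j q) -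
  \sum_g (ofr a g i q * ofr g b j q - ofr a g j q * ofr g b i q).
Proof.
move=> Uq; have H := cdformE oU Uq (om_smooth a b) (sE i) (sE j).
by rewrite /Omfr /curvature_form H.
Qed.

Lemma curvatureC a b i j q : Omfr a b i j q = - Omfr a b j i q.
Proof.
rewrite /Omfr /curvature_form [cdform _ _ _ (e i q) _]cdformC -opprD; congr (- _).
rewrite -[RHS]/(_ + _) -sumrN; congr (_ + _); apply: eq_bigr => g _.
exact: esym (opprB _ _).
Qed.

Lemma cder_thf_bracket b i j k q : U q ->
  cder mfd (e k q) (fun r => cev (thf ph e b r) (br i j r)) q =
  \sum_a (t a j * cder mfd (e k q) (ofr a b i) q -
          t a i * cder mfd (e k q) (ofr a b j) q).
Proof.
move=> Uq.
have sZ c a l := csmoothZ c oU (ofr_smooth a b l).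
have E1 : cder mfd (e k q) (fun r => cev (thf ph e b r) (br i j r)) q =
  cder mfd (e k q) (fun r => \sum_a (t a j * ofr a b i r + - t a i * ofr a b j r)) q.
  apply: (cder_eq _ _ oU Uq) => r /[1!inE] Ur; rewrite thf_bracket //.
  by apply: eq_bigr => a _; rewrite mulNr.
apply: (etrans E1).
apply: (etrans (cder_sum oU Uq (e k q) _ (fun a => csmoothD oU (sZ _ a i) (sZ _ a j)))).
apply: eq_bigr => a _.
apply: (etrans (cderD oU Uq (e k q) (sZ _ a i) (sZ _ a j))).
rewrite -mulNr.
exact: (f_equal2 +%R (cderZ _ _ oU Uq (ofr_smooth a b i)) (cderZ _ _ oU Uq (ofr_smooth a b j))).
Qed.

(* First Bianchi identity: the Jacobi identity for the frame, evaluated by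
   the structure equations. *)
Lemma bianchi b i j k q : U q ->
  \sum_a (t a k * Omfr a b i j q + t a i * Omfr a b j k q + t a j * Omfr a b k i q) =
  (dthfr i j q)%:C%C * taufr b k q + (dthfr j k q)%:C%C * taufr b i q +
  (dthfr k i q)%:C%C * taufr b j q.
Proof.
move=> Uq.
pose P x y z := \sum_g t g x * \sum_a ofr g a y q * ofr a b z q.
pose E x y z := \sum_a t a x * cder mfd (e y q) (ofr a b z) q.
pose N z x y := \sum_a t a z * cev (om a b q) (br x y q).
pose B x y z := cev (thf ph e b q) (bracket mfd (br x y) (e z) q).
have cur x y z : \sum_a t a z * Omfr a b x y q =
    E z x y - E z y x - N z x y - (P z x y - P z y x).
  rewrite /E /N /P -!sumrB; apply: eq_bigr => a _.
  rewrite curvature_frame // sumrB.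
  have aux (t0 x0 y0 z0 u0 v0 : R[i]) : t0 * (x0 - y0 - z0 - (u0 - v0)) =
    t0 * x0 - t0 * y0 - t0 * z0 - (t0 * u0 - t0 * v0) by ring.
  exact: aux.
(* The structure equation on the pair ([e_x, e_y], e_z). Its first argument is not horizontal, so
   here the torsion contributes, with the factor theta [e_x, e_y] = - dtheta(e_x, e_y). *)
have str x y z : P y x z - P x y z - N z x y - (dthfr x y q)%:C%C * taufr b z q =
    - (E y z x - E x z y) - B x y z.
  have sbr := bracket_smooth oU (sE x) (sE y).
  have H := cdformE oU Uq (thf_smooth he b) sbr (sE z).
  have z0 : cder mfd (br x y q) (fun r => cev (thf ph e b r) (e z r)) q = 0.
    rewrite -(cder_cst mfd (br x y q) (t b z) q).
    apply: (cder_eq _ _ oU Uq) => r /[1!inE] Ur.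
    exact: (thf_frame _ _ (orthonormal_frame Ur)).
  move: H; rewrite z0 sub0r cder_thf_bracket // cdform_thf // theta_bracket //.
  rewrite theta_frame // mul0r subr0 taufrE // sumrB => H.
  rewrite sumrB in H.
  have HN : \sum_a cev (thf ph e a q) (e z q) * cev (om a b q) (br x y q) = N z x y.
    apply: eq_bigr => a _.
    by rewrite (thf_frame _ _ (orthonormal_frame Uq)).
  rewrite HN in H.
  rewrite /B -[RHS]H rmorphN mulNr; congr (_ - _ - _).
  rewrite (eq_bigr (fun a => \sum_g (t g y * (ofr g a x q * ofr a b z q) -
                                     t g x * (ofr g a y q * ofr a b z q)))).
    rewrite exchange_big /= /P -sumrB; apply: eq_bigr => g _.
    by rewrite sumrB -!mulr_sumr.
  move=> a _; rewrite thf_bracket // mulr_suml; apply: eq_bigr => g _.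
  by rewrite mulrBl !mulrA.
have jac : B i j k + B j k i + B k i j = 0.
  by rewrite /B -!cevD (jacobi oU Uq (sE i) (sE j) (sE k)) cev0.
have E0 := etrans (big_split _ _ _ _ _) (f_equal2 +%R
  (etrans (big_split _ _ _ _ _) (f_equal2 +%R (cur i j k) (cur j k i))) (cur k i j)).
apply: (etrans E0).
exact: (bianchi_linear (str i j k) (str j k i) (str k i j) jac).
Qed.

Lemma om_skew a b q v : U q -> conjc (cev (om a b q) v) = - cev (om b a q) v.
Proof.
move=> Uq; have [_ _ /(_ q Uq) [_ sk _]] := hS.
have := f_equal (fun f => cev f v) (sk b a).
rewrite /= {1}/cev mulmxDr mxE -/(cev _ _) -/(cev _ _) cev_conj.
by rewrite {3}/cev mulmx0 mxE => /eqP; rewrite addrC addr_eq0 => /eqP.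
Qed.

(** Inherited from the skew-Hermitian connection forms: in the quadratic term conjugation produces
    two signs that cancel and reverses the order of the wedge product, which gives the one sign
    needed. *)
Lemma curvature_skew a b i j q : U q -> conjc (Omfr a b i j q) = - Omfr b a i j q.
Proof.
move=> Uq.
have cD k l c d : conjc (cder mfd (e k q) (ofr c d l) q) =
    - cder mfd (e k q) (ofr d c l) q.
  rewrite -(cder_conj oU Uq (e k q) (ofr_smooth c d l)).
  rewrite -mulN1r -(cderZ _ _ oU Uq (ofr_smooth d c l)).
  by apply: (cder_eq _ _ oU Uq) => r /[1!inE] Ur; rewrite om_skew // mulN1r.
rewrite (curvature_frame a b) // (curvature_frame b a) //.
have aux (d1 d2 o s d1' d2' o' s' : R[i]) : conjc d1 = - d1' -> conjc d2 = - d2' ->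
    conjc o = - o' -> conjc s = - s' ->
    conjc (d1 - d2 - o - s) = - (d1' - d2' - o' - s').
  by move=> h1 h2 h3 h4; rewrite !rmorphB /= h1 h2 h3 h4; ring.
apply: (aux _ _ _ _ _ _ _ _ (cD _ _ _ _) (cD _ _ _ _) (om_skew _ _ _ Uq)).
rewrite rmorph_sum -sumrN; apply: eq_bigr => g _.
rewrite rmorphB !rmorphM /= !om_skew // !mulrNN opprB.
have aux2 (x y z w : R[i]) : x * y - z * w = y * x - w * z by ring.
exact: aux2.
Qed.

Lemma taufr_lshift b a q : taufr b (lshift n a) q = A b a q.
Proof.
rewrite /taufr (eq_bigr (fun g => A b g q * (a == g)%:R)); last first.
  move=> g _; rewrite tcoef_lshift; congr (_ * _).
  by case: (a == g); apply: complex_ext => /=; rewrite ?oppr0.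
rewrite (bigD1 a) //= eqxx mulr1 big1 ?addr0 // => g /negbTE ga.
by rewrite eq_sym ga mulr0.
Qed.

(** The last structure equation is evaluated on two vectors of the first half of the frame, where
    theta^c takes only the values 0 and 1; what remains is the difference of the conjugates of
    [A a b] and [A b a]. *)
Lemma torsion_sym a b q : U q -> A a b q = A b a q.
Proof.
move=> Uq; have [_ _ /(_ q Uq) [_ _ /(_ (e (lshift n b) q) (e (lshift n a) q))]] := hS.
rewrite (eq_bigr (fun c => conjc (A c b q) * (a == c)%:R -
                           conjc (A c a q) * (b == c)%:R)).
  rewrite sumrB (bigD1 a) //= eqxx mulr1 big1 ?addr0; last first.
    by move=> c /negbTE ca; rewrite eq_sym ca mulr0.
  rewrite (bigD1 b) //= eqxx mulr1 big1 ?addr0; last first.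
    by move=> c /negbTE cb; rewrite eq_sym cb mulr0.
  by move=> /eqP; rewrite subr_eq0 => /eqP /(can_inj (@conjcK R)).
move=> c _; rewrite /wedge !cev_conj !taufrE // !taufr_lshift.
by rewrite !(thf_frame _ _ (orthonormal_frame Uq)) !tcoef_lshift.
Qed.

Lemma dthfr_tcoef i j q : U q -> (dthfr i j q)%:C%C =
  Complex 0 1 * \sum_a (t a i * conjc (t a j) - t a j * conjc (t a i)).
Proof.
move=> Uq; have [_ /(_ q Uq) [_ _ _ ->]] := thf_unitary he.
congr (_ * _); apply: eq_bigr => a _; rewrite /wedge !cev_conj.
by rewrite !(thf_frame _ _ (orthonormal_frame Uq)).
Qed.

Lemma curvature_linl a b q (c : R) u v w : U q ->
  curvature_form mfd om a b q (c *: u + v) w =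
  c%:C%C * curvature_form mfd om a b q u w + curvature_form mfd om a b q v w.
Proof.
move=> Uq; rewrite /curvature_form.
rewrite (cdform_linl _ _ _ _ oU Uq (om_smooth a b)).
have -> : \sum_g wedge (om a g q) (om g b q) (c *: u + v) w =
    c%:C%C * \sum_g wedge (om a g q) (om g b q) u w +
    \sum_g wedge (om a g q) (om g b q) v w.
  rewrite mulr_sumr -big_split; apply: eq_bigr => g _ /=.
  rewrite /wedge !cev_lin.
  have aux (x y z w' c' s t' : R[i]) : (c' * x + y) * z - w' * (c' * s + t') =
    c' * (x * z - w' * s) + (y * z - w' * t') by ring.
  exact: aux.
have aux (x y z w' c' : R[i]) : c' * x + y - (c' * z + w') =
  c' * (x - z) + (y - w') by ring.
exact: aux.
Qed.

Lemma curvature_form0 a b q w : U q -> curvature_form mfd om a b q 0 w = 0.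
Proof.
move=> Uq; have := curvature_linl a b (-1) 0 0 w Uq.
by rewrite scaler0 addr0 rmorphN rmorph1 mulN1r addNr.
Qed.

Lemma curvature_scale a b q (c : R) u w : U q ->
  curvature_form mfd om a b q (c *: u) w = c%:C%C * curvature_form mfd om a b q u w.
Proof.
by move=> Uq; rewrite -[c *: u]addr0 curvature_linl // curvature_form0 // addr0.
Qed.

Lemma curvature_formC a b q u w :
  curvature_form mfd om a b q u w = - curvature_form mfd om a b q w u.
Proof.
rewrite /curvature_form [cdform _ _ _ u w]cdformC -opprD; congr (- _).
rewrite -[RHS]/(_ + _) -sumrN; congr (_ + _); apply: eq_bigr => g _.
exact: esym (opprB _ _).
Qed.

Lemma curvature_scale2 a b q (c d : R) u w : U q ->
  curvature_form mfd om a b q (c *: u) (d *: w) =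
  (c * d)%:C%C * curvature_form mfd om a b q u w.
Proof.
move=> Uq; have h1 := curvature_scale a b c u (d *: w) Uq.
have h2 := curvature_scale a b d w u Uq.
have h3 := curvature_formC a b q u (d *: w).
have aux (x y y' z z' : R[i]) : x = c%:C%C * y -> y = - y' -> y' = d%:C%C * z' ->
    z = - z' -> x = (c * d)%:C%C * z.
  by move=> -> -> -> ->; rewrite rmorphM !mulrN mulrA.
exact: aux h1 h3 h2 (curvature_formC a b q u w).
Qed.

(** Z_r and conj Z_s carry a factor 1/2 each, hence the [4^-1]. *)
Lemma webster_frame a b r s q : U q -> webster_curvature mfd e om a b r s q =
  4^-1 * (Omfr a b (lshift n r) (lshift n s) q + Omfr a b (rshift n r) (rshift n s) q +
   Complex 0 1 * (Omfr a b (lshift n r) (rshift n s) q -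
                  Omfr a b (rshift n r) (lshift n s) q)).
Proof.
move=> Uq; rewrite /webster_curvature /cbil /zre /zim !scaleNr opprK -!scaleNr.
rewrite !curvature_scale2 // -/(Omfr _ _ _ _ _) -/(Omfr _ _ _ _ _).
rewrite -/(Omfr _ _ _ _ _) -/(Omfr _ _ _ _ _).
have -> : (4^-1 : R[i]) = (2^-1 * 2^-1 : R)%:C%C.
  have -> : (2^-1 * 2^-1 : R) = 4^-1 by field.
  by rewrite fmorphV rmorph_nat.
rewrite mulNr rmorphN.
have aux (h x y z w i : R[i]) : h * x - - h * y + i * (h * z + - h * w) =
  h * (x + y + i * (z - w)) by ring.
exact: aux.
Qed.

Section Connection.
Variable nab : M -> 'rV[R]_m -> (M -> 'rV[R]_m) -> 'rV[R]_m.
Hypothesis nabZ : forall p, U p -> forall v a,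
  Zvec (fun b => nab p v (e b)) a = \sum_b cev (om a b p) v *: Zvec (e ^~ p) b.

Definition wfr p v i j := metric p (nab p v (e i)) (e j p).

Lemma Zvec_mul (E : 'I_(n + n) -> 'rV[R]_m) a (eta : 'cV[R[i]]_m) :
  (Zvec E a *m eta) 0 0 =
  2^-1 * (cev eta (E (lshift n a)) - Complex 0 1 * cev eta (E (rshift n a))).
Proof.
have h2 : (2^-1 : R)%:C%C = 2^-1 :> R[i] by rewrite fmorphV rmorph_nat.
have hN : (- 2^-1 : R)%:C%C = - 2^-1 :> R[i] by rewrite -h2; apply: complex_ext; rewrite /= ?oppr0.
rewrite cvec_mul !cevZ h2 hN.
have aux (h x y i : R[i]) : h * x + i * (- h * y) = h * (x - i * y) by ring.
exact: aux.
Qed.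

Lemma nab_mul p v a (eta : 'cV[R[i]]_m) : U p ->
  cev eta (nab p v (e (lshift n a))) - Complex 0 1 * cev eta (nab p v (e (rshift n a)))
  = \sum_b cev (om a b p) v *
    (cev eta (e (lshift n b) p) - Complex 0 1 * cev eta (e (rshift n b) p)).
Proof.
move=> Up; have := f_equal (fun z => (z *m eta) 0 0) (nabZ Up v a).
rewrite /= Zvec_mul mulmx_suml summxE => H.
have i2 : (2^-1 : R[i]) != 0 by rewrite invr_eq0 pnatr_eq0.
apply: (mulfI i2); rewrite H mulr_sumr; apply: eq_bigr => b _.
by rewrite -scalemxAl mxE Zvec_mul mulrCA.
Qed.

Lemma theta_nab p v i : U p -> ev (th p) (nab p v (e i)) = 0.
Proof.
move=> Up; rewrite -(splitK i).
have H a : ev (th p) (nab p v (e (lshift n a))) = 0 /\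
           ev (th p) (nab p v (e (rshift n a))) = 0.
  have := nab_mul v a (map_mx (real_complex R) (th p)) Up.
  rewrite big1; last by move=> b _; rewrite !cev_real !theta_frame // mulr0 subr0 mulr0.
  rewrite !cev_real; set x := ev _ _; set y := ev _ _; move: x y => x y.
  move=> /eqP; rewrite eq_complex /= => /andP[/eqP h1 /eqP h2].
  split; first by rewrite -h1; ring.
  by apply/eqP; rewrite -oppr_eq0 -h2; apply/eqP; ring.
by case: (fintype.split i) => a /=; have [] := H a.
Qed.

(** Pairing nabla Z_a with theta^b gives theta^b(nabla e_a) - i theta^b(nabla e_{n+a}) = 2
    theta_a^b. Since nabla Z_a is again of type (1,0), pairing with conj theta^b and conjugating
    gives theta^b(nabla e_a) + i theta^b(nabla e_{n+a}) = 0. The two equations determine both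
    values. *)
Lemma thf_nab p v i b : U p ->
  cev (thf ph e b p) (nab p v (e i)) = \sum_a t a i * cev (om a b p) v.
Proof.
move=> Up; rewrite -(splitK i).
have ii : Complex 0 1 * Complex 0 1 = -1 :> R[i] by apply: complex_ext => /=; ring.
have H a : cev (thf ph e b p) (nab p v (e (lshift n a))) = cev (om a b p) v /\
    cev (thf ph e b p) (nab p v (e (rshift n a))) = Complex 0 1 * cev (om a b p) v.
  have := nab_mul v a (thf ph e b p) Up.
  rewrite (bigD1 b) //= !(thf_frame _ _ (orthonormal_frame Up)).
  rewrite tcoef_lshift tcoef_rshift eqxx mulr1 ii opprK big1 ?addr0; last first.
    move=> c /negbTE cb; rewrite !(thf_frame _ _ (orthonormal_frame Up)).
    by rewrite tcoef_lshift tcoef_rshift cb !mulr0 subr0 mulr0.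
  have := nab_mul v a (conj_form (thf ph e b p)) Up.
  rewrite big1; last first.
    move=> c _; rewrite !cev_conj !(thf_frame _ _ (orthonormal_frame Up)).
    rewrite tcoef_lshift tcoef_rshift rmorphM /=.
    case: (c == b); apply: complex_ext => /=; rewrite ?cReM ?cImM /=; ring.
  rewrite !cev_conj => /(f_equal (@conjc R)).
  rewrite rmorph0 rmorphB rmorphM /= !conjcK.
  set x := cev (thf ph e b p) _; set y := cev (thf ph e b p) _; set w := cev _ _.
  move: x y w => x y w h1 h2.
  have h1' : x = - Complex 0 1 * y.
    apply/eqP; rewrite -subr_eq0 -h1; apply/eqP.
    by apply: complex_ext; rewrite ?cReD ?cImD ?cReN ?cImN ?cReM ?cImM /=; ring.
  have h2' : - Complex 0 1 * y = w.
    have i2 : (2 : R[i]) != 0 by rewrite pnatr_eq0.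
    by apply: (mulIf i2); rewrite -[RHS]h2 h1'; ring.
  split; first by rewrite h1'.
  by rewrite -h2' mulrA mulrN ii opprK mul1r.
case: (fintype.split i) => a /=; have [Hl Hr] := H a.
  rewrite Hl (bigD1 a) //= tcoef_lshift eqxx mul1r big1 ?addr0 // => c /negbTE ca.
  by rewrite tcoef_lshift eq_sym ca mul0r.
rewrite Hr (bigD1 a) //= tcoef_rshift eqxx mulr1 big1 ?addr0 // => c /negbTE ca.
by rewrite tcoef_rshift eq_sym ca mulr0 mul0r.
Qed.

Lemma nab_expand p v i : U p -> nab p v (e i) = \sum_j wfr p v i j *: e j p.
Proof.
move=> Up; rewrite {1}(orthonormal_expand (orthonormal_frame Up) (nab p v (e i))).
by rewrite theta_nab // scale0r add0r.
Qed.

Lemma wfr_om p v i b : U p ->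
  Complex (wfr p v i (lshift n b)) (wfr p v i (rshift n b)) =
  \sum_a t a i * cev (om a b p) v.
Proof. by move=> Up; rewrite -thf_nab // cev_thf. Qed.

Lemma wfr_lshift p v a b : U p ->
  Complex (wfr p v (lshift n a) (lshift n b)) (wfr p v (lshift n a) (rshift n b)) =
  cev (om a b p) v.
Proof.
move=> Up; rewrite wfr_om // (bigD1 a) //= tcoef_lshift eqxx mul1r big1 ?addr0 //.
by move=> c /negbTE ca; rewrite tcoef_lshift eq_sym ca mul0r.
Qed.

Lemma wfr_rshift p v a b : U p ->
  Complex (wfr p v (rshift n a) (lshift n b)) (wfr p v (rshift n a) (rshift n b)) =
  Complex 0 1 * cev (om a b p) v.
Proof.
move=> Up; rewrite wfr_om // (bigD1 a) //= tcoef_rshift eqxx mulr1 big1 ?addr0 //.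
by move=> c /negbTE ca; rewrite tcoef_rshift eq_sym ca mulr0 mul0r.
Qed.

(** Real and imaginary parts of a skew-Hermitian matrix assemble to a skew-symmetric real one; in
    other words, the connection is metric on xi. *)
Lemma wfr_skew p v i j : U p -> wfr p v i j = - wfr p v j i.
Proof.
move=> Up.
have sk a b := om_skew a b v Up.
have ll a b := f_equal (@complex.Re R) (wfr_lshift v a b Up).
have lr a b := f_equal (@complex.Im R) (wfr_lshift v a b Up).
have rl a b := f_equal (@complex.Re R) (wfr_rshift v a b Up).
have rr a b := f_equal (@complex.Im R) (wfr_rshift v a b Up).
have s1 a b := f_equal (@complex.Re R) (sk a b).
have s2 a b := f_equal (@complex.Im R) (sk a b).
rewrite -(splitK i) -(splitK j).
case: (fintype.split i) (fintype.split j) => [a|a] [b|b] /=.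
- move: (ll a b) (ll b a) (s1 a b); rewrite cReJ cReN /= => -> -> ->.
  by [].
- move: (lr a b) (rl b a) (s2 a b); rewrite cImJ cReM cImN /= => -> ->.
  by move=> h; rewrite mul0r mul1r sub0r -h opprK.
- move: (rl a b) (lr b a) (s2 a b); rewrite cImJ cReM cImN /= => -> ->.
  by rewrite mul0r mul1r sub0r.
- move: (rr a b) (rr b a) (s1 a b); rewrite cReJ cReN !cImM /= => -> ->.
  by rewrite !mul0r !mul1r !add0r.
Qed.

(** The torsion of nabla on two horizontal frame fields is purely vertical: both sides have the same
    theta^b by [thf_bracket] and [thf_nab], and the T-component comes from [theta_bracket]. *)
Lemma bracket_nab p i j : U p -> br i j p =
  nab p (e i p) (e j) - nab p (e j p) (e i) - dthfr i j p *: T p.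
Proof.
move=> Up; rewrite -scaleNr.
apply: (thf_ext he Up) => [|b].
  rewrite theta_bracket // addrC ev_lin theta_reeb mulr1.
  rewrite -[- nab _ _ _]scaleN1r [nab _ _ _ + _]addrC ev_lin !theta_nab //.
  by rewrite mulr0 !addr0.
rewrite thf_bracket // !cevD -[- nab _ _ _]scaleN1r !cevZ !thf_nab // cev_thf !metric_reeb.
rewrite mulr0 addr0 rmorphN rmorph1 mulN1r -sumrB.
by apply: eq_bigr => a _; rewrite /ofr.
Qed.

End Connection.

End Structure.

(** * Clifford algebra *)

Section CliffordAlgebra.
Context {R : realType} {n N : nat}.
Local Notation K := R[i].
Local Notation I := ('I_(n + n)).
Local Notation ii := (Complex 0 1 : K).
Variable C : I -> 'M[K]_N.
Hypothesis CR : clifford_relations C.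

Lemma iiM : ii * ii = -1.
Proof. by apply: complex_ext => /=; ring. Qed.

(* Clifford multiplication by Z_a and by its conjugate; cG a b represents the
   elementary matrix E_ba of gl(n) on spinors. *)
Definition cz a : 'M[K]_N := 2^-1 *: (C (lshift n a) - ii *: C (rshift n a)).
Definition czb a : 'M[K]_N := 2^-1 *: (C (lshift n a) + ii *: C (rshift n a)).
Definition cG a b : 'M[K]_N := 2^-1 *: (czb a *m cz b - cz b *m czb a).

Lemma half_half (V : lmodType K) (x : V) : 2^-1 *: (x + x) = x.
Proof.
rewrite scalerDr -scalerDl (_ : 2^-1 + 2^-1 = 1) ?scale1r //.
by field.
Qed.

Lemma lshift_cz a : C (lshift n a) = cz a + czb a.
Proof. by rewrite /cz /czb -scalerDr addrACA addNr addr0 half_half. Qed.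

Lemma rshift_cz a : C (rshift n a) = ii *: (cz a - czb a).
Proof.
have -> : cz a - czb a = - ii *: C (rshift n a).
  rewrite /cz /czb -scalerBr opprD addrACA subrr add0r.
  by rewrite -!scaleNr half_half.
by rewrite scalerA mulrN iiM opprK scale1r.
Qed.

Definition ac (x y : 'M[K]_N) := x *m y + y *m x.

Lemma acC x y : ac x y = ac y x. Proof. by rewrite /ac addrC. Qed.

Lemma ac_lin k x y z : ac (k *: x + y) z = k *: ac x z + ac y z.
Proof.
rewrite /ac mulmxDl mulmxDr -scalemxAl -scalemxAr scalerDr.
by rewrite !addrA; congr (_ + _); rewrite addrAC.
Qed.

Lemma acZ k x z : ac (k *: x) z = k *: ac x z.
Proof. by rewrite /ac -scalemxAl -scalemxAr scalerDr. Qed.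

Lemma ac_C i j : ac (C i) (C j) = (- 2 * (i == j)%:R)%:M.
Proof. exact: CR. Qed.

(* k = 0: z_a, k = 1: bar z_a *)
Lemma ac_half (k l : K) a b :
  ac (2^-1 *: (C (lshift n a) + k *: C (rshift n a)))
     (2^-1 *: (C (lshift n b) + l *: C (rshift n b))) =
  (- 2^-1 * (1 + k * l) * (a == b)%:R)%:M.
Proof.
rewrite acZ acC acZ [C (lshift n b) + _]addrC ac_lin.
rewrite ![ac _ (C (lshift n a) + _)]acC [C (lshift n a) + _]addrC !ac_lin !ac_C.
rewrite !eq_lshift !eq_rshift !eq_lrshift !eq_rlshift mulr0 (raddf0 (@scalar_mx K N)).
rewrite !scaler0 !add0r !addr0 -!scale_scalar_mx !scalerA -!scalerDl -scalerA.
by rewrite !scalerA; congr (_ *: _); field.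
Qed.

Lemma cz_half a : cz a = 2^-1 *: (C (lshift n a) + (- ii) *: C (rshift n a)).
Proof. by rewrite /cz scaleNr. Qed.

Lemma ac_zz a b : ac (cz a) (cz b) = 0.
Proof.
rewrite !cz_half ac_half mulrNN iiM addrN mulr0 mul0r.
exact: (raddf0 (@scalar_mx K N)).
Qed.

Lemma ac_zbzb a b : ac (czb a) (czb b) = 0.
Proof. rewrite ac_half iiM addrN mulr0 mul0r; exact: (raddf0 (@scalar_mx K N)). Qed.

Lemma ac_zzb a b : ac (cz a) (czb b) = (- (a == b)%:R)%:M.
Proof. by rewrite cz_half ac_half [- ii * ii]mulNr iiM opprK; congr (_%:M); field. Qed.

Lemma zzC a b : cz a *m cz b = - (cz b *m cz a).
Proof. by apply/eqP; rewrite -addr_eq0 -/(ac _ _) ac_zz. Qed.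

Lemma zbzbC a b : czb a *m czb b = - (czb b *m czb a).
Proof. by apply/eqP; rewrite -addr_eq0 -/(ac _ _) ac_zbzb. Qed.

Lemma zzbC a b : cz a *m czb b = - (czb b *m cz a) + (- (a == b)%:R)%:M.
Proof. by rewrite -ac_zzb /ac addrC addrK. Qed.

(** Half the anticommutator turns the antisymmetrised product into a normally ordered one plus a
    scalar. This half trace is in the end the source of W. *)
Lemma cG_l a b : cG a b = czb a *m cz b + (2^-1 * (a == b)%:R)%:M.
Proof.
rewrite /cG zzbC opprD opprK addrA scalerDr half_half; congr (_ + _).
by rewrite -(raddfN (@scalar_mx K N)) opprK scale_scalar_mx eq_sym.
Qed.

Lemma cG_r a b : cG a b = - (cz b *m czb a) - (2^-1 * (a == b)%:R)%:M.
Proof.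
have -> : cz b *m czb a = - (czb a *m cz b) + (- (a == b)%:R)%:M.
  by rewrite zzbC eq_sym.
rewrite cG_l opprD opprK -addrA; congr (_ + _).
rewrite -!(raddfN (@scalar_mx K N)) -(raddfD (@scalar_mx K N)) opprK.
by congr (_%:M); field.
Qed.

Lemma comm_CC i j k : C i *m C j *m C k - C k *m (C i *m C j) =
  (2 * (i == k)%:R) *: C j - (2 * (j == k)%:R) *: C i.
Proof.
have E x y : C x *m C y = (- 2 * (x == y)%:R)%:M - C y *m C x.
  by rewrite -ac_C /ac addrK.
rewrite -mulmxA (E j k) mulmxBr mul_mx_scalar !mulmxA (E i k) mulmxBl mul_scalar_mx.
have aux (x y z : 'M[K]_N) (p q : K) :
    (- 2 * q) *: x - ((- 2 * p) *: y - z) - z = (2 * p) *: y - (2 * q) *: x.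
  by apply/matrixP => r s; rewrite !mxE; ring.
exact: aux.
Qed.

Lemma comm_shift (X Y : 'M[K]_N) (s r : K) :
  (X + s%:M) *m (Y + r%:M) - (Y + r%:M) *m (X + s%:M) = X *m Y - Y *m X.
Proof.
rewrite [(X + _) *m _]mulmxDl [(Y + _) *m _]mulmxDl.
rewrite [X *m (_ + _)]mulmxDr [Y *m (_ + _)]mulmxDr.
rewrite [s%:M *m _]mul_scalar_mx [r%:M *m _]mul_scalar_mx !scalerDr.
rewrite !scale_scalar_mx [r * s]mulrC.
rewrite [X *m r%:M]mul_mx_scalar [Y *m s%:M]mul_mx_scalar.
have aux (a b c d e : 'M[K]_N) : a + b + (c + d) - (e + c + (b + d)) = a - e.
  by apply/matrixP => i j; rewrite !mxE; ring.
exact: aux.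
Qed.

Lemma comm_quadratic (x1 z1 x2 z2 : 'M[K]_N) (p q : K) :
  z1 *m x2 = - (x2 *m z1) + (- p)%:M -> z2 *m x1 = - (x1 *m z2) + (- q)%:M ->
  x2 *m x1 = - (x1 *m x2) -> z2 *m z1 = - (z1 *m z2) ->
  x1 *m z1 *m (x2 *m z2) - x2 *m z2 *m (x1 *m z1) =
  q *: (x2 *m z1) - p *: (x1 *m z2).
Proof.
move=> h1 h2 h3 h4.
have -> : x1 *m z1 *m (x2 *m z2) = - p *: (x1 *m z2) - x1 *m x2 *m (z1 *m z2).
  rewrite mulmxA -(mulmxA x1 z1 x2) h1 mulmxDr mulmxDl mul_mx_scalar -scalemxAl.
  by rewrite mulmxN mulNmx !mulmxA addrC.
have -> : x2 *m z2 *m (x1 *m z1) = - q *: (x2 *m z1) - x1 *m x2 *m (z1 *m z2).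
  rewrite mulmxA -(mulmxA x2 z2 x1) h2 mulmxDr mulmxDl mul_mx_scalar -scalemxAl.
  rewrite mulmxN mulNmx addrC; congr (_ - _).
  by rewrite (mulmxA x2 x1 z2) h3 -(mulmxA _ z2 z1) h4 mulmxN mulNmx opprK.
have aux (x y z : 'M[K]_N) : - p *: y - x - (- q *: z - x) = q *: z - p *: y.
  by apply/matrixP => i j; rewrite !mxE; ring.
exact: aux.
Qed.

(** Normally ordered quadratic monomials are closed under commutators; the scalars of [cG_l] drop
    out on the left and cancel on the right. *)
Lemma cG_comm a b c d : cG a b *m cG c d - cG c d *m cG a b =
  (a == d)%:R *: cG c b - (b == c)%:R *: cG a d.
Proof.
rewrite (cG_l a b) (cG_l c d) comm_shift.
rewrite (comm_quadratic (zzbC b c) (zzbC d a) (zbzbC c a) (zzC d b)).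
rewrite [d == a]eq_sym (cG_l c b) (cG_l a d) [c == b]eq_sym !scalerDr.
rewrite !scale_scalar_mx [(b == c)%:R * _]mulrCA [(a == d)%:R * _]mulrCA.
rewrite (mulrC (a == d)%:R (b == c)%:R).
have aux (x y z : 'M[K]_N) : x - y = x + z - (y + z).
  by apply/matrixP => i j; rewrite !mxE; ring.
exact: aux.
Qed.

Lemma sum_delta (V : lmodType K) (J : finType) (j : J) (S : J -> V) :
  \sum_a (a == j)%:R *: S a = S j.
Proof.
rewrite (bigD1 j) //= eqxx scale1r big1 ?addr0 // => a /negbTE ->.
exact: scale0r.
Qed.

Lemma sum_split2 (V : nmodType) (F : I -> I -> V) : \sum_i \sum_j F i j =
  \sum_a \sum_b (F (lshift n a) (lshift n b) + F (lshift n a) (rshift n b) +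
    (F (rshift n a) (lshift n b) + F (rshift n a) (rshift n b))).
Proof.
rewrite big_split_ord /= -big_split /=; apply: eq_bigr => a _.
by rewrite !big_split_ord /= -!big_split.
Qed.

Lemma sym_antisym_sum (S : 'I_n -> 'I_n -> K) (X : 'I_n -> 'I_n -> 'M[K]_N) :
  (forall a b, S a b = S b a) -> (forall a b, X a b = - X b a) ->
  \sum_a \sum_b S a b *: X a b = 0.
Proof.
move=> sS aX; set s := \sum_a _.
have : s = - s.
  rewrite {1}/s exchange_big /= -sumrN; apply: eq_bigr => a _.
  rewrite -sumrN; apply: eq_bigr => b _.
  by rewrite sS aX scalerN.
move=> /eqP; rewrite -addr_eq0 => /eqP ss; rewrite -[s]half_half ss; exact: scaler0.
Qed.

Section Connection.
Variables (w : I -> I -> R) (o : 'I_n -> 'I_n -> K).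
Hypothesis wl : forall a b, Complex (w (lshift n a) (lshift n b))
  (w (lshift n a) (rshift n b)) = o a b.
Hypothesis wr : forall a b, Complex (w (rshift n a) (lshift n b))
  (w (rshift n a) (rshift n b)) = ii * o a b.
Hypothesis o_skew : forall a b, conjc (o a b) = - o b a.
Hypothesis w_skew : forall i j, w i j = - w j i.

Definition cGamma : 'M[K]_N :=
  4^-1 *: \sum_i \sum_j (w i j)%:C%C *: (C i *m C j).

(** The infinitesimal form of Spin -> SO. Each commutator of C_a C_b with C_j has two terms with
    coefficient 2, which agree after summation as w is skew; [4^-1] normalises the resulting 4. This
    makes nabla a derivation for Clifford multiplication. *)
Lemma cGamma_comm j : cGamma *m C j - C j *m cGamma = \sum_d (w j d)%:C%C *: C d.
Proof.
rewrite /cGamma -scalemxAl -scalemxAr -scalerBr mulmx_suml mulmx_sumr -sumrB.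
rewrite (eq_bigr (fun a => \sum_b (w a b)%:C%C *: ((2 * (a == j)%:R) *: C b -
                                              (2 * (b == j)%:R) *: C a))); last first.
  move=> a _; rewrite mulmx_suml mulmx_sumr -sumrB; apply: eq_bigr => b _.
  by rewrite -scalemxAl -scalemxAr -scalerBr comm_CC.
rewrite (eq_bigr (fun a => 2 *: ((a == j)%:R *: \sum_b (w a b)%:C%C *: C b) -
                           2 *: ((w a j)%:C%C *: C a))); last first.
  move=> a _; rewrite !scaler_sumr.
  rewrite [X in _ = _ - X](_ : _ = \sum_b (w a b)%:C%C *: ((2 * (b == j)%:R) *: C a)).
    rewrite -sumrB; apply: eq_bigr => b _.
    by rewrite scalerBr !scalerA; congr (_ *: _ - _); ring.
  rewrite (bigD1 j) //= eqxx mulr1 big1 ?addr0; last first.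
    by move=> b /negbTE ->; rewrite mulr0 scale0r scaler0.
  by rewrite !scalerA mulrC.
rewrite sumrB -!scaler_sumr sum_delta.
rewrite [X in _ - 2 *: X](_ : _ = - \sum_b (w j b)%:C%C *: C b); last first.
  by rewrite -sumrN; apply: eq_bigr => a _; rewrite w_skew rmorphN scaleNr.
rewrite scalerN opprK -scalerDl scalerA.
have -> : 4^-1 * (2 + 2) = 1 :> K by field.
by rewrite scale1r.
Qed.

Lemma zb_z_expand a b : czb a *m cz b = 4^-1 *:
  (C (lshift n a) *m C (lshift n b) + C (rshift n a) *m C (rshift n b) +
   ii *: (C (rshift n a) *m C (lshift n b) - C (lshift n a) *m C (rshift n b))).
Proof.
rewrite /czb /cz -scalemxAl -scalemxAr scalerA mulmxDl !mulmxBr.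
rewrite -!scalemxAl -!scalemxAr scalerA iiM scaleN1r opprK.
have -> : 2^-1 * 2^-1 = 4^-1 :> K by field.
congr (_ *: _); rewrite scalerBr.
have aux (x y z w' : 'M[K]_N) : x - y + (z + w') = x + w' + (z - y).
  by apply/matrixP => i j; rewrite !mxE; ring.
exact: aux.
Qed.

Lemma z_zb_expand a b : cz a *m czb b = 4^-1 *:
  (C (lshift n a) *m C (lshift n b) + C (rshift n a) *m C (rshift n b) -
   ii *: (C (rshift n a) *m C (lshift n b) - C (lshift n a) *m C (rshift n b))).
Proof.
rewrite /czb /cz -scalemxAl -scalemxAr scalerA mulmxBl !mulmxDr.
rewrite -!scalemxAl -!scalemxAr scalerA iiM scaleN1r.
have -> : 2^-1 * 2^-1 = 4^-1 :> K by field.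
congr (_ *: _); rewrite scalerBr.
have aux (x y z w' : 'M[K]_N) : x + y - (z - w') = x + w' - (z - y).
  by apply/matrixP => i j; rewrite !mxE; ring.
exact: aux.
Qed.

(** By [wl] and [wr] the real connection is complex linear, so it pairs z only with conj z; [o_skew]
    then combines the two orders of the product into [cG]. *)
Lemma cGamma_om : cGamma = \sum_a \sum_b o a b *: cG a b.
Proof.
have -> : \sum_a \sum_b o a b *: cG a b = 2^-1 *:
    (\sum_a \sum_b (o a b *: (czb a *m cz b) + conjc (o a b) *: (cz a *m czb b))).
  have -> : \sum_a \sum_b (o a b *: (czb a *m cz b) + conjc (o a b) *: (cz a *m czb b)) =
      \sum_a \sum_b o a b *: (czb a *m cz b) - \sum_a \sum_b o a b *: (cz b *m czb a).
    rewrite [X in _ - X]exchange_big /= -sumrB; apply: eq_bigr => a _.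
    rewrite -sumrB; apply: eq_bigr => b _.
    by rewrite o_skew scaleNr.
  rewrite -sumrB scaler_sumr; apply: eq_bigr => a _.
  rewrite -sumrB scaler_sumr; apply: eq_bigr => b _.
  by rewrite -scalerBr !scalerA mulrC -scalerA.
have -> : \sum_a \sum_b (o a b *: (czb a *m cz b) + conjc (o a b) *: (cz a *m czb b)) =
   2^-1 *: \sum_i \sum_j (w i j)%:C%C *: (C i *m C j).
  rewrite (sum_split2 (fun i j => (w i j)%:C%C *: (C i *m C j))).
  rewrite scaler_sumr; apply: eq_bigr => a _; rewrite scaler_sumr; apply: eq_bigr => b _.
  rewrite zb_z_expand z_zb_expand.
  have := f_equal (@complex.Re R) (wr a b); have := f_equal (@complex.Im R) (wr a b).
  rewrite cReM cImM /= !mul0r !mul1r sub0r add0r => -> ->.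
  have := f_equal (@complex.Re R) (wl a b); have := f_equal (@complex.Im R) (wl a b).
  move=> /= -> ->.
  set x := complex.Re _; set y := complex.Im _.
  have -> : conjc (o a b) = x%:C%C - ii * y%:C%C.
    by apply: complex_ext; rewrite ?cReJ ?cImJ ?cReD ?cImD ?cReN ?cImN ?cReM ?cImM /= /x /y; ring.
  have -> : o a b = x%:C%C + ii * y%:C%C.
    by apply: complex_ext; rewrite ?cReD ?cImD ?cReN ?cImN ?cReM ?cImM /= /x /y; ring.
  have -> : (- y)%:C%C = - y%:C%C :> K by apply: complex_ext; rewrite /= ?oppr0.
  move: (C (lshift n a) *m C (lshift n b)) (C (rshift n a) *m C (rshift n b)).
  move: (C (lshift n a) *m C (rshift n b)) (C (rshift n a) *m C (lshift n b)).
  move: (x%:C%C) (y%:C%C) => {x y} x y LR RL LL RR.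
  apply/matrixP => r s; rewrite !mxE.
  have aux (i l1 l2 l3 l4 : K) : i * i = -1 ->
    (x + i * y) * (4^-1 * (l3 + l4 + i * (l2 - l1))) +
    (x - i * y) * (4^-1 * (l3 + l4 - i * (l2 - l1))) =
    2^-1 * (x * l3 + y * l1 + (- y * l2 + x * l4)).
    move=> H.
    have -> : (x + i * y) * (4^-1 * (l3 + l4 + i * (l2 - l1))) +
    (x - i * y) * (4^-1 * (l3 + l4 - i * (l2 - l1))) =
    2^-1 * (x * (l3 + l4)) + i * i * (2^-1 * (y * (l2 - l1))) by field.
    by rewrite H; ring.
  exact: aux iiM.
rewrite scalerA /cGamma; congr (_ *: _); by field.
Qed.

End Connection.

(** The X a b have the commutators of the elementary matrices E_ba, so a coefficient matrix o is
    represented through its transpose and commutators change sign. With this sign the quadratic term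
    of the curvature form becomes the commutator of the spin connection matrices. *)
Lemma gl_commutator (X : 'I_n -> 'I_n -> 'M[K]_N) (o o' : 'I_n -> 'I_n -> K) :
  (forall a b c d, X a b *m X c d - X c d *m X a b =
    (a == d)%:R *: X c b - (b == c)%:R *: X a d) ->
  (\sum_a \sum_b o a b *: X a b) *m (\sum_a \sum_b o' a b *: X a b) -
  (\sum_a \sum_b o' a b *: X a b) *m (\sum_a \sum_b o a b *: X a b) =
  \sum_a \sum_b (- \sum_g (o a g * o' g b - o' a g * o g b)) *: X a b.
Proof.
move=> XC.
pose F (u v : 'I_n -> 'I_n -> K) a b := \sum_c \sum_d (u a b * v c d) *: (X a b *m X c d).
have prodE u v : (\sum_a \sum_b u a b *: X a b) *m (\sum_a \sum_b v a b *: X a b) =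
    \sum_a \sum_b F u v a b.
  rewrite mulmx_suml; apply: eq_bigr => a _; rewrite mulmx_suml; apply: eq_bigr => b _.
  rewrite mulmx_sumr; apply: eq_bigr => c _; rewrite mulmx_sumr; apply: eq_bigr => d _.
  by rewrite -scalemxAl -scalemxAr scalerA.
have swap : \sum_a \sum_b F o' o a b =
    \sum_a \sum_b \sum_c \sum_d (o a b * o' c d) *: (X c d *m X a b).
  transitivity (\sum_a \sum_c \sum_b \sum_d (o' a b * o c d) *: (X a b *m X c d)).
    by apply: eq_bigr => a _; exact: exchange_big.
  rewrite exchange_big /=; apply: eq_bigr => c _.
  transitivity (\sum_a \sum_d \sum_b (o' a b * o c d) *: (X a b *m X c d)).
    by apply: eq_bigr => a _; exact: exchange_big.
  rewrite exchange_big /=; apply: eq_bigr => d _; apply: eq_bigr => a _.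
  by apply: eq_bigr => b _; rewrite mulrC.
rewrite !prodE swap -sumrB.
transitivity (\sum_a \sum_b (\sum_c (o a b * o' c a) *: X c b -
                             \sum_d (o a b * o' b d) *: X a d)).
  apply: eq_bigr => a _; rewrite -sumrB; apply: eq_bigr => b _; rewrite /F -sumrB.
  transitivity (\sum_c \sum_d ((a == d)%:R *: ((o a b * o' c d) *: X c b) -
                               (b == c)%:R *: ((o a b * o' c d) *: X a d))).
    apply: eq_bigr => c _; rewrite -sumrB; apply: eq_bigr => d _.
    rewrite -scalerBr XC scalerBr !scalerA.
    by congr (_ *: _ - _ *: _); exact: mulrC.
  rewrite (eq_bigr (fun c => \sum_d (a == d)%:R *: ((o a b * o' c d) *: X c b) -
     \sum_d (b == c)%:R *: ((o a b * o' c d) *: X a d))); last first.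
    by move=> c _; rewrite sumrB.
  rewrite sumrB; congr (_ - _).
    apply: eq_bigr => c _.
    rewrite (eq_bigr (fun d => (d == a)%:R *: ((o a b * o' c d) *: X c b))).
      by rewrite sum_delta.
    by move=> d _; rewrite eq_sym.
  rewrite (eq_bigr (fun c => (c == b)%:R *: \sum_d ((o a b * o' c d) *: X a d))).
    by rewrite sum_delta.
  by move=> c _; rewrite eq_sym scaler_sumr.
have split2 : \sum_a \sum_b (- \sum_g (o a g * o' g b - o' a g * o g b)) *: X a b =
   \sum_a \sum_b \sum_g (o' a g * o g b) *: X a b -
   \sum_a \sum_b \sum_g (o a g * o' g b) *: X a b.
  rewrite -sumrB; apply: eq_bigr => a _; rewrite -sumrB; apply: eq_bigr => b _.
  by rewrite -sumrB -sumrN scaler_suml; apply: eq_bigr => g _; rewrite opprB scalerBl.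
rewrite split2 (eq_bigr (fun a => \sum_b \sum_c (o a b * o' c a) *: X c b -
   \sum_b \sum_d (o a b * o' b d) *: X a d)); last by move=> a _; rewrite sumrB.
rewrite sumrB; congr (_ - _).
  transitivity (\sum_a \sum_c \sum_b (o a b * o' c a) *: X c b).
    by apply: eq_bigr => a _; exact: exchange_big.
  rewrite exchange_big /=; apply: eq_bigr => c _.
  rewrite exchange_big /=; apply: eq_bigr => b _; apply: eq_bigr => a _.
  by rewrite mulrC.
by apply: eq_bigr => a _; exact: exchange_big.
Qed.

Lemma cG_curvature (o o' : 'I_n -> 'I_n -> K) :
  (\sum_a \sum_b o a b *: cG a b) *m (\sum_a \sum_b o' a b *: cG a b) -
  (\sum_a \sum_b o' a b *: cG a b) *m (\sum_a \sum_b o a b *: cG a b) =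
  \sum_a \sum_b (- \sum_g (o a g * o' g b - o' a g * o g b)) *: cG a b.
Proof. by apply: gl_commutator; exact: cG_comm. Qed.

End CliffordAlgebra.

(** * Clifford contraction of the curvature *)

Section CurvatureTerm.
Context {R : realType} {n N : nat}.
Local Notation K := R[i].
Local Notation I := ('I_(n + n)).
Local Notation ii := (Complex 0 1 : K).
Local Notation t := (@tcoef R n).
Local Notation tb := (fun a i => conjc (t a i)).
Variable C : I -> 'M[K]_N.
Hypothesis CR : clifford_relations C.

#[local] Opaque tcoef.

Lemma conj_nat (b : bool) : conjc (b%:R : K) = b%:R.
Proof. by case: b; apply: complex_ext; rewrite /= ?oppr0. Qed.

Lemma tb_lshift b a : conjc (t b (lshift n a)) = (a == b)%:R.
Proof. by rewrite tcoef_lshift conj_nat. Qed.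

Lemma tb_rshift b a : conjc (t b (rshift n a)) = - ii * (a == b)%:R.
Proof.
rewrite tcoef_rshift rmorphM /= conj_nat; congr (_ * _).
by apply: complex_ext; rewrite /= ?oppr0.
Qed.

Lemma sum_frame (u : I -> K) (a b : 'I_n) (k : K) :
  (forall c, u (lshift n c) = (c == a)%:R) ->
  (forall c, u (rshift n c) = k * (c == a)%:R) ->
  forall f : I -> K, \sum_i u i * f i = f (lshift n a) + k * f (rshift n a).
Proof.
move=> ul ur f; rewrite big_split_ord /=.
rewrite (bigD1 a) //= ul eqxx mul1r big1 ?addr0; last first.
  by move=> c /negbTE ca; rewrite ul ca mul0r.
rewrite (bigD1 a) //= ur eqxx mulr1 big1 ?addr0 //.
by move=> c /negbTE ca; rewrite ur ca mulr0 mul0r.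
Qed.

Lemma sum_t a f : \sum_i t a i * f i = f (lshift n a) + ii * f (rshift n a).
Proof. by apply: sum_frame => // c; [exact: tcoef_lshift|exact: tcoef_rshift]. Qed.

Lemma sum_tb a f : \sum_i tb a i * f i = f (lshift n a) + - ii * f (rshift n a).
Proof. by apply: sum_frame => // c; [exact: tb_lshift|exact: tb_rshift]. Qed.

Lemma sum_tt a b : \sum_i t a i * t b i = 0.
Proof.
rewrite sum_t tcoef_lshift tcoef_rshift mulrA (iiM (R := R)) mulN1r addrN.
by [].
Qed.

Lemma sum_ttb a b : \sum_i t a i * tb b i = 2 * (a == b)%:R.
Proof.
rewrite sum_t /= tb_lshift tb_rshift mulrA mulrN (iiM (R := R)) opprK mul1r.
by ring.
Qed.

Lemma sum_tbt a b : \sum_i tb a i * t b i = 2 * (a == b)%:R.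
Proof.
rewrite sum_tb tcoef_lshift tcoef_rshift mulrA mulNr (iiM (R := R)) opprK mul1r.
by ring.
Qed.

Lemma sum_tbtb a b : \sum_i tb a i * tb b i = 0.
Proof.
rewrite sum_tb /= tb_lshift tb_rshift mulrA mulNr mulrN (iiM (R := R)) opprK.
by rewrite mulN1r addrN.
Qed.

Lemma C_frame i : C i = \sum_a (t a i *: cz C a + tb a i *: czb C a).
Proof.
rewrite -(splitK i); case: (fintype.split i) => c /=.
  rewrite (eq_bigr (fun a => (a == c)%:R *: (cz C a + czb C a))).
    by rewrite sum_delta lshift_cz.
  by move=> a _; rewrite tcoef_lshift conj_nat -scalerDr eq_sym.
rewrite (eq_bigr (fun a => (a == c)%:R *: (ii *: (cz C a - czb C a)))).
  by rewrite sum_delta rshift_cz.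
move=> a _; rewrite tcoef_rshift -tcoef_rshift tb_rshift tcoef_rshift.
rewrite scalerA mulrC -scalerA mulNr scaleNr [ii * _]mulrC -!scalerA -!scalerBr.
by rewrite eq_sym.
Qed.

(* t s and tb r are the components of 2 conj Z_s and 2 Z_r in the frame e. *)
Definition bext (X : I -> I -> K) (u v : I -> K) := \sum_i u i * \sum_j v j * X i j.

Lemma bextC X u v : (forall i j, X i j = - X j i) -> bext X u v = - bext X v u.
Proof.
move=> aX; rewrite /bext.
transitivity (\sum_i \sum_j u i * (v j * X i j)).
  by apply: eq_bigr => i _; rewrite mulr_sumr.
rewrite exchange_big -sumrN; apply: eq_bigr => j _ /=.
rewrite mulr_sumr -sumrN; apply: eq_bigr => i _.
rewrite aX; have aux (x y z : K) : x * (y * - z) = - (y * (x * z)) by ring.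
exact: aux.
Qed.

Variables (Om : 'I_n -> 'I_n -> I -> I -> K) (A : 'I_n -> 'I_n -> K).
Local Notation dT i j := (ii * \sum_a (t a i * tb a j - t a j * tb a i)).
Local Notation tau b k := (\sum_g A b g * tb g k).
Hypothesis OmC : forall a b i j, Om a b i j = - Om a b j i.
Hypothesis OmJ : forall a b i j, conjc (Om a b i j) = - Om b a i j.
Hypothesis A_sym : forall a b, A a b = A b a.
Hypothesis bianchi_id : forall b i j k,
  \sum_a (t a k * Om a b i j + t a i * Om a b j k + t a j * Om a b k i) =
  dT i j * tau b k + dT j k * tau b i + dT k i * tau b j.

Definition text a (u : I -> K) := \sum_i u i * t a i.
Definition tauext b (u : I -> K) := \sum_i u i * tau b i.
Definition dText (u v : I -> K) := bext (fun i j => dT i j) u v.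

Lemma triple_sum (u v w : I -> K) (f : I -> K) (X : I -> I -> K) :
  \sum_i u i * (\sum_j v j * (\sum_k w k * (f k * X i j))) =
  (\sum_k w k * f k) * bext X u v.
Proof.
rewrite /bext mulr_sumr; apply: eq_bigr => i _; rewrite mulrCA; congr (_ * _).
rewrite mulr_sumr; apply: eq_bigr => j _; rewrite mulrCA; congr (_ * _).
by rewrite mulr_suml; apply: eq_bigr => k _; rewrite mulrA.
Qed.

Lemma triple_rot (u v w : I -> K) (F : I -> I -> I -> K) :
  \sum_i u i * (\sum_j v j * (\sum_k w k * F i j k)) =
  \sum_j v j * (\sum_k w k * (\sum_i u i * F i j k)).
Proof.
transitivity (\sum_i \sum_j v j * (u i * \sum_k w k * F i j k)).
  by apply: eq_bigr => i _; rewrite mulr_sumr; apply: eq_bigr => j _; exact: mulrCA.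
rewrite exchange_big; apply: eq_bigr => j _ /=; rewrite -mulr_sumr; congr (_ * _).
transitivity (\sum_i \sum_k w k * (u i * F i j k)).
  by apply: eq_bigr => i _; rewrite mulr_sumr; apply: eq_bigr => k _; exact: mulrCA.
by rewrite exchange_big; apply: eq_bigr => k _ /=; rewrite -mulr_sumr.
Qed.

Lemma triple_add (u v w : I -> K) (F G : I -> I -> I -> K) :
  \sum_i u i * (\sum_j v j * (\sum_k w k * (F i j k + G i j k))) =
  \sum_i u i * (\sum_j v j * (\sum_k w k * F i j k)) +
  \sum_i u i * (\sum_j v j * (\sum_k w k * G i j k)).
Proof.
rewrite -big_split; apply: eq_bigr => i _ /=; rewrite -mulrDr; congr (_ * _).
rewrite -big_split; apply: eq_bigr => j _ /=; rewrite -mulrDr; congr (_ * _).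
by rewrite -big_split; apply: eq_bigr => k _ /=; rewrite -mulrDr.
Qed.

Lemma triple_sumr (u v w : I -> K) (F : 'I_n -> I -> I -> I -> K) :
  \sum_i u i * (\sum_j v j * (\sum_k w k * (\sum_a F a i j k))) =
  \sum_a \sum_i u i * (\sum_j v j * (\sum_k w k * F a i j k)).
Proof.
rewrite exchange_big; apply: eq_bigr => i _ /=; rewrite -mulr_sumr; congr (_ * _).
rewrite exchange_big; apply: eq_bigr => j _ /=; rewrite -mulr_sumr; congr (_ * _).
by rewrite exchange_big; apply: eq_bigr => k _ /=; rewrite -mulr_sumr.
Qed.

(** The identity is trilinear in the frame vectors, hence extends to complex combinations of them;
    below, u, v and w become multiples of the Z and conj Z. *)
Lemma bianchi_ext b u v w :
  \sum_a (text a w * bext (Om a b) u v + text a u * bext (Om a b) v w +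
          text a v * bext (Om a b) w u) =
  dText u v * tauext b w + dText v w * tauext b u + dText w u * tauext b v.
Proof.
have E2 (f : I -> K) (X : I -> I -> K) :
    \sum_i u i * (\sum_j v j * (\sum_k w k * (f i * X j k))) =
    (\sum_i u i * f i) * bext X v w.
  by rewrite triple_rot (triple_sum v w u).
have E3 (f : I -> K) (X : I -> I -> K) :
    \sum_i u i * (\sum_j v j * (\sum_k w k * (f j * X k i))) =
    (\sum_j v j * f j) * bext X w u.
  by rewrite triple_rot triple_rot (triple_sum w u v).
have L : \sum_i u i * (\sum_j v j * (\sum_k w k *
    (\sum_a (t a k * Om a b i j + t a i * Om a b j k + t a j * Om a b k i)))) =
    \sum_a (text a w * bext (Om a b) u v + text a u * bext (Om a b) v w +
          text a v * bext (Om a b) w u).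
  rewrite triple_sumr; apply: eq_bigr => a _; rewrite !triple_add.
  by rewrite triple_sum (E2 (t a) (Om a b)) (E3 (t a) (Om a b)).
rewrite -L.
transitivity (\sum_i u i * (\sum_j v j * (\sum_k w k *
    (dT i j * tau b k + dT j k * tau b i + dT k i * tau b j)))).
  apply: eq_bigr => i _; congr (_ * _); apply: eq_bigr => j _; congr (_ * _).
  by apply: eq_bigr => k _; congr (_ * _); exact: bianchi_id.
rewrite !triple_add; congr (_ + _ + _).
- transitivity (\sum_i u i * (\sum_j v j * (\sum_k w k * (tau b k * dT i j)))).
    apply: eq_bigr => i _; congr (_ * _); apply: eq_bigr => j _; congr (_ * _).
    by apply: eq_bigr => k _; congr (_ * _); exact: mulrC.
  by rewrite (triple_sum u v w (fun k => tau b k)) mulrC.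
- transitivity (\sum_i u i * (\sum_j v j * (\sum_k w k * (tau b i * dT j k)))).
    apply: eq_bigr => i _; congr (_ * _); apply: eq_bigr => j _; congr (_ * _).
    by apply: eq_bigr => k _; congr (_ * _); exact: mulrC.
  by rewrite (E2 (fun k => tau b k)) mulrC.
- transitivity (\sum_i u i * (\sum_j v j * (\sum_k w k * (tau b j * dT k i)))).
    apply: eq_bigr => i _; congr (_ * _); apply: eq_bigr => j _; congr (_ * _).
    by apply: eq_bigr => k _; congr (_ * _); exact: mulrC.
  by rewrite (E3 (fun k => tau b k)) mulrC.
Qed.

Lemma text_tb a r : text a (tb r) = 2 * (r == a)%:R. Proof. exact: sum_tbt. Qed.
Lemma text_t a r : text a (t r) = 0. Proof. exact: sum_tt. Qed.

Lemma tauext_t b r : tauext b (t r) = 2 * A b r.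
Proof.
rewrite /tauext (eq_bigr (fun i => \sum_g A b g * (t r i * tb g i))); last first.
  by move=> i _; rewrite mulr_sumr; apply: eq_bigr => g _; exact: mulrCA.
rewrite exchange_big /= (eq_bigr (fun g => A b g * (2 * (r == g)%:R))); last first.
  by move=> g _; rewrite -mulr_sumr sum_ttb.
rewrite (bigD1 r) //= eqxx mulr1 mulrC big1 ?addr0 // => g /negbTE gr.
by rewrite eq_sym gr mulr0 mulr0.
Qed.

Lemma tauext_tb b r : tauext b (tb r) = 0.
Proof.
rewrite /tauext (eq_bigr (fun i => \sum_g A b g * (tb r i * tb g i))); last first.
  by move=> i _; rewrite mulr_sumr; apply: eq_bigr => g _; exact: mulrCA.
rewrite exchange_big big1 // => g _ /=.
by rewrite -mulr_sumr sum_tbtb mulr0.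
Qed.

Lemma dText_sum u v : dText u v = ii * \sum_a ((\sum_i u i * t a i) * (\sum_j v j * tb a j) -
  (\sum_i u i * tb a i) * (\sum_j v j * t a j)).
Proof.
rewrite /dText /bext.
transitivity (\sum_i \sum_j \sum_a ii * (u i * t a i * (v j * tb a j) -
                                        u i * tb a i * (v j * t a j))).
  apply: eq_bigr => i _; rewrite mulr_sumr; apply: eq_bigr => j _.
  rewrite !mulr_sumr; apply: eq_bigr => a _.
  have aux (x y z p q r s : K) : x * (y * (z * (p * q - r * s))) =
    z * (x * p * (y * q) - x * s * (y * r)) by ring.
  exact: aux.
rewrite mulr_sumr.
transitivity (\sum_i \sum_a \sum_j ii * (u i * t a i * (v j * tb a j) -
                                        u i * tb a i * (v j * t a j))).
  by apply: eq_bigr => i _; exact: exchange_big.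
rewrite exchange_big; apply: eq_bigr => a _ /=.
rewrite mulr_suml [X in _ - X]mulr_suml -sumrB mulr_sumr; apply: eq_bigr => i _.
by rewrite -mulr_sumr sumrB -!mulr_sumr.
Qed.

Lemma dText_tbt r s : dText (tb r) (t s) = 4 * ii * (r == s)%:R.
Proof.
rewrite dText_sum (eq_bigr (fun a => 4 * ((r == a)%:R * (s == a)%:R))); last first.
  move=> a _; rewrite sum_tbt sum_ttb sum_tbtb mul0r subr0.
  have aux (x y : K) : 2 * x * (2 * y) = 4 * (x * y) by ring.
  exact: aux.
rewrite -mulr_sumr (bigD1 r) //= eqxx mul1r big1 ?addr0; last first.
  by move=> a /negbTE ar; rewrite [r == a]eq_sym ar mul0r.
by rewrite [s == r]eq_sym mulrA [ii * 4]mulrC.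
Qed.

Lemma dText_tt r s : dText (t r) (t s) = 0.
Proof.
rewrite dText_sum big1 ?mulr0 // => a _.
by rewrite sum_tt sum_tt mul0r mulr0 subr0.
Qed.

Lemma dText_tbtb r s : dText (tb r) (tb s) = 0.
Proof.
rewrite dText_sum big1 ?mulr0 // => a _.
by rewrite sum_tbtb sum_tbtb mul0r mulr0 subr0.
Qed.

Lemma dTextC u v : dText u v = - dText v u.
Proof.
apply: bextC => i j; rewrite -mulrN -sumrN; congr (_ * _).
by apply: eq_bigr => a _; rewrite opprB.
Qed.

(** The curvature on 2 Z_r and 2 conj Z_s, that is 4 times the Webster curvature. *)
Definition Rc a b r s := bext (Om a b) (tb r) (t s).

Lemma sum_delta2 (f : 'I_n -> K) r : \sum_a 2 * (r == a)%:R * f a = 2 * f r.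
Proof.
rewrite (bigD1 r) //= eqxx mulr1 big1 ?addr0 // => a /negbTE ar.
by rewrite eq_sym ar mulr0 mul0r.
Qed.

Lemma two_neq0 : (2 : K) != 0. Proof. by rewrite pnatr_eq0. Qed.

(** Bianchi on (Z_r, conj Z_s, Z_a): the right side vanishes because tau kills (1,0) vectors and
    dtheta vanishes on two of them, and on the left theta^c kills conj Z_s. *)
Lemma Rc_sym a b r s : Rc a b r s = Rc r b a s.
Proof.
have := bianchi_ext b (tb r) (t s) (tb a).
rewrite !tauext_tb dText_tbtb !mulr0 mul0r !addr0.
rewrite (eq_bigr (fun c => 2 * (a == c)%:R * Rc c b r s -
                          2 * (r == c)%:R * Rc c b a s)); last first.
  move=> c _; rewrite !text_tb text_t mul0r addr0; congr (_ + _).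
  by rewrite -mulrN; congr (_ * _); exact: bextC.
rewrite sumrB !sum_delta2 -mulrBr => /eqP.
by rewrite mulf_eq0 (negbTE two_neq0) /= subr_eq0 => /eqP.
Qed.

(** Bianchi on (Z_r, conj Z_s, conj Z_q): on the left theta^c is nonzero on Z_r only, which isolates
    the (0,2) part of the curvature and equates it with torsion terms. *)
Lemma Om_tt r b s q : bext (Om r b) (t s) (t q) =
  4 * ii * ((r == s)%:R * A b q - (r == q)%:R * A b s).
Proof.
have := bianchi_ext b (tb r) (t s) (t q).
rewrite [dText (t q) _]dTextC !dText_tbt dText_tt !tauext_t mul0r addr0.
rewrite (eq_bigr (fun c => 2 * (r == c)%:R * bext (Om c b) (t s) (t q))); last first.
  by move=> c _; rewrite !text_tb !text_t !mul0r addr0 add0r.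
rewrite sum_delta2 => H; apply: (mulfI two_neq0); rewrite H.
have aux (i x y z w : K) : 4 * i * x * (2 * y) + - (4 * i * z) * (2 * w) =
  2 * (4 * i * (x * y - z * w)) by ring.
exact: aux.
Qed.

Lemma bext_conj a b u v : conjc (bext (Om a b) u v) =
  - bext (Om b a) (fun i => conjc (u i)) (fun i => conjc (v i)).
Proof.
rewrite /bext rmorph_sum -sumrN; apply: eq_bigr => i _.
rewrite rmorphM -mulrN rmorph_sum; congr (_ * _); rewrite -sumrN.
by apply: eq_bigr => j _; rewrite rmorphM /= OmJ mulrN.
Qed.

Lemma t_conjK r : (fun i => conjc (tb r i)) = t r.
Proof. by apply/funext => i; rewrite conjcK. Qed.

Lemma Om_tbtb a b s q : bext (Om a b) (tb s) (tb q) =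
  4 * ii * ((b == s)%:R * conjc (A a q) - (b == q)%:R * conjc (A a s)).
Proof.
have -> : bext (Om a b) (tb s) (tb q) = - conjc (bext (Om b a) (t s) (t q)).
  by rewrite bext_conj opprK.
rewrite Om_tt; have c4 : conjc (4 * ii) = - (4 * ii).
  rewrite (rmorphM (@conjc R)) (rmorph_nat (@conjc R)) -mulrN; congr (_ * _).
  by apply: complex_ext; rewrite /= ?oppr0.
have aux (x y x' y' : K) : conjc x = - x' -> conjc y = y' -> - conjc (x * y) = x' * y'.
  by move=> h1 h2; rewrite rmorphM /= h1 h2 mulNr opprK.
apply: aux c4 _; rewrite rmorphB !rmorphM /=.
by rewrite !conj_nat.
Qed.

Lemma Rc_conj a b r s : conjc (Rc a b r s) = Rc b a s r.
Proof.
rewrite /Rc bext_conj t_conjK (bextC (t r)) ?opprK //.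
Qed.

Lemma Rc_sym2 a b r s : Rc a b r s = Rc a s r b.
Proof.
by apply: (can_inj (@conjcK R)); rewrite !Rc_conj Rc_sym.
Qed.

Local Notation z := (cz C).
Local Notation zb := (czb C).
Local Notation G := (cG C).

Lemma sum4 (J : finType) (V : nmodType) (F1 F2 F3 F4 : J -> V) :
  \sum_j (F1 j + F2 j + (F3 j + F4 j)) =
  \sum_j F1 j + \sum_j F2 j + (\sum_j F3 j + \sum_j F4 j).
Proof. by rewrite !big_split. Qed.

Lemma scaler4 (V : lmodType K) (k : K) (x1 x2 x3 x4 : V) :
  k *: (x1 + x2 + (x3 + x4)) = k *: x1 + k *: x2 + (k *: x3 + k *: x4).
Proof. by rewrite !scalerDr. Qed.

(** Decomposition of the 2-form X by type. The (1,1) part occurs in both orders of Z and conj Z; as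
    X is skew, these combine into the commutators [G]. *)
Lemma sum_CC (X : I -> I -> K) : (forall i j, X i j = - X j i) ->
  \sum_i \sum_j X i j *: (C i *m C j) =
  \sum_a \sum_b (bext X (t a) (t b) *: (z a *m z b)) +
  \sum_a \sum_b (bext X (tb a) (tb b) *: (zb a *m zb b)) +
  2 *: \sum_a \sum_b (bext X (tb a) (t b) *: G a b).
Proof.
move=> aX.
have bextE u v (Y : 'I_n -> 'I_n -> 'M[K]_N) :
  \sum_a \sum_b (bext X (u a) (v b) *: Y a b) =
  \sum_i \sum_j X i j *: \sum_a \sum_b (u a i * v b j) *: Y a b.
  transitivity (\sum_a \sum_b \sum_i \sum_j (X i j * (u a i * v b j)) *: Y a b).
    apply: eq_bigr => a _; apply: eq_bigr => b _.
    rewrite scaler_suml; apply: eq_bigr => i _.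
    rewrite mulr_sumr scaler_suml; apply: eq_bigr => j _; congr (_ *: _).
    have aux (x y w : K) : x * (y * w) = w * (x * y) by ring.
    exact: aux.
  transitivity (\sum_a \sum_i \sum_b \sum_j (X i j * (u a i * v b j)) *: Y a b).
    by apply: eq_bigr => a _; exact: exchange_big.
  rewrite exchange_big; apply: eq_bigr => i _ /=.
  transitivity (\sum_a \sum_j \sum_b (X i j * (u a i * v b j)) *: Y a b).
    by apply: eq_bigr => a _; exact: exchange_big.
  rewrite exchange_big; apply: eq_bigr => j _ /=.
  rewrite scaler_sumr; apply: eq_bigr => a _; rewrite scaler_sumr.
  by apply: eq_bigr => b _; rewrite scalerA.
have -> : 2 *: \sum_a \sum_b (bext X (tb a) (t b) *: G a b) =
   \sum_a \sum_b (bext X (tb a) (t b) *: (zb a *m z b)) +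
   \sum_a \sum_b (bext X (t a) (tb b) *: (z a *m zb b)).
  rewrite [X in _ = _ + X]exchange_big -big_split scaler_sumr /=.
  apply: eq_bigr => a _; rewrite -big_split scaler_sumr; apply: eq_bigr => b _ /=.
  rewrite (bextC (t b) (tb a) aX) scaleNr -scalerBr !scalerA.
  by congr (_ *: _); rewrite mulrC mulKf // two_neq0.
have E1 := bextE t t (fun a b => z a *m z b).
have E2 := bextE (fun a => tb a) (fun b => tb b) (fun a b => zb a *m zb b).
have E3 := bextE (fun a => tb a) t (fun a b => zb a *m z b).
have E4 := bextE t (fun b => tb b) (fun a b => z a *m zb b).
apply: (etrans _ (esym (f_equal2 +%R (f_equal2 +%R E1 E2) (f_equal2 +%R E3 E4)))).
apply: (etrans _ (sum4 _ _ _ _)); apply: eq_bigr => i _.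
apply: (etrans _ (sum4 _ _ _ _)); apply: eq_bigr => j _.
apply: (etrans _ (scaler4 _ _ _ _ _)); congr (_ *: _).
rewrite {1}(C_frame i) mulmx_suml.
apply: (etrans _ (sum4 _ _ _ _)); apply: eq_bigr => a _.
rewrite {1}(C_frame j) mulmx_sumr.
apply: (etrans _ (sum4 _ _ _ _)); apply: eq_bigr => b _.
move: (z a) (zb a) (z b) (zb b) => x xb y yb.
rewrite mulmxDl !mulmxDr -!scalemxAl -!scalemxAr !scalerA.
have aux (p q r s : 'M[K]_N) : p + q + (r + s) = p + s + (r + q).
  by apply/matrixP => k l; rewrite !mxE; ring.
exact: aux.
Qed.

Lemma AzzE (B : 'I_n -> 'I_n -> K) : (forall a b, B a b = B b a) ->
  \sum_a \sum_b B a b *: (z a *m z b) = 0.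
Proof. by move=> sB; apply: sym_antisym_sum => // a b; exact: zzC. Qed.

Lemma AzbzbE (B : 'I_n -> 'I_n -> K) : (forall a b, B a b = B b a) ->
  \sum_a \sum_b B a b *: (zb a *m zb b) = 0.
Proof. by move=> sB; apply: sym_antisym_sum => // a b; exact: zbzbC. Qed.

Let Y b := \sum_q A b q *: z q.
Let Yb a := \sum_q conjc (A a q) *: zb q.

Lemma sum_Yz : \sum_b Y b *m z b = 0.
Proof.
apply: (etrans _ (AzzE A_sym)); rewrite [RHS]exchange_big; apply: eq_bigr => b _ /=.
by rewrite mulmx_suml; apply: eq_bigr => q _; rewrite -scalemxAl A_sym.
Qed.

Lemma sum_zY : \sum_a z a *m Y a = 0.
Proof.
apply: (etrans _ (AzzE A_sym)); apply: eq_bigr => a _.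
by rewrite mulmx_sumr; apply: eq_bigr => q _; rewrite -scalemxAr.
Qed.

Lemma cA_sym a b : conjc (A a b) = conjc (A b a). Proof. by rewrite A_sym. Qed.

Lemma sum_Ybzb : \sum_b Yb b *m zb b = 0.
Proof.
apply: (etrans _ (AzbzbE cA_sym)); rewrite [RHS]exchange_big; apply: eq_bigr => b _ /=.
by rewrite mulmx_suml; apply: eq_bigr => q _; rewrite -scalemxAl A_sym.
Qed.

Lemma sum_zbYb : \sum_a zb a *m Yb a = 0.
Proof.
apply: (etrans _ (AzbzbE cA_sym)); apply: eq_bigr => a _.
by rewrite mulmx_sumr; apply: eq_bigr => q _; rewrite -scalemxAr.
Qed.

(** The coefficients have the shape that [Om_tt] and [Om_tbtb] produce. Since the x anticommute,
    both halves of the antisymmetrisation contribute equally, hence the factor 2. *)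
Lemma antisym_pair_sum (x : 'I_n -> 'M[K]_N) (k : K) (f : 'I_n -> K) c :
  (forall a b, x a *m x b = - (x b *m x a)) ->
  \sum_a \sum_b (k * ((c == a)%:R * f b - (c == b)%:R * f a)) *: (x a *m x b) =
  (2 * k) *: (x c *m \sum_q f q *: x q).
Proof.
move=> xC.
have E1 : \sum_a \sum_b (k * ((c == a)%:R * f b)) *: (x a *m x b) =
    k *: (x c *m \sum_q f q *: x q).
  rewrite (eq_bigr (fun a => (a == c)%:R *: (k *: (x a *m \sum_q f q *: x q)))).
    by rewrite sum_delta.
  move=> a _; rewrite mulmx_sumr !scaler_sumr; apply: eq_bigr => b _.
  rewrite -scalemxAr !scalerA eq_sym; congr (_ *: _).
  have aux (p q r : K) : p * (q * r) = q * p * r by ring.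
  exact: aux.
have E2 : \sum_a \sum_b (k * ((c == b)%:R * f a)) *: (x a *m x b) =
    - (k *: (x c *m \sum_q f q *: x q)).
  rewrite -E1 exchange_big /= -sumrN; apply: eq_bigr => b _.
  by rewrite -sumrN; apply: eq_bigr => a _; rewrite xC scalerN.
have aux (p q : 'M[K]_N) : p = k *: q -> forall r, r = - (k *: q) -> p - r = (2 * k) *: q.
  by move=> -> _ ->; apply/matrixP => i j; rewrite !mxE; ring.
apply: (etrans _ (aux _ _ E1 _ E2)).
rewrite -sumrB; apply: eq_bigr => a _; rewrite -sumrB; apply: eq_bigr => b _.
by rewrite -scalerBl -mulrBr.
Qed.

(* Om_tt expresses this part of Om by the symmetric A, whereas the z_a anticommute. *)
Lemma T1_zero : \sum_a \sum_b
  (\sum_r \sum_s (bext (Om a b) (t r) (t s) *: (z r *m z s))) *m G a b = 0.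
Proof.
have E a b : \sum_r \sum_s (bext (Om a b) (t r) (t s) *: (z r *m z s)) =
    (2 * (4 * ii)) *: (z a *m Y b).
  rewrite -(antisym_pair_sum (4 * ii) (A b) a (zzC CR)).
  by apply: eq_bigr => r _; apply: eq_bigr => s _; rewrite Om_tt.
(* The ordering [cG_r] puts [z b] right after [Y b], so that summation over b meets [sum_Yz]; the
   scalar part forces a = b and meets [sum_zY]. *)
transitivity (\sum_a \sum_b (2 * (4 * ii)) *:
   (- (z a *m (Y b *m z b) *m zb a) - (2^-1 * (a == b)%:R) *: (z a *m Y b))).
  apply: eq_bigr => a _; apply: eq_bigr => b _.
  have aux (x y w v S' G' : 'M[K]_N) (k p : K) : S' = k *: (x *m y) ->
      G' = - (w *m v) - p%:M ->
      S' *m G' = k *: (- (x *m (y *m w) *m v) - p *: (x *m y)).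
    by move=> -> ->; rewrite -scalemxAl mulmxBr mulmxN mul_mx_scalar !mulmxA.
  exact: aux (E a b) (cG_r CR a b).
transitivity ((2 * (4 * ii)) *: (- (\sum_a z a *m (\sum_b Y b *m z b) *m zb a)
    - 2^-1 *: \sum_a z a *m Y a)).
  rewrite scaler_sumr -sumrN -sumrB scaler_sumr; apply: eq_bigr => a _.
  rewrite -scaler_sumr sumrB sumrN; congr (_ *: (- _ - _)).
    by rewrite mulmx_sumr mulmx_suml.
  rewrite (eq_bigr (fun b => (b == a)%:R *: (2^-1 *: (z a *m Y b)))).
    by rewrite sum_delta.
  by move=> b _; rewrite scalerA mulrC eq_sym.
rewrite sum_Yz sum_zY big1 => [|a _]; first by rewrite scaler0 oppr0 addr0 scaler0.
by rewrite mulmx0 mul0mx.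
Qed.

(** Mirror image of [T1_zero]: the symmetric factor is now conj A, and the ordering [cG_l] brings
    [zb a] next to [Yb a]. *)
Lemma T2_zero : \sum_a \sum_b
  (\sum_r \sum_s (bext (Om a b) (tb r) (tb s) *: (zb r *m zb s))) *m G a b = 0.
Proof.
have E a b : \sum_r \sum_s (bext (Om a b) (tb r) (tb s) *: (zb r *m zb s)) =
    (2 * (4 * ii)) *: (zb b *m Yb a).
  rewrite -(antisym_pair_sum (4 * ii) (fun q => conjc (A a q)) b (zbzbC CR)).
  by apply: eq_bigr => r _; apply: eq_bigr => s _; rewrite Om_tbtb.
transitivity (\sum_a \sum_b (2 * (4 * ii)) *:
   (zb b *m (Yb a *m zb a) *m z b + (2^-1 * (a == b)%:R) *: (zb b *m Yb a))).
  apply: eq_bigr => a _; apply: eq_bigr => b _.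
  have aux (x y w v S' G' : 'M[K]_N) (k p : K) : S' = k *: (x *m y) ->
      G' = w *m v + p%:M ->
      S' *m G' = k *: (x *m (y *m w) *m v + p *: (x *m y)).
    by move=> -> ->; rewrite -scalemxAl mulmxDr mul_mx_scalar !mulmxA.
  exact: aux (E a b) (cG_l CR a b).
rewrite exchange_big /=.
transitivity ((2 * (4 * ii)) *: (\sum_b zb b *m (\sum_a Yb a *m zb a) *m z b
    + 2^-1 *: \sum_b zb b *m Yb b)).
  rewrite scaler_sumr -big_split scaler_sumr; apply: eq_bigr => b _ /=.
  rewrite -scaler_sumr big_split /=; congr (_ *: (_ + _)).
    by rewrite mulmx_sumr mulmx_suml.
  rewrite (eq_bigr (fun a => (a == b)%:R *: (2^-1 *: (zb b *m Yb a)))).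
    by rewrite sum_delta.
  by move=> a _; rewrite scalerA mulrC.
rewrite sum_Ybzb sum_zbYb big1 => [|a _]; first by rewrite scaler0 addr0 scaler0.
by rewrite mulmx0 mul0mx.
Qed.

(** Normal ordering with all conj z on the left: moving z_s past conj z_a produces the term with s =
    a, and the half traces of [cG_l] produce the last three terms. *)
Lemma GG_expand r s a b : G r s *m G a b =
  - ((zb r *m zb a) *m (z s *m z b)) - (s == a)%:R *: (zb r *m z b) +
  (2^-1 * (a == b)%:R) *: (zb r *m z s) + (2^-1 * (r == s)%:R) *: (zb a *m z b) +
  (4^-1 * ((r == s)%:R * (a == b)%:R))%:M.
Proof.
have aux1 (x y x' y' : 'M[K]_N) (p : K) : y *m x' = - (x' *m y) + (- p)%:M ->
    x *m y *m (x' *m y') = - (x *m x' *m (y *m y')) - p *: (x *m y').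
  move=> h; rewrite mulmxA -(mulmxA x y x') h mulmxDr mulmxDl.
  by rewrite mul_mx_scalar -scalemxAl mulmxN mulNmx scaleNr !mulmxA.
have E := aux1 (zb r) _ _ (z b) _ (zzbC CR s a).
have gen (x y : 'M[K]_N) (p q : K) : (x + p%:M) *m (y + q%:M) =
    x *m y + q *: x + p *: y + (p * q)%:M.
  rewrite mulmxDl !mulmxDr mul_mx_scalar !mul_scalar_mx scale_scalar_mx.
  by rewrite !addrA.
rewrite (cG_l CR r s) (cG_l CR a b) gen E; congr (_ + _%:M).
have aux (h p q : K) : h * h = 4^-1 -> h * p * (h * q) = 4^-1 * (p * q).
  by move=> <-; ring.
by apply: aux; field.
Qed.

Let Q := \sum_a \sum_r \sum_b Rc a b r a *: (zb r *m z b).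

(* The quartic terms of GG_expand cancel as Rc is symmetric in a, r while the zb_a
   anticommute; the symmetries of Rc identify the quadratic terms with Q, up to
   factors adding up to 0. *)
Lemma T3_value : \sum_a \sum_b (\sum_r \sum_s Rc a b r s *: G r s) *m G a b =
  (\sum_a \sum_g 4^-1 * Rc g g a a)%:M.
Proof.
pose S1 := \sum_a \sum_b \sum_r \sum_s Rc a b r s *: ((zb r *m zb a) *m (z s *m z b)).
pose S2 := \sum_a \sum_b \sum_r \sum_s Rc a b r s *: ((s == a)%:R *: (zb r *m z b)).
pose S3 := \sum_a \sum_b \sum_r \sum_s Rc a b r s *: ((2^-1 * (a == b)%:R) *: (zb r *m z s)).
pose S4 := \sum_a \sum_b \sum_r \sum_s Rc a b r s *: ((2^-1 * (r == s)%:R) *: (zb a *m z b)).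
pose S5 := \sum_a \sum_b \sum_r \sum_s
  Rc a b r s *: (4^-1 * ((r == s)%:R * (a == b)%:R))%:M : 'M[K]_N.
have -> : \sum_a \sum_b (\sum_r \sum_s Rc a b r s *: G r s) *m G a b =
    - S1 - S2 + S3 + S4 + S5.
  rewrite /S1 /S2 /S3 /S4 /S5 -sumrN -sumrB -!big_split; apply: eq_bigr => a _ /=.
  rewrite -sumrN -sumrB -!big_split; apply: eq_bigr => b _ /=.
  rewrite mulmx_suml -sumrN -sumrB -!big_split; apply: eq_bigr => r _ /=.
  rewrite mulmx_suml -sumrN -sumrB -!big_split; apply: eq_bigr => s _ /=.
  by rewrite -scalemxAl GG_expand !scalerDr !scalerN.
have -> : S1 = 0.
  rewrite /S1 exchange_big big1 // => b _ /=.
  rewrite (eq_bigr (fun a => \sum_s \sum_r Rc a b r s *: ((zb r *m zb a) *m (z s *m z b)))).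
    rewrite exchange_big big1 // => s _ /=.
    transitivity ((\sum_a \sum_r Rc a b r s *: (zb r *m zb a)) *m (z s *m z b)).
      rewrite mulmx_suml; apply: eq_bigr => a _; rewrite mulmx_suml.
      by apply: eq_bigr => r _; rewrite -scalemxAl.
    rewrite sym_antisym_sum ?mul0mx // => a r; first exact: Rc_sym.
    exact: zbzbC.
  by move=> a _; exact: exchange_big.
have -> : S2 = Q.
  apply: eq_bigr => a _; rewrite exchange_big; apply: eq_bigr => r _ /=.
  apply: eq_bigr => b _.
  rewrite (eq_bigr (fun s => (s == a)%:R *: (Rc a b r s *: (zb r *m z b)))).
    by rewrite sum_delta.
  by move=> s _; rewrite !scalerA mulrC.
have -> : S3 = 2^-1 *: Q.
  rewrite scaler_sumr; apply: eq_bigr => a _.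
  rewrite (eq_bigr (fun b => (b == a)%:R *: (2^-1 *: \sum_r \sum_s Rc a b r s *: (zb r *m z s)))).
    rewrite sum_delta; congr (_ *: _); apply: eq_bigr => r _; apply: eq_bigr => s _.
    by rewrite Rc_sym2.
  move=> b _; rewrite scalerA scaler_sumr; apply: eq_bigr => r _.
  rewrite scaler_sumr; apply: eq_bigr => s _; rewrite !scalerA mulrC eq_sym.
  by rewrite [2^-1 * _]mulrC.
have -> : S4 = 2^-1 *: Q.
  transitivity (2^-1 *: \sum_a \sum_b \sum_r Rc r b a r *: (zb a *m z b)).
    rewrite scaler_sumr; apply: eq_bigr => a _; rewrite scaler_sumr; apply: eq_bigr => b _.
    rewrite scaler_sumr; apply: eq_bigr => r _.
    rewrite (eq_bigr (fun s => (s == r)%:R *: (2^-1 *: (Rc a b r s *: (zb a *m z b))))).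
      by rewrite sum_delta Rc_sym.
    move=> s _; rewrite !scalerA eq_sym; congr (_ *: _).
    have aux (x y h : K) : x * (h * y) = y * h * x by ring.
    exact: aux.
  apply: (f_equal (fun x => 2^-1 *: x)).
  transitivity (\sum_a \sum_r \sum_b Rc r b a r *: (zb a *m z b)).
    by apply: eq_bigr => a _; exact: exchange_big.
  exact: exchange_big.
(* The product of the two half traces. As [Rc] is 4 times the Webster curvature, the coefficient
   [4^-1] makes it exactly the scalar curvature. *)
have -> : S5 = (\sum_a \sum_g 4^-1 * Rc g g a a)%:M.
  transitivity (\sum_a \sum_r (4^-1 * Rc a a r r)%:M : 'M[K]_N).
    apply: eq_bigr => a _.
    rewrite (eq_bigr (fun b => (b == a)%:R *:
        (\sum_r \sum_s (s == r)%:R *: (4^-1 * Rc a b r s)%:M))).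
      by rewrite sum_delta; apply: eq_bigr => r _; rewrite sum_delta.
    move=> b _; rewrite scaler_sumr; apply: eq_bigr => r _.
    rewrite scaler_sumr; apply: eq_bigr => s _.
    rewrite !scale_scalar_mx [b == a]eq_sym [s == r]eq_sym; congr (_%:M).
    have aux (x y v h : K) : x * (h * (y * v)) = v * (y * (h * x)) by ring.
    exact: aux.
  rewrite [X in _ = X%:M]exchange_big (raddf_sum (@scalar_mx K N)) /=.
  apply: eq_bigr => a _; exact: esym (raddf_sum (@scalar_mx K N) _ _ _).
have aux (q x : 'M[K]_N) : - 0 - q + 2^-1 *: q + 2^-1 *: q + x = x.
  by apply/matrixP => i j; rewrite !mxE; field.
exact: aux.
Qed.

(** The parts of type (2,0) and (0,2) vanish, and the outer [2^-1] meets the 2 that [sum_CC] puts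
    before the (1,1) part, so the value found in [T3_value] enters with coefficient 1. *)
Lemma curvature_term :
  2^-1 *: \sum_i \sum_j (C i *m C j *m \sum_a \sum_b Om a b i j *: G a b) =
  (\sum_a \sum_g 4^-1 * Rc g g a a)%:M.
Proof.
have -> : \sum_i \sum_j (C i *m C j *m \sum_a \sum_b Om a b i j *: G a b) =
    \sum_a \sum_b (\sum_i \sum_j Om a b i j *: (C i *m C j)) *m G a b.
  transitivity (\sum_i \sum_a \sum_b \sum_j (Om a b i j *: (C i *m C j)) *m G a b).
    apply: eq_bigr => i _.
    transitivity (\sum_j \sum_a \sum_b (Om a b i j *: (C i *m C j)) *m G a b).
      apply: eq_bigr => j _; rewrite mulmx_sumr; apply: eq_bigr => a _.
      rewrite mulmx_sumr; apply: eq_bigr => b _.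
      by rewrite -scalemxAl -scalemxAr.
    rewrite exchange_big; apply: eq_bigr => a _; exact: exchange_big.
  rewrite exchange_big; apply: eq_bigr => a _ /=.
  rewrite exchange_big; apply: eq_bigr => b _ /=.
  rewrite mulmx_suml; apply: eq_bigr => i _.
  by rewrite mulmx_suml.
have E a b : (\sum_i \sum_j Om a b i j *: (C i *m C j)) *m G a b =
    (\sum_r \sum_s (bext (Om a b) (t r) (t s) *: (z r *m z s))) *m G a b +
    (\sum_r \sum_s (bext (Om a b) (tb r) (tb s) *: (zb r *m zb s))) *m G a b +
    2 *: ((\sum_r \sum_s Rc a b r s *: G r s) *m G a b).
  by rewrite (sum_CC (OmC a b)) !mulmxDl -scalemxAl.
transitivity (2^-1 *: (\sum_a \sum_b
    ((\sum_r \sum_s (bext (Om a b) (t r) (t s) *: (z r *m z s))) *m G a b +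
    (\sum_r \sum_s (bext (Om a b) (tb r) (tb s) *: (zb r *m zb s))) *m G a b +
    2 *: ((\sum_r \sum_s Rc a b r s *: G r s) *m G a b)))).
  apply: (f_equal (fun x => 2^-1 *: x)); apply: eq_bigr => a _.
  by apply: eq_bigr => b _; exact: E.
have split3 (F1 F2 F3 : 'I_n -> 'I_n -> 'M[K]_N) :
    \sum_a \sum_b (F1 a b + F2 a b + 2 *: F3 a b) =
    \sum_a \sum_b F1 a b + \sum_a \sum_b F2 a b + 2 *: \sum_a \sum_b F3 a b.
  rewrite scaler_sumr -!big_split; apply: eq_bigr => a _ /=.
  by rewrite scaler_sumr -!big_split.
have aux (x y v : 'M[K]_N) : x = 0 -> y = 0 -> 2^-1 *: (x + y + 2 *: v) = v.
  by move=> -> ->; rewrite !add0r scalerA mulVf ?two_neq0 // scale1r.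
apply: (etrans _ T3_value).
apply: (etrans _ (aux _ _ _ T1_zero T2_zero)).
exact: (f_equal (fun x => 2^-1 *: x) (split3 _ _ _)).
Qed.

End CurvatureTerm.

(** * Spin frames *)

Section SpinGroup.
Context {R : realType} {k N : nat}.
Local Notation K := R[i].
Variable c : 'I_k -> 'M[K]_N.
Hypothesis CR : clifford_relations c.

Lemma clifford_vec_lin n (a : 'I_n -> R) (v : 'I_n -> 'I_k -> R) :
  clifford_vec c (fun d => \sum_i a i * v i d) =
  \sum_i (a i)%:C%C *: clifford_vec c (v i).
Proof.
rewrite /clifford_vec; under [RHS]eq_bigr do rewrite scaler_sumr.
rewrite exchange_big; apply: eq_bigr => d _ /=.
rewrite (rmorph_sum (real_complex R)) scaler_suml; apply: eq_bigr => i _.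
by rewrite scalerA (rmorphM (real_complex R)).
Qed.

Lemma clifford_vec_ac v b : clifford_vec c v *m c b + c b *m clifford_vec c v =
  (- 2 * (v b)%:C%C)%:M.
Proof.
rewrite /clifford_vec mulmx_suml mulmx_sumr -big_split /=.
rewrite (bigD1 b) //= -scalemxAl -scalemxAr -scalerDr CR eqxx mulr1.
rewrite scale_scalar_mx mulrC big1 ?addr0 // => a ab.
rewrite -scalemxAl -scalemxAr -scalerDr CR (negbTE ab) mulr0.
by rewrite (raddf0 (@scalar_mx K N)) scaler0.
Qed.

Lemma clifford_vec_sq v : clifford_vec c v *m clifford_vec c v =
  (- (\sum_a v a ^+ 2)%:C%C)%:M.
Proof.
set X := clifford_vec c v.
have E : X *m X + X *m X = (- 2 * (\sum_a v a ^+ 2)%:C%C)%:M.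
  transitivity (\sum_b (v b)%:C%C *: (X *m c b + c b *m X)).
    under eq_bigr do rewrite scalerDr.
    have l (Y : 'M[K]_N) : Y *m X = \sum_b (v b)%:C%C *: (Y *m c b).
      by rewrite mulmx_sumr; apply: eq_bigr => b _; rewrite -scalemxAr.
    have r (Y : 'M[K]_N) : X *m Y = \sum_b (v b)%:C%C *: (c b *m Y).
      by rewrite mulmx_suml; apply: eq_bigr => b _; rewrite -scalemxAl.
    by rewrite big_split /= -l -r.
  rewrite (rmorph_sum (real_complex R)) mulr_sumr (raddf_sum (@scalar_mx K N)).
  apply: eq_bigr => b _; rewrite clifford_vec_ac scale_scalar_mx; congr (_%:M).
  by rewrite (rmorphXn (real_complex R)) expr2 mulrCA.
rewrite -[LHS]half_half E scale_scalar_mx; congr (_%:M).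
by rewrite mulrA mulrN mulVf ?mulN1r // pnatr_eq0.
Qed.

(** Induction over the unit vectors whose product is g: each is invertible, having square -1, and
    conjugation by it preserves the real span of the [c b]. *)
Lemma spin_cover_exists g : Spin c g -> g \in unitmx /\ exists A, spin_cover c g A.
Proof.
move=> [s [_ us ->]] {g}.
suff [ug [A hA]] : foldr (fun v h => clifford_vec c v *m h) 1%:M s \in unitmx /\
    exists A : 'M[R]_k, forall a, foldr (fun v h => clifford_vec c v *m h) 1%:M s *m c a =
      clifford_vec c (fun b => A b a) *m foldr (fun v h => clifford_vec c v *m h) 1%:M s.
  by split => //; exists A => a; rewrite hA mulmxK.
elim: s us => [|v s IH] us /=.
  split; first exact: unitmx1.
  exists 1%:M => a; rewrite mul1mx mulmx1 /clifford_vec (bigD1 a) //= mxE eqxx scale1r.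
  by rewrite big1 ?addr0 // => b /negbTE ba; rewrite mxE ba scale0r.
have [uh [A hA]] : _ := IH (fun i => us i.+1).
have v1 : \sum_a v a ^+ 2 = 1 by exact: (us 0%N).
have vv : clifford_vec c v *m clifford_vec c v = - 1%:M.
  by rewrite clifford_vec_sq v1 (raddfN (@scalar_mx K N)).
have uv : clifford_vec c v \in unitmx.
  have : clifford_vec c v *m - clifford_vec c v = 1%:M by rewrite mulmxN vv opprK.
  by move=> /mulmx1_unit [].
split; first by rewrite unitmx_mul uv.
set h := foldr _ _ _ in uh hA *.
(* The image of e_b under minus the reflection in the hyperplane orthogonal to v: as v v = -1, the
   relation v c_b + c_b v = - 2 v_b reads v c_b = (2 v_b v - c_b) v. *)
pose rho b d := 2 * v b * v d - (b == d)%:R.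
have refl b : clifford_vec c v *m c b = clifford_vec c (rho b) *m clifford_vec c v.
  have -> : clifford_vec c (rho b) = (2 * v b)%:C%C *: clifford_vec c v - c b.
    rewrite /clifford_vec scaler_sumr /rho.
    transitivity (\sum_a ((2 * v b)%:C%C *: ((v a)%:C%C *: c a) - (a == b)%:R *: c a)).
      apply: eq_bigr => a _.
      rewrite (rmorphB (real_complex R)) scalerBl (rmorphM (real_complex R)) scalerA.
      by rewrite eq_sym; case: (a == b).
    by rewrite sumrB sum_delta.
  rewrite mulmxBl -scalemxAl vv (rmorphM (real_complex R)).
  have aux (x y : 'M[K]_N) (p : K) : x + y = (- 2 * p)%:M -> x = (2 * p) *: - 1%:M - y.
    move=> E; rewrite -[x](addrK y) E; congr (_ - _).
    by rewrite scalerN scale_scalar_mx mulr1 mulNr (raddfN (@scalar_mx K N)).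
  rewrite (rmorph_nat (real_complex R) 2).
  exact: aux (clifford_vec_ac v b).
exists (\matrix_(d, a) \sum_b A b a * rho b d) => a.
rewrite -mulmxA hA mulmxA.
have -> : clifford_vec c v *m clifford_vec c (fun b => A b a) =
    clifford_vec c (fun d => \sum_b A b a * rho b d) *m clifford_vec c v.
  rewrite clifford_vec_lin [RHS]mulmx_suml [clifford_vec c (A^~ a)]/clifford_vec mulmx_sumr.
    apply: eq_bigr => b _.
  by rewrite -scalemxAr refl scalemxAl.
rewrite mulmxA; congr (clifford_vec c _ *m _ *m _).
by apply/funext => d; rewrite mxE.
Qed.

End SpinGroup.

Lemma frame_actM {R : realType} {n : nat} (E : 'I_(n + n) -> 'rV[R]_(n + n).+1)
    (A B : 'M[R]_(n + n)) :
  frame_act (frame_act E A) B = frame_act E (A *m B).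
Proof.
apply/funext => a; rewrite /frame_act.
under eq_bigr do rewrite scaler_sumr.
rewrite exchange_big; apply: eq_bigr => b _ /=.
by rewrite mxE scaler_suml; apply: eq_bigr => d _; rewrite scalerA mulrC.
Qed.

Lemma orthogonal_sum {R : realType} k (A : 'M[R]_k) (x : 'I_k -> R) d :
  A *m A^T = 1%:M -> \sum_a (\sum_b A b a * x b) * A d a = x d.
Proof.
move=> AA; pose X : 'rV[R]_k := \row_b x b.
have := f_equal (fun Z : 'M[R]_k => (X *m Z) 0 d) AA.
rewrite mulmx1 mulmxA mxE [RHS]mxE => <-.
apply: eq_bigr => a _; rewrite !mxE; congr (_ * _).
by apply: eq_bigr => b _; rewrite !mxE mulrC.
Qed.

Section SpinFrames.
Context {R : realType} {n N : nat} {M : topologicalType}.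
Local Notation m := (n + n).+1.
Local Notation K := R[i].
Local Notation I := ('I_(n + n)).
Variables (mfd : manifold R m M) (ph : pseudohermitian mfd).
Variable c : I -> 'M[K]_N.
Hypothesis CR : clifford_relations c.
Variable S : spin_structure ph c.
Local Notation P := (spin_total S).
Local Notation pr := (@spin_pr _ _ _ _ _ _ _ S).
Local Notation fr := (@spin_fr _ _ _ _ _ _ _ S).
Local Notation act := (@spin_act _ _ _ _ _ _ _ S).
Local Notation metric := (levi mfd (theta ph) (J ph)).

Lemma fr_orthonormal (p : P) : Defs.orthonormal ph (pr p) (fr p).
Proof. by have [] := spin_fr_SO p. Qed.

Lemma metric_frame_act p E (A B : 'M[R]_(n + n)) a b :
  Defs.orthonormal ph p E ->
  metric p (frame_act E A a) (frame_act E B b) = (A^T *m B) a b.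
Proof.
move=> [E0 E1]; rewrite /frame_act.
rewrite (lin_sum _ _ (fun k u v => metric_lin ph p k u v _)) mxE.
apply: eq_bigr => i _; rewrite mxE; congr (_ * _).
rewrite (lin_sum _ _ (fun k u v => metric_linr ph p k u v _)).
rewrite (bigD1 i) //= E1 eqxx mulr1 big1 ?addr0 // => j /negbTE ji.
by rewrite E1 eq_sym ji mulr0.
Qed.

Lemma frame_act_orthogonal p E (A : 'M[R]_(n + n)) :
  Defs.orthonormal ph p E -> Defs.orthonormal ph p (frame_act E A) ->
  A *m A^T = 1%:M.
Proof.
move=> oE [_ oA]; apply: mulmx1C; apply/matrixP => a b.
by rewrite -(metric_frame_act _ _ _ _ oE) oA mxE.
Qed.

Lemma clifford_vec_conj (g : 'M[K]_N) (A : 'M[R]_(n + n)) (x : I -> R) :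
  Spin c g -> spin_cover c g A -> A *m A^T = 1%:M ->
  clifford_vec c (fun a => \sum_b A b a * x b) =
  invmx g *m clifford_vec c x *m g.
Proof.
move=> sg hA AA; have [ug _] := spin_cover_exists CR sg.
have E : clifford_vec c x *m g =
    g *m clifford_vec c (fun a => \sum_b A b a * x b).
  rewrite [in RHS]/clifford_vec mulmx_sumr.
  rewrite (_ : clifford_vec c x = clifford_vec c (fun d =>
    \sum_a (\sum_b A b a * x b) * A d a)); last first.
    by congr clifford_vec; apply/funext => d; rewrite orthogonal_sum.
  rewrite clifford_vec_lin [LHS]mulmx_suml; apply: eq_bigr => a _.
  by rewrite -hA -scalemxAl mulmxKV // scalemxAr.
by rewrite -mulmxA E mulmxA mulVmx // mul1mx.
Qed.

Lemma spin_cover_orthogonal (p : P) g A : Spin c g -> spin_cover c g A ->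
  A *m A^T = 1%:M.
Proof.
move=> sg hA; apply: (frame_act_orthogonal (fr_orthonormal p)).
rewrite -(spin_fr_act p sg hA).
by have := fr_orthonormal (act p g); rewrite spin_pr_act.
Qed.

(** This matches the equivariance of spinors, so that Clifford multiplication, computed on
    components, is independent of the spin frame. *)
Lemma cliff_act (p : P) g v : Spin c g ->
  cliff (act p g) v = invmx g *m cliff p v *m g.
Proof.
move=> sg; have [ug [A hA]] := spin_cover_exists CR sg.
have AA := spin_cover_orthogonal p sg hA.
apply: (etrans _ (clifford_vec_conj (fun b => metric (pr p) v (fr p b)) sg hA AA)).
apply: (f_equal (clifford_vec c)); apply/funext => a.
rewrite spin_pr_act // (spin_fr_act p sg hA).
exact: (lin_sum _ _ (fun k u v' => metric_linr ph (pr p) k u v' v)).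
Qed.

End SpinFrames.

Lemma continuous_within_comp {X Y Z : topologicalType} (A : set X) (B : set Y)
    (f : X -> Y) (g : Y -> Z) : {within A, continuous f} ->
  {within B, continuous g} -> (forall x, A x -> B (f x)) ->
  {within A, continuous (fun x => g (f x))}.
Proof.
move=> /subspace_continuousP cf /subspace_continuousP cg AB.
apply/subspace_continuousP => x Ax W hW.
have hg : nbhs (f x) [set y | B y -> W (g y)] by exact: (cg _ (AB x Ax) W hW).
have hf : nbhs x [set x' | A x' -> B (f x') -> W (g (f x'))].
  exact: (cf x Ax _ hg).
change (nbhs x [set x' | A x' -> W (g (f x'))]).
by apply: filterS hf => x' /= h Ax'; apply: h => //; exact: AB.
Qed.

(** * Local spin frames and the spin connection *)

Section LocalSpinFrames.
Context {R : realType} {n N : nat} {M : topologicalType}.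
Local Notation m := (n + n).+1.
Local Notation K := R[i].
Local Notation I := ('I_(n + n)).
Variables (mfd : manifold R m M) (ph : pseudohermitian mfd).
Variable c : I -> 'M[K]_N.
Hypothesis CR : clifford_relations c.
Variable S : spin_structure ph c.
Local Notation P := (spin_total S).
Local Notation pr := (@spin_pr _ _ _ _ _ _ _ S).
Local Notation fr := (@spin_fr _ _ _ _ _ _ _ S).
Local Notation act := (@spin_act _ _ _ _ _ _ _ S).
Local Notation metric := (levi mfd (theta ph) (J ph)).
Variables (U : set M) (e : I -> M -> 'rV[R]_m).
Hypothesis oU : open U.
Hypothesis he : local_adapted_frame ph U e.

(** Clifford multiplication by e_i in a spin frame over e A: for orthogonal A, the vector e_i has
    components [A i] in the frame e A. *)
Definition rotC (A : 'M[R]_(n + n)) (i : I) := clifford_vec c (A i).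

Lemma rotC_relations A : A *m A^T = 1%:M -> clifford_relations (rotC A).
Proof.
move=> AA i j; rewrite /rotC.
have E : clifford_vec c (A j) = \sum_b (A j b)%:C%C *: c b by [].
rewrite E mulmx_sumr mulmx_suml -big_split /=.
transitivity (\sum_b (A j b)%:C%C *: ((- 2 * (A i b)%:C%C)%:M : 'M[K]_N)).
  apply: eq_bigr => b _.
  by rewrite -scalemxAr -scalemxAl -scalerDr clifford_vec_ac.
under eq_bigr do rewrite scale_scalar_mx.
rewrite -(raddf_sum (@scalar_mx K N)); congr (_%:M).
have := f_equal (fun Z : 'M[R]_(n + n) => (Z i j)%:C%C) AA.
rewrite !mxE (rmorph_nat (real_complex R)) => <-.
rewrite (rmorph_sum (real_complex R)) mulr_sumr; apply: eq_bigr => b _.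
by rewrite mxE (rmorphM (real_complex R)) mulrCA [X in _ * X]mulrC.
Qed.

Definition adapted_spin_frame (V : set M) (A : 'M[R]_(n + n)) (s : M -> P) :=
  [/\ open V, V `<=` U, {within V, continuous s} &
      forall y, V y -> pr (s y) = y /\ fr (s y) = frame_act (e ^~ y) A].

Let oE q : U q -> Defs.orthonormal ph q (e ^~ q).
Proof. by case: he => _ h /h []. Qed.

Lemma adapted_spin_frame_orthogonal V A s x : adapted_spin_frame V A s -> V x ->
  A *m A^T = 1%:M.
Proof.
move=> [_ VU _ h] Vx; have [px fx] := h x Vx.
apply: (frame_act_orthogonal (oE (VU _ Vx))); rewrite -fx -{1}px.
exact: fr_orthonormal.
Qed.

Lemma adapted_spin_frame_local V A s : adapted_spin_frame V A s ->
  local_spin_frame V (fun a q => frame_act (e ^~ q) A a) s.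
Proof.
move=> [oV VU cs h]; split=> //; split.
  move=> a; apply: (smooth_vf_sum (fun b => A b a) oV) => b.
  by apply: (smooth_vf_subset VU); case: he.
move=> q Vq; have [pq fq] := h q Vq.
have := spin_fr_SO (s q); rewrite pq fq; exact.
Qed.

Lemma local_SO_frame_adapted : local_SO_frame ph U e.
Proof.
split; first by case: he.
move=> q Uq; split; first exact: oE.
exists (e ^~ q), 1%:M; split; first by case: he => _; apply.
  by rewrite det1 ltr01.
apply/funext => a; rewrite /frame_act (bigD1 a) //= mxE eqxx scale1r.
by rewrite big1 ?addr0 // => b /negbTE ba; rewrite mxE ba scale0r.
Qed.

Lemma frame_act_metric q E : U q -> Defs.orthonormal ph q E ->
  E = frame_act (e ^~ q) (\matrix_(b, a) metric q (E a) (e b q)).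
Proof.
move=> Uq [E0 _]; apply/funext => a.
rewrite [LHS](orthonormal_expand (oE Uq)) E0 scale0r add0r.
by rewrite /frame_act; apply: eq_bigr => b _; rewrite mxE.
Qed.

(** Let A be the matrix of [fr p] in the frame [e]. The covering has local inverses near the image
    of p; the one through p, restricted to the slice of pairs (y, A) with A fixed, is the desired
    section. *)
Lemma spin_frame_through p : U (pr p) ->
  exists V A s, [/\ adapted_spin_frame V A s, V (pr p) & s (pr p) = p].
Proof.
move=> Up; have := spin_fr_covering S oU local_SO_frame_adapted.
set h := fun p : P => (pr p, \matrix_(b, a) metric (pr p) (fr p a) (e b (pr p))).
move=> [hB _ hO]; have [B [s [oB Bp cs hs [_ _ sec]]]] := hO _ (hB p Up).
have [i pi] := sec p Up Bp.
set A := (h p).2; have SA : SO A by have [] := hB p Up.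
have cA (y : M) : (fun q : M => (q, A)) @ nbhs y --> nbhs (y, A).
  by apply: (@cvg_pair _ _ _ _ (nbhs y) (nbhs A)); [exact: cvg_id | exact: cvg_cst].
exists (U `&` [set y | B (y, A)]), A, (fun y => s i (y, A)); split => //.
split.
- apply: openI => //; apply: (@open_comp _ _ (fun q : M => (q, A))) => // y _.
  exact: cA.
- by move=> y [].
- apply: (@continuous_within_comp _ _ _ _ _ (fun y => (y, A)) (s i) _ (cs i)).
    by apply: continuous_subspaceT => y; exact: cA.
  by move=> y [Uy Oy].
- move=> y [Uy Oy]; have [Us hsy] := hs i (y, A) Oy (conj Uy SA).
  have [py Ay] : pr (s i (y, A)) = y /\ (h (s i (y, A))).2 = A.
    by split; [exact: (f_equal fst hsy) | exact: (f_equal snd hsy)].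
  have F : fr (s i (y, A)) = frame_act (e ^~ (pr (s i (y, A)))) (h (s i (y, A))).2.
    exact: frame_act_metric Us (fr_orthonormal _).
  by split; [exact: py | move: F; rewrite Ay py].
Qed.

Lemma adapted_spin_frame_act V A s g : adapted_spin_frame V A s -> Spin c g ->
  exists2 B, spin_cover c g B & adapted_spin_frame V (A *m B) (fun y => act (s y) g).
Proof.
move=> [oV VU cs h] sg; have [ug [B hB]] := spin_cover_exists CR sg.
exists B => //; split=> //.
- apply: (@continuous_within_comp _ _ _ _ _ (fun y => (s y, g))
    (fun z => act z.1 z.2) _ (@spin_act_continuous _ _ _ _ _ _ _ S)) => //.
  apply: (@continuous_within_comp _ _ _ _ setT _ (fun p => (p, g)) cs) => //.
  apply: continuous_subspaceT => p.
  by apply: (@cvg_pair _ _ _ _ (nbhs p) (nbhs g)); [exact: cvg_id | exact: cvg_cst].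
- move=> y Vy; have [py fy] := h y Vy.
  by rewrite spin_pr_act // (spin_fr_act (s y) sg hB) fy frame_actM.
Qed.

Lemma cliff_frame V A s y i : adapted_spin_frame V A s -> V y ->
  cliff (s y) (e i y) = rotC A i.
Proof.
move=> [_ VU _ h] Vy; have [py fy] := h y Vy; rewrite /cliff /rotC py fy.
apply: (f_equal (clifford_vec c)); apply/funext => a; rewrite /frame_act.
apply: (etrans (lin_sum _ _ (fun k u v => metric_linr ph y k u v _))).
have [_ E1] := oE (VU _ Vy); rewrite (bigD1 i) //= E1 eqxx mulr1 big1 ?addr0 //.
by move=> b /negbTE bi; rewrite E1 eq_sym bi mulr0.
Qed.

Section Connection.
Variable nab : M -> 'rV[R]_m -> (M -> 'rV[R]_m) -> 'rV[R]_m.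
Hypothesis nab_ph : is_ph_connection ph nab.
Variable nabS : P -> 'rV[R]_m -> (P -> 'cV[K]_N) -> 'cV[K]_N.
Hypothesis nabS_spin : is_spin_connection nab nabS.
Local Notation w := (wfr ph e nab).

Lemma smooth_vfZ (a : R) X : smooth_vf mfd U X -> smooth_vf mfd U (fun q => a *: X q).
Proof.
move=> sX; have := smooth_vf_lin (a - 1) oU sX sX.
rewrite (_ : (fun q => _) = fun q => a *: X q) //.
by apply/funext => q; rewrite scalerBl scale1r subrK.
Qed.

Lemma nab_lin p v (a : R) X Y : U p -> smooth_vf mfd U X -> smooth_vf mfd U Y ->
  nab p v (fun q => a *: X q + Y q) = a *: nab p v X + nab p v Y.
Proof.
move=> Up sX sY; have [nabC _ _] := nab_ph; have [_ nabD nabM _ _] := nabC U oU.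
rewrite (nabD _ _ (smooth_vfZ a sX) sY p Up); congr (_ + _).
rewrite (nabM (fun=> a) _ (smooth_cst mfd U a) sX p Up) der_cst.
by rewrite scale0r add0r.
Qed.

Lemma nab_sum p v (a : I -> R) : U p ->
  nab p v (fun q => \sum_i a i *: e i q) = \sum_i a i *: nab p v (e i).
Proof.
move=> Up.
have se i : smooth_vf mfd U (e i) by case: he.
have sT : smooth_vf mfd U (reeb ph).
  by apply: smooth_vf_subset (reeb_smooth ph).
pose F (r : seq I) q := \sum_(i <- r) a i *: e i q.
(* The zero field is written as a multiple of the smooth Reeb field, so that smoothness and
   linearity of [nab] cover the empty sum as well. *)
have F0 : F [::] = fun q => 0 *: reeb ph q.
  by apply/funext => q; rewrite /F big_nil scale0r.
have Fc i r : F (i :: r) = fun q => a i *: e i q + F r q.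
  by apply/funext => q; rewrite /F big_cons.
have sF r : smooth_vf mfd U (F r).
  elim: r => [|i r IH]; first by rewrite F0; exact: smooth_vfZ.
  by rewrite Fc; exact: (smooth_vf_lin (a i) oU (se i) IH).
suff h r : nab p v (F r) = \sum_(i <- r) a i *: nab p v (e i) by exact: h.
elim: r => [|i r IH]; last by rewrite Fc (nab_lin v (a i) Up (se i) (sF r)) IH big_cons.
have := nab_lin v (-1) Up sT sT.
rewrite (_ : (fun q => _) = F [::]); last first.
  by rewrite F0; apply/funext => q; rewrite scaleN1r addNr scale0r.
by move=> ->; rewrite scaleN1r addNr big_nil.
Qed.

(** As A is constant, nabla (e A) = (nabla e) A, and the two factors A are absorbed by the
    generators [rotC A]. In this form the connection coefficients of the adapted frame enter the
    spin connection. *)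
Lemma cGamma_rotC (A : 'M[R]_(n + n)) x v : U x ->
  4^-1 *: \sum_a \sum_b
    (metric x (nab x v (fun q => frame_act (e ^~ q) A a))
      (frame_act (e ^~ x) A b))%:C%C *: (c a *m c b) =
  cGamma (rotC A) (w x v).
Proof.
move=> Ux; apply: (f_equal (fun Z => 4^-1 *: Z)).
transitivity (\sum_a \sum_b \sum_i \sum_j
    (w x v i j)%:C%C *: (((A i a)%:C%C *: c a) *m ((A j b)%:C%C *: c b))).
  apply: eq_bigr => a _; apply: eq_bigr => b _.
  rewrite (nab_sum v (fun i => A i a) Ux) /frame_act.
  rewrite (lin_sum _ _ (fun k u v' => metric_lin ph x k u v' _)).
  rewrite (rmorph_sum (real_complex R)) scaler_suml; apply: eq_bigr => i _.
  rewrite (lin_sum _ _ (fun k u v' => metric_linr ph x k u v' _)).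
  rewrite mulr_sumr (rmorph_sum (real_complex R)) scaler_suml.
  apply: eq_bigr => j _; rewrite -scalemxAl -scalemxAr !scalerA.
  rewrite (rmorphM (real_complex R) (A i a)) (rmorphM (real_complex R) (A j b)).
  have aux (y1 y2 y3 : K) : y1 * (y2 * y3) = y3 * y1 * y2 by ring.
  exact: (f_equal (fun k => k *: (c a *m c b)) (aux _ _ _)).
under eq_bigr do rewrite exchange_big.
rewrite exchange_big; apply: eq_bigr => i _ /=.
under eq_bigr do rewrite exchange_big.
rewrite exchange_big; apply: eq_bigr => j _ /=.
rewrite /rotC {1}/clifford_vec mulmx_suml scaler_sumr; apply: eq_bigr => a _.
by rewrite /clifford_vec mulmx_sumr scaler_sumr.
Qed.

Lemma nabS_frame V A s psi x v : is_spinor U psi -> adapted_spin_frame V A s ->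
  V x -> nabS (s x) v psi =
  mder mfd v (fun y => psi (s y)) x + cGamma (rotC A) (w x v) *m psi (s x).
Proof.
move=> hpsi as_ Vx; have [oV VU _ _] := as_.
rewrite (nabS_spin oU hpsi oV VU (adapted_spin_frame_local as_) Vx).
congr (_ + _); first by apply/matrixP => k j; rewrite !mxE (ord1 j).
rewrite -cGamma_rotC; last exact: VU.
rewrite -scalemxAl mulmx_suml; congr (_ *: _); apply: eq_bigr => a _.
by rewrite mulmx_suml; apply: eq_bigr => b _; rewrite -scalemxAl.
Qed.

Lemma cGamma_lin (C : I -> 'M[K]_N) (k : R) w1 w2 w3 :
  (forall i j, w1 i j = k * w2 i j + w3 i j) ->
  cGamma C w1 = k%:C%C *: cGamma C w2 + cGamma C w3.
Proof.
move=> h; rewrite /cGamma scalerA mulrC -scalerA -scalerDr.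
apply: (f_equal (fun Z => 4^-1 *: Z)).
rewrite scaler_sumr -big_split; apply: eq_bigr => i _ /=.
rewrite scaler_sumr -big_split; apply: eq_bigr => j _ /=.
by rewrite h (rmorphD (real_complex R)) (rmorphM (real_complex R)) scalerDl scalerA.
Qed.

Lemma cGamma_conj (C : I -> 'M[K]_N) w1 g : g \in unitmx ->
  cGamma (fun i => invmx g *m C i *m g) w1 = invmx g *m cGamma C w1 *m g.
Proof.
move=> ug; rewrite /cGamma -scalemxAr -scalemxAl.
apply: (f_equal (fun Z => 4^-1 *: Z)).
rewrite mulmx_sumr mulmx_suml; apply: eq_bigr => i _.
rewrite mulmx_sumr mulmx_suml; apply: eq_bigr => j _.
rewrite -scalemxAr -scalemxAl; apply: (f_equal (fun Z => _ *: Z)).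
by rewrite !mulmxA mulmxK.
Qed.

Lemma spinor_smooth V A s psi : is_spinor U psi -> adapted_spin_frame V A s ->
  msmooth mfd V (fun y => psi (s y)).
Proof.
move=> [_ hpsi] as_; have [oV VU _ _] := as_ => k j; rewrite (ord1 j).
exact: hpsi oV VU (adapted_spin_frame_local as_) k.
Qed.

Lemma wfr_lin p (k : R) u v i j : U p ->
  w p (k *: u + v) i j = k * w p u i j + w p v i j.
Proof.
move=> Up; have [nabC _ _] := nab_ph; have [nabl _ _ _ _] := nabC U oU.
have se : smooth_vf mfd U (e i) by case: he.
by rewrite /wfr (nabl _ se p Up) metric_lin.
Qed.

Lemma nabS_lin psi p (k : R) u v : is_spinor U psi -> U (pr p) ->
  nabS p (k *: u + v) psi = k%:C%C *: nabS p u psi + nabS p v psi.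
Proof.
move=> hpsi Up; have [V [A [s [as_ Vp <-]]]] := spin_frame_through Up.
have [oV VU _ _] := as_.
rewrite !(nabS_frame _ hpsi as_ Vp).
rewrite (mder_lin Vp k u v (spinor_smooth hpsi as_)).
have G : cGamma (rotC A) (w (pr p) (k *: u + v)) =
    k%:C%C *: cGamma (rotC A) (w (pr p) u) + cGamma (rotC A) (w (pr p) v).
  by apply: cGamma_lin => i j; exact: wfr_lin (VU _ Vp).
have aux (a b y : 'cV[K]_N) l (G1 G2 G3 : 'M[K]_N) : G1 = l *: G2 + G3 ->
    l *: a + b + G1 *m y = l *: (a + G2 *m y) + (b + G3 *m y).
  by move=> ->; rewrite mulmxDl -scalemxAl scalerDr addrACA.
exact: aux G.
Qed.

(** For constant g the section s g is again a spin frame of the same kind, over e (A B) with B the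
    image of g. Computed in it, the derivative part picks up [invmx g] and the connection matrix is
    conjugated by g. *)
Lemma nabS_act psi p g v : is_spinor U psi -> U (pr p) -> Spin c g ->
  nabS (act p g) v psi = invmx g *m nabS p v psi.
Proof.
move=> hpsi Up sg; have [V [A [s [as_ Vp sp]]]] := spin_frame_through Up.
have [B hB as'] := adapted_spin_frame_act as_ sg.
have [oV VU _ hs] := as_; have [ug _] := spin_cover_exists CR sg.
have BB := spin_cover_orthogonal p sg hB.
rewrite -{1 2}sp (nabS_frame v hpsi as_ Vp) (nabS_frame v hpsi as' Vp).
have E y : V y -> psi (act (s y) g) = invmx g *m psi (s y).
  by move=> Vy; apply: (proj1 hpsi) => //; have [-> _] := hs y Vy; exact: VU.
rewrite (mder_eq mfd v oV Vp (F := fun y => psi (act (s y) g))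
  (G := fun y => invmx g *m psi (s y))); last by move=> y; rewrite inE => /E.
rewrite (mderMl oV Vp v (invmx g) (spinor_smooth hpsi as_)) (E _ Vp).
rewrite (_ : rotC (A *m B) = fun i => invmx g *m rotC A i *m g); last first.
  apply/funext => i; rewrite /rotC -(clifford_vec_conj CR (A i) sg hB BB).
  congr clifford_vec; apply/funext => a; rewrite mxE.
  by apply: eq_bigr => b _; rewrite mulrC.
by rewrite cGamma_conj // mulmxDr !mulmxA mulmxK.
Qed.

(** [is_spin_connection] describes [nabS] on spinors only, so second derivatives become accessible
    through this. Smoothness is demanded in all local spin frames, including those over frames
    rotated by a varying matrix; there the defining formula is used in place of [nabS_frame]. *)
Lemma cov_spinor X psi : smooth_vf mfd U X -> is_spinor U psi ->
  is_spinor U (cov nabS X psi).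
Proof.
move=> sX hpsi; split=> [p g Up sg|V e' s oV VU hs k].
  by rewrite /cov spin_pr_act // nabS_act.
pose G x := mder mfd (X x) (fun y => psi (s y)) x + 4^-1 *: \sum_a \sum_b
  (metric x (nab x (X x) (e' a)) (e' b x))%:C%C *: (c a *m c b *m psi (s x)).
have [[se hSO] _ ps] := hs.
have sX' : smooth_vf mfd V X by exact: smooth_vf_subset VU sX.
have spsi : msmooth mfd V (fun y => psi (s y)).
  by move=> i j; rewrite (ord1 j); exact: (proj2 hpsi) oV VU hs i.
apply: (@csmooth_eq _ _ _ mfd V (fun x => G x k 0)) => //.
  move=> x; rewrite inE => Vx.
  rewrite /cov (nabS_spin oU hpsi oV VU hs Vx); have [-> _] := ps x Vx.
  apply: (f_equal (fun Z : 'cV[K]_N => Z k 0)); apply: (f_equal (fun Z => Z + _)).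
  by apply/matrixP => i j; rewrite !mxE (ord1 j).
have [nabC _ _] := nab_ph; have [_ _ _ _ nabs] := nabC V oV.
suff: msmooth mfd V G by exact.
apply: (msmoothD oV); first exact: mder_smooth.
apply: (msmoothZ oV); first exact: csmooth_cst.
apply: (msmooth_sum _ oV) => a; apply: (msmooth_sum _ oV) => b.
apply: (msmoothZ oV); last exact: (msmoothM oV (msmooth_cst mfd V (c a *m c b)) spsi).
apply: csmooth_real; apply: (smooth_metric oV (nabs X (e' a) sX' (se a)) (se b)).
by move=> q Vq; have [[h _] _] := hSO q Vq; exact: h.
Qed.

Lemma clinear_sum a b (f : 'rV[R]_m -> 'M[K]_(a, b)) k (r : 'I_k -> R) (u : 'I_k -> 'rV[R]_m) :
  (forall (l : R) x y, f (l *: x + y) = l%:C%C *: f x + f y) ->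
  f (\sum_i r i *: u i) = \sum_i (r i)%:C%C *: f (u i).
Proof.
move=> fl.
have f0 : f 0 = 0.
  have := fl 1 0 0; rewrite scaler0 addr0 scale1r.
  by move/(f_equal (fun Z => Z - f 0)); rewrite addrK subrr.
elim: (index_enum _) => [|i s IH]; first by rewrite !big_nil.
by rewrite !big_cons fl IH.
Qed.

Lemma cliff_lin (p : P) (k : R) u v :
  cliff p (k *: u + v) = k%:C%C *: cliff p u + cliff p v.
Proof.
rewrite /cliff /clifford_vec scaler_sumr -big_split; apply: eq_bigr => a _ /=.
rewrite metric_lin (rmorphD (real_complex R)) (rmorphM (real_complex R)).
by rewrite scalerDl scalerA.
Qed.

Lemma orthogonal_sum2 (A : 'M[R]_(n + n)) a b d (L : I -> 'M[K]_(a, b))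
    (L' : I -> 'M[K]_(b, d)) : A *m A^T = 1%:M ->
  \sum_k (\sum_i (A i k)%:C%C *: L i) *m (\sum_j (A j k)%:C%C *: L' j) =
  \sum_i L i *m L' i.
Proof.
move=> AA.
transitivity (\sum_i \sum_j (((A *m A^T) i j)%:C%C) *: (L i *m L' j)).
  under eq_bigr do rewrite mulmx_suml.
  rewrite exchange_big; apply: eq_bigr => i _ /=.
  under eq_bigr do rewrite mulmx_sumr.
  rewrite exchange_big; apply: eq_bigr => j _ /=.
  rewrite mxE (rmorph_sum (real_complex R)) scaler_suml; apply: eq_bigr => k _.
  by rewrite mxE (rmorphM (real_complex R)) -scalemxAl -scalemxAr scalerA.
apply: eq_bigr => i _; rewrite AA (bigD1 i) //= mxE eqxx scale1r.
rewrite big1 ?addr0 // => j /negbTE ji.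
by rewrite mxE eq_sym ji scale0r.
Qed.

(** The summand is bilinear in the basis vector, so the sum is the same for the bases [fr p] and
    [e], which differ by an orthogonal matrix. *)
Lemma contact_dirac_frame psi p : is_spinor U psi -> U (pr p) ->
  contact_dirac nabS psi p = \sum_i cliff p (e i (pr p)) *m cov nabS (e i) psi p.
Proof.
move=> hpsi Up; have [V [A [s [as_ Vp sp]]]] := spin_frame_through Up.
have AA := adapted_spin_frame_orthogonal as_ Vp.
have [oV VU _ hs] := as_; have [_ fs] := hs _ Vp; rewrite sp in fs.
rewrite /contact_dirac /cov -[RHS](orthogonal_sum2 _ _ AA); apply: eq_bigr => a _.
rewrite fs /frame_act (clinear_sum _ _ (cliff_lin p)).
by rewrite (clinear_sum _ _ (fun k u v => nabS_lin k u v hpsi Up)).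
Qed.

Lemma is_spinor_eq psi psi' : (forall p, U (pr p) -> psi p = psi' p) ->
  is_spinor U psi -> is_spinor U psi'.
Proof.
move=> E [h1 h2]; split=> [p g Up sg|V e' s oV VU hs k].
  by rewrite -!E ?spin_pr_act //; exact: h1.
have [_ _ ps] := hs.
apply: (csmooth_eq oV _ (h2 V e' s oV VU hs k)) => x; rewrite inE => Vx.
by rewrite E //; have [-> _] := ps x Vx; exact: VU.
Qed.

(** Makes the image of the Dirac operator a legitimate argument of [nabS], as its square
    requires. *)
Lemma contact_dirac_spinor psi : is_spinor U psi ->
  is_spinor U (contact_dirac nabS psi).
Proof.
move=> hpsi.
have se i : smooth_vf mfd U (e i) by case: he.
apply: (is_spinor_eq (fun p Up => esym (contact_dirac_frame hpsi Up))).
have hc i := cov_spinor (se i) hpsi.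
split=> [p g Up sg|V e' s oV VU hs k].
  have [ug _] := spin_cover_exists CR sg.
  rewrite mulmx_sumr spin_pr_act //; apply: eq_bigr => i _.
  rewrite (proj1 (hc i) p g Up sg) (cliff_act CR _ _ sg).
  by rewrite !mulmxA mulmxK.
have [[se' hSO] _ ps] := hs.
pose G x := \sum_i (\sum_a (metric x (e i x) (e' a x))%:C%C *: c a) *m
  cov nabS (e i) psi (s x).
have EG x : V x -> \sum_i cliff (s x) (e i (pr (s x))) *m cov nabS (e i) psi (s x) = G x.
  by move=> Vx; have [px fx] := ps x Vx; rewrite /cliff px fx.
suff sG : msmooth mfd V G.
  apply: (csmooth_eq oV _ (sG k 0)) => x; rewrite inE => Vx.
  exact: (f_equal (fun Z : 'cV[K]_N => Z k 0) (esym (EG x Vx))).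
apply: (msmooth_sum _ oV) => i; apply: (msmoothM oV); last first.
  by move=> k' j; rewrite (ord1 j); exact: (proj2 (hc i)) oV VU hs k'.
apply: (msmooth_sum _ oV) => a; apply: (msmoothZ oV); last exact: msmooth_cst.
apply: csmooth_real; apply: (smooth_metric oV _ (se' a)).
  exact: smooth_vf_subset VU (se i).
by move=> q Vq; have [[h _] _] := hSO q Vq; exact: h.
Qed.

End Connection.

End LocalSpinFrames.

(** * The square of the contact Dirac operator *)

Lemma Rc_frame {R : realType} {n : nat}
    (Om : 'I_n -> 'I_n -> 'I_(n + n) -> 'I_(n + n) -> R[i]) a b r t :
  Rc Om a b r t =
  Om a b (lshift n r) (lshift n t) + Om a b (rshift n r) (rshift n t) +
  Complex 0 1 * (Om a b (lshift n r) (rshift n t) - Om a b (rshift n r) (lshift n t)).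
Proof.
rewrite /Rc /bext.
apply: (etrans (sum_tb r (fun i => \sum_j tcoef t j * Om a b i j))).
have E i : \sum_j tcoef t j * Om a b i j =
    Om a b i (lshift n t) + Complex 0 1 * Om a b i (rshift n t) := sum_t t _.
rewrite !E.
have ii2 : Complex 0 1 * Complex 0 1 = -1 :> R[i] := iiM (R := R).
move: (Om _ _ _ _) (Om _ _ _ _) (Om _ _ _ _) (Om _ _ _ _) (Complex 0 1) ii2
  => y4 y3 y2 y1 z zz.
have -> : y1 + z * y2 + - z * (y3 + z * y4) = y1 - (z * z) * y4 + z * (y2 - y3) by ring.
by rewrite zz mulN1r opprK.
Qed.

Section CliffordSums.
Context {R : realType} {n N : nat}.
Local Notation K := R[i].
Local Notation I := ('I_(n + n)).
Variable C : I -> 'M[K]_N.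
Hypothesis CR : clifford_relations C.

(** Exchanging i and j and replacing C_j C_i by - C_i C_j - 2 delta_ij gives a second expression for
    the sum; the claim is the mean of both. *)
Lemma clifford_square_split (H : I -> I -> 'cV[K]_N) :
  \sum_i \sum_j C i *m C j *m H i j =
  - \sum_i H i i + 2^-1 *: \sum_i \sum_j C i *m C j *m (H i j - H j i).
Proof.
set X := LHS.
have E : X = \sum_i \sum_j - (C i *m C j *m H j i) - (\sum_i H i i + \sum_i H i i).
  rewrite /X exchange_big -[\sum_i H i i + _]big_split -sumrB.
  apply: eq_bigr => i _ /=.
  transitivity (\sum_j (- (C i *m C j *m H j i) - (i == j)%:R *: (H j i + H j i))).
    apply: eq_bigr => j _; have := CR j i.
    move/(f_equal (fun Z => Z - C i *m C j)); rewrite addrK => ->.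
    rewrite mulmxBl mul_scalar_mx addrC eq_sym; congr (_ + _).
    by rewrite mulrC mulrN scaleNr -scalerA scalerDl scale1r.
  rewrite sumrB; congr (_ - _).
  rewrite (bigD1 i) //= eqxx scale1r big1 ?addr0 // => j /negbTE ji.
  by rewrite eq_sym ji scale0r.
have E2 : X + X = \sum_i \sum_j C i *m C j *m (H i j - H j i) -
    (\sum_i H i i + \sum_i H i i).
  rewrite {2}E addrA; congr (_ - _); rewrite /X -big_split; apply: eq_bigr => i _ /=.
  by rewrite -big_split; apply: eq_bigr => j _ /=; rewrite mulmxBr.
by rewrite -[LHS]half_half E2 scalerBr half_half addrC.
Qed.

(** The commutator contributes sum_j (nabla e_j) f_j, which by skewness of w equals - sum_j e_j
    sum_d w_jd f_d. This is the correction that turns nabla nabla_{e_j} into a second covariant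
    derivative. *)
Lemma dirac_commutator (G : 'M[K]_N) (w : I -> I -> R) (g f : I -> 'cV[K]_N) :
  (forall j, G *m C j - C j *m G = \sum_d (w j d)%:C%C *: C d) ->
  (forall i j, w i j = - w j i) ->
  \sum_j C j *m g j + G *m (\sum_j C j *m f j) =
  \sum_j C j *m (g j + G *m f j - \sum_d (w j d)%:C%C *: f d).
Proof.
move=> hG hw.
have E : G *m (\sum_j C j *m f j) = \sum_j C j *m (G *m f j) +
    \sum_j \sum_d (w j d)%:C%C *: (C d *m f j).
  rewrite mulmx_sumr -big_split; apply: eq_bigr => j _ /=.
  rewrite !mulmxA -[G *m C j](subrK (C j *m G)) hG addrC mulmxDl mulmx_suml.
  by congr (_ + _); apply: eq_bigr => d _; rewrite -scalemxAl.
rewrite E addrA exchange_big /= -!big_split; apply: eq_bigr => j _ /=.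
rewrite !mulmxDr; congr (_ + _ + _); rewrite mulmxN mulmx_sumr -sumrN.
apply: eq_bigr => d _.
by rewrite -scalemxAr hw (rmorphN (real_complex R)) scaleNr.
Qed.

(** Each b contributes 2 C_b C_{n+b} - 2 C_{n+b} C_b = 4 C_b C_{n+b}, and d vanishes on all other
    pairs. *)
Lemma clifford_symplectic_sum (d : I -> I -> R) :
  (forall a b : 'I_n, [/\ d (lshift n a) (lshift n b) = 0,
    d (lshift n a) (rshift n b) = 2 * (a == b)%:R,
    d (rshift n a) (lshift n b) = - (2 * (a == b)%:R) &
    d (rshift n a) (rshift n b) = 0]) ->
  2^-1 *: (\sum_i \sum_j (d i j)%:C%C *: (C i *m C j)) =
  2 *: \sum_(b < n) C (lshift n b) *m C (rshift n b).
Proof.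
move=> hd; rewrite sum_split2.
transitivity (2^-1 *: \sum_(a < n) 4 *: (C (lshift n a) *m C (rshift n a))).
  congr (_ *: _); apply: eq_bigr => a _.
  transitivity (\sum_(b < n) (b == a)%:R *: (4 *: (C (lshift n a) *m C (rshift n b)))).
    apply: eq_bigr => b _; have [-> -> -> ->] := hd a b.
    rewrite (rmorph0 (real_complex R)) !scale0r add0r addr0 eq_sym
      (rmorphN (real_complex R)).
    have -> : (2 * (b == a)%:R)%:C%C = 2 * (b == a)%:R :> K.
      by rewrite (rmorphM (real_complex R)) !(rmorph_nat (real_complex R)).
    have CC : C (rshift n a) *m C (lshift n b) = - (C (lshift n b) *m C (rshift n a)).
      apply/eqP; rewrite -addr_eq0 CR eq_rlshift mulr0.
      by rewrite (raddf0 (@scalar_mx K N)).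
    case: eqVneq CC => [<-|_] CC; last by rewrite !mulr0 oppr0 !scale0r addr0.
    rewrite CC !mulr1 scaleNr scalerN opprK -scalerDl scale1r.
    by congr (_ *: _); ring.
  exact: sum_delta.
rewrite -scaler_sumr scalerA; congr (_ *: _).
by field.
Qed.

End CliffordSums.

Section Weitzenboeck.
Context {R : realType} {n N : nat} {M : topologicalType}.
Local Notation m := (n + n).+1.
Local Notation K := R[i].
Local Notation I := ('I_(n + n)).
Variables (mfd : manifold R m M) (ph : pseudohermitian mfd).
Variable c : I -> 'M[K]_N.
Hypothesis CR : clifford_relations c.
Variable S : spin_structure ph c.
Local Notation P := (spin_total S).
Local Notation pr := (@spin_pr _ _ _ _ _ _ _ S).
Local Notation metric := (levi mfd (theta ph) (J ph)).
Local Notation T := (reeb ph).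
Variables (U : set M) (e : I -> M -> 'rV[R]_m).
Hypothesis oU : open U.
Hypothesis he : local_adapted_frame ph U e.
Variable nab : M -> 'rV[R]_m -> (M -> 'rV[R]_m) -> 'rV[R]_m.
Hypothesis nab_ph : is_ph_connection ph nab.
Variable nabS : P -> 'rV[R]_m -> (P -> 'cV[K]_N) -> 'cV[K]_N.
Hypothesis nabS_spin : is_spin_connection nab nabS.
Variables (om : 'I_n -> 'I_n -> M -> 'cV[K]_m) (A : 'I_n -> 'I_n -> M -> K).
Hypothesis hS : structure_equations ph U (thf ph e) om A.
Hypothesis nabZ : forall p, U p -> forall v a,
  Zvec (fun b => nab p v (e b)) a = \sum_b cev (om a b p) v *: Zvec (e ^~ p) b.
Variable phi : P -> 'cV[K]_N.
Hypothesis hphi : is_spinor U phi.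
Variables (V : set M) (B : 'M[R]_(n + n)) (s : M -> P) (x : M).
Hypothesis as_ : adapted_spin_frame U e V B s.
Hypothesis Vx : V x.

Local Notation C := (rotC c B).
Local Notation w := (wfr ph e nab).
Local Notation br i j := (bracket mfd (e i) (e j)).

Let oV : open V. Proof. by case: as_. Qed.
Let VU : V `<=` U. Proof. by case: as_. Qed.
Let prs y : V y -> pr (s y) = y. Proof. by case: as_ => _ _ _ h /h []. Qed.
Let CC : clifford_relations C.
Proof. exact (rotC_relations CR (adapted_spin_frame_orthogonal he as_ Vx)). Qed.
Let se i : smooth_vf mfd U (e i). Proof. by case: he. Qed.
Let seV i : smooth_vf mfd V (e i). Proof. exact: smooth_vf_subset VU (se i). Qed.
Let hcov i : is_spinor U (cov nabS (e i) phi).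
Proof. exact (cov_spinor CR oU he nab_ph nabS_spin (se i) hphi). Qed.

Let F y := phi (s y).
Let f j y := cov nabS (e j) phi (s y).

Let smF : msmooth mfd V F. Proof. exact (spinor_smooth he hphi as_). Qed.
Let smf j : msmooth mfd V (f j). Proof. exact (spinor_smooth he (hcov j) as_). Qed.

Lemma nabS_nab v j : nabS (s x) (nab x v (e j)) phi =
  \sum_d (w x v j d)%:C%C *: f d x.
Proof.
have Ux := VU Vx.
rewrite (nab_expand he nabZ v j Ux).
have Us : U (pr (s x)) by rewrite prs //; exact: VU.
rewrite (clinear_sum _ _ (fun k u v => nabS_lin oU he nab_ph nabS_spin k u v hphi Us)).
by rewrite /f /cov prs.
Qed.

(** Along the spin frame the Dirac operator has the constant coefficients C_j, so the derivative
    passes through them, and the connection matrix is moved past C_j by [dirac_commutator]. *)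
Lemma nabS_dirac v : nabS (s x) v (contact_dirac nabS phi) =
  \sum_j C j *m (nabS (s x) v (cov nabS (e j) phi) -
                 nabS (s x) (nab x v (e j)) phi).
Proof.
have hD := contact_dirac_spinor CR oU he nab_ph nabS_spin hphi.
have D y : V y -> contact_dirac nabS phi (s y) = \sum_j C j *m f j y.
  move=> Vy; have Us : U (pr (s y)) by rewrite prs //; exact: VU.
  rewrite (contact_dirac_frame oU he nab_ph nabS_spin hphi Us).
  by apply: eq_bigr => j _; rewrite prs // (cliff_frame he j as_ Vy).
rewrite (nabS_frame oU he nab_ph nabS_spin v hD as_ Vx) (D x Vx).
rewrite (mder_eq mfd v oV Vx (F := fun y => contact_dirac nabS phi (s y))
  (G := fun y => \sum_j C j *m f j y)); last by move=> y; rewrite inE => /D.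
rewrite (mder_sum oV Vx v _ (fun j => msmoothM oV (msmooth_cst mfd V (C j)) (smf j))).
under eq_bigr do rewrite (mderMl oV Vx v (C _) (smf _)).
have w_skew i j := wfr_skew he hS nabZ v i j (VU Vx).
rewrite (dirac_commutator _ _ (cGamma_comm CC w_skew) w_skew).
apply: eq_bigr => j _; rewrite nabS_nab.
by rewrite (nabS_frame oU he nab_ph nabS_spin v (hcov j) as_ Vx).
Qed.

Lemma dirac_square : contact_dirac nabS (contact_dirac nabS phi) (s x) =
  \sum_i \sum_j C i *m C j *m cov2 nab nabS (e i) (e j) phi (s x).
Proof.
have hD := contact_dirac_spinor CR oU he nab_ph nabS_spin hphi.
have Us : U (pr (s x)) by rewrite prs //; exact: VU.
rewrite (contact_dirac_frame oU he nab_ph nabS_spin hD Us); apply: eq_bigr => i _.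
rewrite /cov prs // (cliff_frame he i as_ Vx) nabS_dirac mulmx_sumr.
apply: eq_bigr => j _.
by rewrite /cov2 /cov prs // mulmxA.
Qed.

Local Notation G := (cG C).
Local Notation Om := (Omfr mfd e om).

Let Gam j y := \sum_a \sum_b ofr e om a b j y *: G a b.

Let smG j : msmooth mfd V (Gam j).
Proof.
apply: (msmooth_sum _ oV) => a; apply: (msmooth_sum _ oV) => b.
apply: (msmoothZ oV _ (msmooth_cst mfd V (G a b))).
exact: csmooth_subset VU (ofr_smooth oU he hS a b j).
Qed.

Lemma cGamma_frame y v : U y -> cGamma C (w y v) =
  \sum_a \sum_b cev (om a b y) v *: G a b.
Proof.
move=> Uy.
exact (cGamma_om C (fun a b => wfr_lshift he nabZ v a b Uy)
  (fun a b => wfr_rshift he nabZ v a b Uy) (fun a b => om_skew hS a b v Uy)).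
Qed.

Let f_frame j y : V y -> f j y = mder mfd (e j y) F y + Gam j y *m F y.
Proof.
move=> Vy; rewrite /f /cov prs // (nabS_frame oU he nab_ph nabS_spin _ hphi as_ Vy).
by rewrite cGamma_frame //; exact: VU.
Qed.

Let DGam i j := \sum_a \sum_b cder mfd (e i x) (ofr e om a b j) x *: G a b.

Lemma mder_Gam i j : mder mfd (e i x) (Gam j) x = DGam i j.
Proof.
rewrite (mder_sum oV Vx); last first.
  move=> a; apply: (msmooth_sum _ oV) => b.
  apply: (msmoothZ oV _ (msmooth_cst mfd V (G a b))).
  exact: csmooth_subset VU (ofr_smooth oU he hS a b j).
apply: eq_bigr => a _; rewrite (mder_sum oV Vx); last first.
  move=> b; apply: (msmoothZ oV _ (msmooth_cst mfd V (G a b))).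
  exact: csmooth_subset VU (ofr_smooth oU he hS a b j).
apply: eq_bigr => b _; apply: (mderZ oV Vx).
exact: csmooth_subset VU (ofr_smooth oU he hS a b j).
Qed.

Lemma nabS_cov i j : nabS (s x) (e i x) (cov nabS (e j) phi) =
  mder mfd (e i x) (fun y => mder mfd (e j y) F y) x + DGam i j *m F x +
  Gam j x *m mder mfd (e i x) F x +
  Gam i x *m (mder mfd (e j x) F x + Gam j x *m F x).
Proof.
rewrite (nabS_frame oU he nab_ph nabS_spin (e i x) (hcov j) as_ Vx).
rewrite (cGamma_frame (e i x) (VU Vx)).
have sd := mder_smooth oV (seV j) smF.
apply: (f_equal2 (fun Y Z : 'cV[K]_N => Y + _ *m Z)); last exact: f_frame.
rewrite (mder_eq mfd (e i x) oV Vx (F := f j)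
  (G := fun y => mder mfd (e j y) F y + Gam j y *m F y)); last first.
  by move=> y; rewrite inE; exact: f_frame.
rewrite (mderD oV Vx (e i x) sd (msmoothM oV (smG j) smF)).
by rewrite (mderM oV Vx (e i x) (smG j) smF) mder_Gam addrA.
Qed.

(** By [bracket_nab] the two vectors differ by [e_i, e_j] + dtheta(e_i, e_j) T. The bracket part
    will cancel against the commutator of second derivatives of F; the T part stays. *)
Lemma nabS_bracket i j :
  nabS (s x) (nab x (e i x) (e j)) phi - nabS (s x) (nab x (e j x) (e i)) phi =
  mder mfd (br i j x) F x + (\sum_a \sum_b cev (om a b x) (br i j x) *: G a b) *m F x +
  (dthfr ph e i j x)%:C%C *: nabS (s x) (T x) phi.
Proof.
have Us : U (pr (s x)) by rewrite prs //; exact: VU.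
have lin k u v := nabS_lin oU he nab_ph nabS_spin k u v hphi Us.
have b := bracket_nab oU he hS nabZ i j (VU Vx).
have E : nab x (e i x) (e j) = 1 *: nab x (e j x) (e i) +
    (dthfr ph e i j x *: T x + br i j x).
  have aux (u v y z : 'rV[R]_m) : z = u - v - y -> u = 1 *: v + (y + z).
    by move=> ->; apply/matrixP => k l; rewrite !mxE; ring.
  exact: aux b.
have aux (y1 y2 y3 : 'cV[K]_N) : (1 : R)%:C%C *: y1 + (y2 + y3) - y1 = y3 + y2.
  by rewrite scale1r addrC addKr addrC.
rewrite E (lin 1) (lin (dthfr ph e i j x)) aux.
rewrite (nabS_frame oU he nab_ph nabS_spin (br i j x) hphi as_ Vx).
by rewrite (cGamma_frame _ (VU Vx)).
Qed.

Lemma cov2_commutator i j :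
  cov2 nab nabS (e i) (e j) phi (s x) - cov2 nab nabS (e j) (e i) phi (s x) =
  (\sum_a \sum_b Om a b i j x *: G a b) *m phi (s x) -
  (dthfr ph e i j x)%:C%C *: nabS (s x) (T x) phi.
Proof.
have b := nabS_bracket i j.
have mb := mder_bracket oV Vx (seV i) (seV j) smF.
have cov2E k l : cov2 nab nabS (e k) (e l) phi (s x) =
    nabS (s x) (e k x) (cov nabS (e l) phi) - nabS (s x) (nab x (e k x) (e l)) phi.
  by rewrite /cov2 /cov prs.
(* The curvature form in the frame: [cG_curvature] identifies its quadratic part with the commutator
   of the connection matrices. *)
have -> : \sum_a \sum_b Om a b i j x *: G a b =
    DGam i j - DGam j i + (Gam i x *m Gam j x - Gam j x *m Gam i x) -
    \sum_a \sum_b cev (om a b x) (br i j x) *: G a b.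
  rewrite (cG_curvature CC) -!sumrB -big_split -sumrB; apply: eq_bigr => a _ /=.
  rewrite -!sumrB -big_split -sumrB; apply: eq_bigr => d _ /=.
  rewrite (curvature_frame oU he hS a d i j (VU Vx)).
  rewrite -!scalerBl -scalerDl -scalerBl; congr (_ *: _).
  by rewrite addrAC.
rewrite !cov2E !nabS_cov.
have aux (p q mij mji u v y t bF : 'cV[K]_N) (gi gj dij dji g : 'M[K]_N) :
    p - q = bF + g *m y + t -> bF = mij - mji ->
    mij + dij *m y + gj *m u + gi *m (v + gj *m y) - p -
    (mji + dji *m y + gi *m v + gj *m (u + gi *m y) - q) =
    (dij - dji + (gi *m gj - gj *m gi) - g) *m y - t.
  move=> hp hb; have -> : p = q + (bF + g *m y + t) by rewrite -hp addrC subrK.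
  rewrite hb !(mulmxDl, mulNmx, mulmxDr) !mulmxA.
  move: (gi *m gj *m y) (gj *m gi *m y) (g *m y) (dij *m y) (dji *m y) (gj *m u)
    (gi *m v) => z1 z2 z3 z4 z5 z6 z7.
  by apply/matrixP => k l; rewrite !mxE; ring.
exact: aux b mb.
Qed.

Lemma dthfr_frame a b : [/\ dthfr ph e (lshift n a) (lshift n b) x = 0,
  dthfr ph e (lshift n a) (rshift n b) x = 2 * (a == b)%:R,
  dthfr ph e (rshift n a) (lshift n b) x = - (2 * (a == b)%:R) &
  dthfr ph e (rshift n a) (rshift n b) x = 0].
Proof.
have aE : adapted ph x (e ^~ x) by case: he => _; apply; exact: VU.
have [[_ E1] _] := aE.
have dr u d : dform mfd (theta ph) x u (e (rshift n d) x) =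
  2 * metric x u (e (lshift n d) x) := dth_rshift aE u d.
have dl u d : dform mfd (theta ph) x u (e (lshift n d) x) =
  - 2 * metric x u (e (rshift n d) x) := dth_lshift aE u d.
rewrite /dthfr !dr !dl !E1 eq_lrshift eq_rlshift !mulr0 mulNr.
by rewrite (inj_eq (@lshift_inj _ _)) (inj_eq (@rshift_inj _ _)).
Qed.

Lemma webster_Rc a b r t : webster_curvature mfd e om a b r t x =
  4^-1 * Rc (fun a b i j => Om a b i j x) a b r t.
Proof.
apply: (etrans (webster_frame oU hS _ _ _ _ (VU Vx))).
exact: (f_equal (fun z => 4^-1 * z) (esym (Rc_frame (fun a b i j => Om a b i j x) a b r t))).
Qed.

Lemma weitzenboeck_frame (W : R) :
  W%:C%C = \sum_a \sum_g webster_curvature mfd e om g g a a x ->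
  contact_dirac nabS (contact_dirac nabS phi) (s x) =
  - \sum_a cov2 nab nabS (e a) (e a) phi (s x) + W%:C%C *: phi (s x) -
  2 *: \sum_(b < n) C (lshift n b) *m C (rshift n b) *m nabS (s x) (T x) phi.
Proof.
move=> hW; rewrite dirac_square (clifford_square_split CC) -addrA.
apply: (f_equal (fun Z => _ + Z)).
set y := nabS (s x) (T x) phi.
pose d i j := dthfr ph e i j x.
pose O i j := \sum_a \sum_b Om a b i j x *: G a b.
transitivity ((2^-1 *: \sum_i \sum_j C i *m C j *m O i j) *m phi (s x) -
    (2^-1 *: \sum_i \sum_j (d i j)%:C%C *: (C i *m C j)) *m y).
  rewrite -!scalemxAl -scalerBr; apply: (f_equal (fun Z => 2^-1 *: Z)).
  rewrite !mulmx_suml -sumrB; apply: eq_bigr => i _.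
  rewrite !mulmx_suml -sumrB; apply: eq_bigr => j _.
  by rewrite cov2_commutator mulmxBr mulmxA -scalemxAl -scalemxAr.
rewrite (clifford_symplectic_sum CC dthfr_frame).
have -> : (2 *: \sum_(b < n) C (lshift n b) *m C (rshift n b)) *m y =
    2 *: \sum_(b < n) C (lshift n b) *m C (rshift n b) *m y.
  by rewrite -scalemxAl mulmx_suml.
apply: (f_equal (fun Z => Z - _)).
apply: (etrans _ (mul_scalar_mx _ _)); apply: (f_equal (fun Z => Z *m _)).
rewrite hW.
have Ux := VU Vx.
rewrite (curvature_term CC (Om := fun a b i j => Om a b i j x) (A := fun a b => A a b x)).
- apply: (f_equal (@scalar_mx K N)); apply: eq_bigr => a _; apply: eq_bigr => g _.
  by rewrite webster_Rc.
- by move=> a b i j; exact: curvatureC.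
- by move=> a b i j; exact: (curvature_skew oU he hS).
- by move=> a b; exact: (torsion_sym he hS).
move=> b i j k; rewrite -!(dthfr_tcoef he _ _ Ux).
exact: (bianchi oU he hS b i j k Ux).
Qed.

End Weitzenboeck.

Theorem theorem2p7 (R : realType) (n : nat) (M : topologicalType)
    (mfd : manifold R (n + n).+1 M) (ph : pseudohermitian mfd)
    (N : nat) (c : 'I_(n + n) -> 'M[R[i]]_N)
    (c_relations : clifford_relations c)
    (c_irreducible : clifford_irreducible c)
    (S : spin_structure ph c)
    (nab : M -> 'rV[R]_(n + n).+1 -> (M -> 'rV[R]_(n + n).+1) ->
           'rV[R]_(n + n).+1)
    (nab_ph : is_ph_connection ph nab)
    (W : M -> R) (W_scalar : is_scalar_curvature ph W)
    (nabS : spin_total S -> 'rV[R]_(n + n).+1 ->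
            (spin_total S -> 'cV[R[i]]_N) -> 'cV[R[i]]_N)
    (nabS_spin : is_spin_connection nab nabS)
    (phi : spin_total S -> 'cV[R[i]]_N) (phi_spinor : is_spinor setT phi)
    (U : set M) (e : 'I_(n + n) -> M -> 'rV[R]_(n + n).+1)
    (U_open : open U) (e_adapted : local_adapted_frame ph U e)
    (p : spin_total S) (Up : U (spin_pr p)) :
  contact_dirac nabS (contact_dirac nabS phi) p =
    rough_laplacian nab nabS e phi p + (W (spin_pr p))%:C%C *: phi p -
    2 *: \sum_(b < n)
      (cliff p (e (lshift n b) (spin_pr p)) *m
       cliff p (e (rshift n b) (spin_pr p)) *m
       cov nabS (reeb ph) phi p).

Proof.
have phi_U : is_spinor U phi.
  case: phi_spinor => h1 h2; split=> [q g _|V f s oV _]; first exact: h1.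
  exact: h2.
have [V [A [s [as_ Vp <-]]]] := spin_frame_through U_open e_adapted Up.
have [_ _ nab_frame] := nab_ph.
(* The coframe [thf] of [e] serves both specifications: [nab_frame] yields the forms [om] and [B]
   for it, and [W_scalar] is then applied to these same forms. *)
have uth := thf_unitary e_adapted.
have [om [B [hS nabZ]]] := nab_frame U e _ U_open e_adapted uth.
have [_ VU _ hs] := as_.
have Us : spin_pr (s (spin_pr p)) = spin_pr p by have [] := hs _ Vp.
rewrite Us (weitzenboeck_frame c_relations U_open e_adapted nab_ph nabS_spin hS
  nabZ phi_U as_ Vp (W_scalar U e _ om B U_open e_adapted uth hS _ (VU _ Vp))).
rewrite /rough_laplacian /cov Us; congr (_ - _ *: _).
apply: eq_bigr => b _.
by rewrite !(cliff_frame e_adapted _ as_ Vp).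
Qed.
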